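(* Consider the Bernoulli model described in the context with $m=m_1=m_2$, and suppose that the noise assumption in the context is satisfied for some $U\ge2$. Let $k=k_{n,m}\to\infty$ be such that $0<k\le m^{1/3}$ and $k^{1/4}\sqrt{m/n}<\min(1,a)/2$, and suppose that $\Sigma\subset(0,U]$ contains the interval $[\sqrt{1-4\tau},1]$, where $\tau=\limsup_{n,m}k^{1/4}\sqrt{m/n}$. Let $0\le k_0<k$ satisfy $k_0=o(\sqrt k)$. Then for any $\alpha,\alpha'>0$ satisfying $0<2\alpha+\alpha'<1$, an honest confidence set for the model $\mathcal A(a,k)\otimes\Sigma$ at level $\alpha$ that adapts to the sub-model $\mathcal A(a,k_0)\otimes\Sigma$ at level $\alpha'$ does not exist. In fact, if $\alpha<1/3$, we have for every honest confidence set $C_n$ for the model $\mathcal A(a,k)\otimes\Sigma$ at level $\alpha$ and a constant $c=c(a,U,\alpha)>0$ that $$\sup_{(M_0,\sigma)\in\mathcal A(a,k_0)\otimes\Sigma}\mathbb E_{M_0,\sigma}|C_n|_F^2\ge c\,\frac{m^3\sqrt k}{n}.$$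
   Context: Notation. $\|\cdot\|_F$ is the Frobenius norm, $\|A\|_\infty=\max_{i,j}|A_{ij}|$, $\mathcal A(a,k)=\{A\in\mathbb R^{m\times m}:\|A\|_\infty\le a,\ \mathrm{rank}(A)\le k\}$ with $a>0$ (so $\mathcal A(a,0)=\{0\}$), and $\mathcal A(a,k)\otimes\Sigma=\{(A,\sigma):A\in\mathcal A(a,k),\sigma\in\Sigma\}$. For $S\subset\mathcal A(a,k)\otimes\Sigma$, $|S|_F=\sup\{\|A-A'\|_F:(A,\sigma),(A',\sigma')\in S\}$ is the Frobenius diameter (only the matrix components enter). Bernoulli model (square case). Given $n\le m^2$, put $p=n/m^2$; the $B_{ij}$ are i.i.d. Bernoulli($p$), independent of the noise $(\epsilon_{ij})$, and one observes $Y_{ij}=B_{ij}(M_{ij}+\epsilon_{ij})$ (together with $B_{ij}$) for $1\le i,j\le m$. $\mathbb P_{M,\sigma},\mathbb E_{M,\sigma}$ are the law of the data and the expectation with matrix $M$ and noise variance $\sigma^2$. Noise assumption (with constant $U>0$): the $\epsilon_{ij}$ are independent (not necessarily identically distributed), $\mathbb E\epsilon_{ij}=0$, $\mathbb E\epsilon_{ij}^2=\sigma^2$, and $\max_{i,j}|\epsilon_{ij}|\le U$ almost surely. The noise law is otherwise unspecified and may depend on $M$; infima and suprema over $(M,\sigma)$ are understood to range also over the noise laws satisfying this assumption. Asymptotics: $\min(n,m)\to\infty$ with $n\le m^2$; $k,k_0$ depend on $(n,m)$, and $\limsup_{n,m}$ is taken in this regime. Honest and adaptive confidence sets. A confidence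 set is a set $C_n\subset\mathcal A(a,k)\otimes\Sigma$ depending on the data. It is honest at level $\alpha$ for $\mathcal A(a,k)\otimes\Sigma$ if $\liminf\inf_{(M,\sigma)\in\mathcal A(a,k)\otimes\Sigma}\mathbb P_{M,\sigma}((M,\sigma)\in C_n)\ge1-\alpha$, the $\liminf$ being as $\min(n,m)\to\infty$. It adapts to the sub-model $\mathcal A(a,k_0)\otimes\Sigma$ at level $\alpha'$ if there is a constant $K=K(\alpha,\alpha')>0$ such that for both $l=k_0$ and $l=k$, $$\sup_{(M,\sigma)\in\mathcal A(a,l)\otimes\Sigma}\mathbb P_{M,\sigma}\big(|C_n|_F>K\,r_{n,m}(l)\big)\le\alpha',$$ where $r_{n,m}(l)$ is the minimax rate of estimation over $\mathcal A(a,l)\otimes\Sigma$ in Frobenius norm, i.e. $\inf_{\tilde M}\sup_{(M,\sigma)\in\mathcal A(a,l)\otimes\Sigma}\mathbb E_{M,\sigma}\|\tilde M-M\|_F\asymp r_{n,m}(l)$ (infimum over all estimators); this rate is, at most up to a log-factor, of order $\sqrt{m^2\cdot l\cdot 2m/n}$.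
   Formalization: When τ=0 the interval [√(1-4τ),1] is the single point 1 and the claim fails for Σ={1} (known variance), so Σ is also required to contain [s,1] for some s<1; this is automatic when τ>0. *)

(* Defs.v *)
From HB Require Import structures.
From mathcomp Require Import all_boot all_order all_algebra.
From mathcomp Require Import all_classical all_reals all_analysis.

Set Implicit Arguments.
Unset Strict Implicit.
Unset Printing Implicit Defensive.

Import Order.TTheory GRing.Theory Num.Theory.
Import numFieldNormedType.Exports.

Local Open Scope classical_set_scope.
Local Open Scope ring_scope.

Definition frob_norm (R : realType) (m : nat) (A : 'M[R]_m) : R :=
  Num.sqrt (\sum_i \sum_j A i j ^+ 2).

(* The norm `|A| on matrices is max_{i,j} |A i j|. *)
Definition lowrank (R : realType) (m : nat) (a : R) (k : nat) : set 'M[R]_m :=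
  [set A | `|A| <= a /\ (\rank A <= k)%N].

(* Pairs (M, sigma); sigma is the standard deviation of the noise. *)
Definition model (R : realType) (m : nat) (a : R) (k : nat) (Sigma : set R) :
  set ('M[R]_m * R) := lowrank a k `*` Sigma.

(* sup is 0 on the empty set; the model is bounded, so on its subsets sup is
   never applied to an unbounded set. *)
Definition frob_diam (R : realType) (m : nat) (S : set ('M[R]_m * R)) : R :=
  sup [set x | exists th th', [/\ S th, S th' & x = frob_norm (th.1 - th'.1)]].

(* An experiment carries the noise law, which is otherwise unspecified: inf and
   sup over the noise laws are taken over all experiments with given n, m, U
   and sigma. Joint independence of the 2 m^2 variables says at once that the
   B i j are independent, that the eps i j are independent, and that the two
   families are independent of each other. *)
Record experiment (R : realType) (n m : nat) (U sigma : R) := Experiment {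
  edisp : measure_display ;
  espace : measurableType edisp ;
  eprob : probability espace R ;
  eB : 'I_m -> 'I_m -> {RV eprob >-> bool} ;
  eeps : 'I_m -> 'I_m -> {RV eprob >-> R} ;
  eB_bernoulli : forall i j, eprob (eB i j @^-1` [set true]) =
    (n%:R / m%:R ^+ 2)%:E ;
  eindep : forall (E : 'I_m -> 'I_m -> set bool) (G : 'I_m -> 'I_m -> set R),
    (forall i j, measurable (E i j)) -> (forall i j, measurable (G i j)) ->
    eprob [set w | forall i j, E i j (eB i j w) /\ G i j (eeps i j w)] =
    (\prod_i \prod_j
       (eprob (eB i j @^-1` E i j) * eprob (eeps i j @^-1` G i j)))%E ;
  eeps_mean : forall i j, ('E_eprob[eeps i j] = 0)%E ;
  eeps_var : forall i j,
    ('E_eprob[(fun w => eeps i j w ^+ 2)%R] = (sigma ^+ 2)%:E)%E ;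
  eeps_bound : {ae eprob, forall w, forall i j, `|eeps i j w| <= U} }.

(* Entry (i, j) of the data is the pair (B i j, Y i j); the type carries the
   product sigma-algebra. *)
Definition data (R : realType) (m : nat) : Type :=
  m.-tuple (m.-tuple (bool * R)%type).

Definition observe (R : realType) (n m : nat) (U sigma : R)
    (X : experiment n m U sigma) (M : 'M[R]_m) (w : espace X) : data R m :=
  [tuple [tuple (eB X i j w, (eB X i j w)%:R * (M i j + eeps X i j w))
         | j < m] | i < m].

(* The probabilities P_{M,sigma}(ev (M, sigma)), for (M, sigma) in Theta and
   all admissible noise laws. *)
Definition probs (R : realType) (n m : nat) (U : R)
    (Theta : set ('M[R]_m * R)) (ev : 'M[R]_m * R -> set (data R m)) :
  set (\bar R) :=
  [set x | exists th, Theta th /\ exists X : experiment n m U th.2,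
     x = eprob X [set w | ev th (observe th.1 w)]].

Definition expectations (R : realType) (n m : nat) (U : R)
    (Theta : set ('M[R]_m * R)) (f : 'M[R]_m * R -> data R m -> R) :
  set (\bar R) :=
  [set x | exists th, Theta th /\ exists X : experiment n m U th.2,
     x = ('E_(eprob X)[(fun w => f th (observe (X := X) th.1 w))%R])%E].

Definition estimator (R : realType) (m : nat) : set (data R m -> 'M[R]_m) :=
  [set Mt | forall i j, measurable_fun setT (fun y => Mt y i j)].

Definition minimax_risk (R : realType) (n m : nat) (a U : R) (l : nat)
    (Sigma : set R) : \bar R :=
  ereal_inf [set ereal_sup (expectations n U (model a l Sigma)
                   (fun th y => frob_norm (Mt y - th.1)))
            | Mt in @estimator R m].

(* min(n, m) --> oo within a set D of pairs (n, m). *)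
Definition regime (D : set (nat * nat)) : set_system (nat * nat) :=
  within D (filter_prod \oo \oo).

Definition is_minimax_rate (R : realType) (a U : R) (Sigma : set R)
    (D : set (nat * nat)) (l : nat -> nat -> nat) (r : nat -> nat -> nat -> R) :
  Prop :=
  exists c1 c2 : R, [/\ 0 < c1, 0 < c2 &
    \forall nm \near regime D,
      let: (n, m) := nm in let risk := minimax_risk n m a U (l n m) Sigma in
      ((c1 * r n m (l n m))%:E <= risk)%E /\
      (risk <= (c2 * r n m (l n m))%:E)%E].

Definition confidence_procedure (R : realType) : Type :=
  forall n m : nat, data R m -> set ('M[R]_m * R).

Definition confidence_set (R : realType) (a : R) (Sigma : set R)
    (D : set (nat * nat)) (k : nat -> nat -> nat) (C : confidence_procedure R) :
  Prop :=
  forall n m, D (n, m) ->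
    [/\ forall y, C n m y `<=` model a (k n m) Sigma,
        forall th, measurable [set y | C n m y th] &
        measurable_fun setT (fun y => frob_diam (C n m y))].

Definition honest (R : realType) (a U : R) (Sigma : set R)
    (D : set (nat * nat)) (k : nat -> nat -> nat) (alpha : R)
    (C : confidence_procedure R) : Prop :=
  ((1 - alpha)%:E <=
   limf_einf (fun nm : nat * nat =>
     ereal_inf (probs nm.1 U (model a (k nm.1 nm.2) Sigma)
                  (fun th => [set y | C nm.1 nm.2 y th])))
     (regime D))%E.

Definition adaptive (R : realType) (a U : R) (Sigma : set R)
    (D : set (nat * nat)) (k k0 : nat -> nat -> nat)
    (r : nat -> nat -> nat -> R) (alpha' : R) (C : confidence_procedure R) :
  Prop :=
  exists2 K : R, 0 < K &
    forall n m, D (n, m) -> forall l, l = k0 n m \/ l = k n m ->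
      (ereal_sup (probs n U (model a l Sigma)
         (fun _ => [set y | K * r n m l < frob_diam (C n m y)]%R))
       <= alpha'%:E)%E.

(* The constraints cannot hold for all pairs (n, m) with n <= m^2 (they force
   m < n), so limits are taken within a set D of pairs on which they hold. *)
Record lower_bound_setting (R : realType) (a U : R) (Sigma : set R)
    (D : set (nat * nat)) (k k0 : nat -> nat -> nat) (tau : R) : Prop := {
  D_unbounded : forall N : nat, exists n m,
    [/\ D (n, m), (N <= n)%N & (N <= m)%N] ;
  D_n : forall n m, D (n, m) -> (0 < n <= m ^ 2)%N ;
  k_oo : (fun nm => k nm.1 nm.2) @ regime D --> \oo ;
  k_m : forall n m, D (n, m) ->
    (0 < k n m)%N /\ (k n m)%:R <= m%:R `^ (3^-1) :> R ;
  k_n : forall n m, D (n, m) ->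
    (k n m)%:R `^ (4^-1) * Num.sqrt (m%:R / n%:R) < Num.min 1 a / 2 :> R ;
  tau_limsup : limf_esup (fun nm : nat * nat =>
    ((k nm.1 nm.2)%:R `^ (4^-1) * Num.sqrt (nm.2%:R / nm.1%:R) : R)%:E)
    (regime D) = tau%:E ;
  Sigma_U : Sigma `<=` `]0, U] ;
  (* Num.sqrt is 0 on negative numbers, so with Sigma_U this forces tau < 1/4,
     without which the interval is not a subset of ]0, U]. *)
  Sigma_itv : `[Num.sqrt (1 - 4 * tau), 1] `<=` Sigma ;
  (* Follows from Sigma_itv if tau > 0. If tau = 0, that interval is the single
     point 1; without this condition Sigma = {1} would be allowed, that is, a
     known variance, for which the result fails. *)
  Sigma_nondeg : exists2 s : R, s < 1 & `[s, 1] `<=` Sigma ;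
  k0_k : forall n m, D (n, m) -> (k0 n m < k n m)%N ;
  (* k0 = o(sqrt k) *)
  k0_small : forall e : R, 0 < e -> \forall nm \near regime D,
    (k0 nm.1 nm.2)%:R <= e * Num.sqrt (k nm.1 nm.2)%:R }.

(* Main.v *)
(* A confidence set that contains both (0, 1) and (M, sigma) has diameter at
   least the norm of M. Take M = u * S with u of order k^(1/4) sqrt(m/n) and S a
   random m x m sign matrix of rank at most k, and choose the noise so that
   M + eps is always 1 or -1. Then sigma^2 = 1 - u^2, each observed entry is a
   sign of mean M i j, and under M = 0, sigma = 1 it is a fair sign. The
   chi-square divergence of the mixture over S from the null is
   E prod (1 + p u^2 S i j S' i j) - 1 for two independent copies S, S'; it is
   small when u / (k^(1/4) sqrt(m/n)) is. So under the null the diameter is at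
   least the Frobenius norm u m of M with probability about 1 - 2 alpha. This
   gives the bound on the expectation, as (u m)^2 is of order m^3 sqrt k / n.

   Adaptivity would give diameter O(r(k0)) under the null. The minimax risk at
   rank at most l is O(sqrt (l m^3 / n)), without a logarithm: a Gibbs estimator
   over a separated net satisfies it, because the mass of the net at distance D
   from the truth is controlled by counting codes obtained from rounding the two
   factors of a low-rank matrix. With k0 = o(sqrt k) this is o(u m). *)

Require Import Defs.
From HB Require Import structures.
From mathcomp Require Import all_boot all_order all_algebra.
From mathcomp Require Import all_classical all_reals all_analysis.
From mathcomp Require Import measurable_realfun.
From mathcomp Require Import ring lra zify.

Set Implicit Arguments.
Unset Strict Implicit.
Unset Printing Implicit Defensive.

Import Order.TTheory GRing.Theory Num.Theory.
Import numFieldNormedType.Exports.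

Local Open Scope classical_set_scope.
Local Open Scope ring_scope.

(** * Exponential moments of sign averages *)

(** The obstacle in the chi-square bound is that q = p u^2 satisfies q m = kap sqrt k, so q^2 m^2 =
    kap^2 k is unbounded. The m^2 products of entries of S and S' are uncorrelated signs, so
    replacing 1 + q s by exp (q s) would already lose a factor of order exp (q^2 m^2 / 2). Hence
    each factor keeps its normalization exp (- q^2 / 2), and the quadratic term of the exponential
    moment is carried with its exact constant 1/2 until the two cancel; what is left is of order
    kap^3. The same concern shapes the prior. With fixed column labels, both copies would give equal
    labels to the same m^2 / k or so pairs of columns, an error of order kap^4 k. Random shifts
    leave about m^2 / k^2 pairs that agree in both copies, an error of order kap^4. Cyclic shifts,
    unlike independent labels, also keep every label class of size at most [(m %/ k).+1], as the
    chaos bounds require. For the risk, no concentration inequality is used: ratios of Gibbs weights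
    are bounded in expectation from the first two moments of the noise, and their sum over the net
    is a sum over integer codes with geometric weights. *)

Section hyperbolic_cosine.
Variable R : realType.
Implicit Types x y z : R.

Lemma sinh_le_xcosh x : 0 <= x ->
  expR x - expR (- x) <= x * (expR x + expR (- x)).
Proof.
move=> x0; rewrite -subr_ge0.
pose f (y : R) := y * (expR y + expR (- y)) - (expR y - expR (- y)).
have fd y : is_derive y 1 f (y * (expR y - expR (- y))).
  have ? : is_derive y 1 (fun z : R => expR (- z)) (- expR (- y)).
    rewrite (_ : (fun z => expR (- z)) = expR \o -%R)//.
    by apply: is_derive_eq; rewrite mulrN1.
  by apply: is_derive_eq; rewrite /GRing.scale /=; ring.
have -> : x * (expR x + expR (- x)) - (expR x - expR (- x)) = f x by [].
have <- : f 0 = 0 by rewrite /f oppr0 !mul0r subrr subrr.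
apply: (@ger0_derive1_ndecry R f 0) => //.
- move=> y; rewrite in_itv /= andbT => y0.
  rewrite derive1E (@derive_val _ _ _ _ _ _ _ (fd y)).
  by rewrite mulr_ge0 ?(ltW y0)// subr_ge0 ler_expR; lra.
- apply: continuous_subspaceT => y.
  exact/differentiable_continuous/derivable1_diffP/(@ex_derive _ _ _ _ _ _ _ (fd y)).
Qed.

Lemma cosh_le_expR_sqr x : expR x + expR (- x) <= 2 * expR (x ^+ 2 / 2).
Proof.
wlog x0 : x / 0 <= x.
  move=> H; have [/H//|/ltW x0] := leP 0 x.
  by have := H (- x); rewrite opprK sqrrN addrC => -> //; lra.
(* The product of cosh y and exp (- y^2 / 2) decreases for y >= 0, since its logarithmic derivative
   is tanh y - y. The minus sign turns this into monotonicity. *)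
pose g (y : R) := - ((expR y + expR (- y)) * expR (- (y ^+ 2 / 2))).
have gd y : is_derive y 1 g
    ((y * (expR y + expR (- y)) - (expR y - expR (- y))) * expR (- (y ^+ 2 / 2))).
  have ? : is_derive y 1 (fun z : R => expR (- z)) (- expR (- y)).
    rewrite (_ : (fun z => expR (- z)) = expR \o -%R)//.
    by apply: is_derive_eq; rewrite mulrN1.
  have ? : is_derive y 1 (fun z : R => expR (- (z ^+ 2 / 2)))
      (- y * expR (- (y ^+ 2 / 2))).
    rewrite (_ : (fun z => expR (- (z ^+ 2 / 2))) =
      expR \o (fun z : R => - (z ^+ 2 / 2)))//.
    by apply: is_derive_eq; rewrite /GRing.scale /=; field.
  by apply: is_derive_eq; rewrite /GRing.scale /=; ring.
suff : g 0 <= g x.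
  rewrite /g lerN2 oppr0 expr0n mul0r oppr0 !expR0 mulr1 (expRN (x ^+ 2 / 2)).
  by rewrite ler_pdivrMr ?expR_gt0//.
apply: (@ger0_derive1_ndecry R g 0) => //.
- move=> y; rewrite in_itv /= andbT => y0.
  rewrite derive1E (@derive_val _ _ _ _ _ _ _ (gd y)).
  by rewrite mulr_ge0 ?expR_ge0// subr_ge0 sinh_le_xcosh// ltW.
- apply: continuous_subspaceT => y.
  exact/differentiable_continuous/derivable1_diffP/(@ex_derive _ _ _ _ _ _ _ (gd y)).
Qed.

End hyperbolic_cosine.

(** * Expectations under uniform laws on finite types *)

Section average.
Variable R : realType.

(** Expectation under the uniform law on [T]. On an empty type it is 0, hence the inhabitants passed
    to some of the lemmas below. *)
Definition avg (T : finType) (f : T -> R) : R := (\sum_x f x) / #|T|%:R.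

Lemma ler_avg (T : finType) (f g : T -> R) :
  (forall x, f x <= g x) -> avg f <= avg g.
Proof.
by move=> fg; rewrite /avg ler_wpM2r ?invr_ge0 ?ler0n// ler_sum.
Qed.

Lemma eq_avg (T : finType) (f g : T -> R) : f =1 g -> avg f = avg g.
Proof. by move=> fg; rewrite /avg (eq_bigr _ (fun x _ => fg x)). Qed.

Lemma avg_cst (T : finType) (x0 : T) (c : R) : avg (fun _ : T => c) = c.
Proof.
rewrite /avg sumr_const -[c *+ _]mulr_natr mulfK// pnatr_eq0 -lt0n.
by apply/card_gt0P; exists x0.
Qed.

Lemma avgZ (T : finType) (c : R) (f : T -> R) :
  avg (fun x => c * f x) = c * avg f.
Proof. by rewrite /avg -mulr_sumr mulrA. Qed.

Lemma avgD (T : finType) (f g : T -> R) :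
  avg (fun x => f x + g x) = avg f + avg g.
Proof. by rewrite /avg big_split mulrDl. Qed.

Lemma avg_ge0 (T : finType) (f : T -> R) : (forall x, 0 <= f x) -> 0 <= avg f.
Proof. by move=> f0; rewrite /avg divr_ge0 ?ler0n ?sumr_ge0. Qed.

Lemma exchange_avg (T T' : finType) (f : T -> T' -> R) :
  avg (fun x => avg (f x)) = avg (fun y => avg (f^~ y)).
Proof.
rewrite /avg -!mulr_suml exchange_big /=; ring.
Qed.

Lemma avg_pair (T T' : finType) (f : T * T' -> R) :
  avg f = avg (fun x => avg (fun y => f (x, y))).
Proof.
rewrite /avg -mulr_suml pair_big /= card_prod natrM invfM mulrA mulrAC.
by congr (_ / _ / _); apply: eq_bigr => -[].
Qed.

Lemma avg_le_avg_le (T : finType) (x0 : T) (f : T -> R) (c : R) :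
  (forall x, f x <= c) -> avg f <= c.
Proof. by move=> fc; rewrite -(avg_cst x0 c) ler_avg. Qed.

Definition upd (I T : finType) (f : {ffun I -> T}) (i : I) (a : T) :
  {ffun I -> T} := [ffun j => if j == i then a else f j].

(** Redrawing one coordinate independently does not change the uniform law. This allows randomness
    to be integrated out one coordinate at a time. *)
Lemma avg_resample (I T : finType) (t0 : T) (i : I) (F : {ffun I -> T} -> R) :
  avg (fun f => avg (fun a => F (upd f i a))) = avg F.
Proof.
have T0 : #|T|%:R != 0 :> R.
  by rewrite pnatr_eq0 -lt0n; apply/card_gt0P; exists t0.
rewrite -(avg_pair (fun fa => F (upd fa.1 i fa.2))).
(* Exchanging the coordinate at [i] with the fresh draw is a measure-preserving involution. *)
pose h (fa : {ffun I -> T} * T) := (upd fa.1 i fa.2, fa.1 i).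
have hK : involutive h.
  move=> [f a]; rewrite /h /=; congr pair; last by rewrite ffunE eqxx.
  by apply/ffunP => j; rewrite !ffunE; case: eqP => // ->.
rewrite -[RHS](_ : avg (fun fa : {ffun I -> T} * T => F fa.1) = _).
  rewrite /avg [in RHS](reindex_inj (inv_inj hK)).
  by [].
by rewrite avg_pair /=; apply: eq_avg => f; rewrite avg_cst.
Qed.

Lemma avg_bool (f : bool -> R) : avg f = (f true + f false) / 2.
Proof. by rewrite /avg big_bool card_bool. Qed.

Lemma avg_prod (I T : finType) (g : I -> T -> R) :
  avg (fun f : {ffun I -> T} => \prod_i g i (f i)) = \prod_i avg (g i).
Proof.
rewrite /avg -(bigA_distr_bigA g) card_ffun big_split /= prodr_const.
by rewrite natrX exprVn.
Qed.

End average.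

Section rademacher.
Variable R : realType.

Definition sgb (b : bool) : R := (-1) ^+ b.

Lemma sg_sqr b : sgb b * sgb b = 1.
Proof. by case: b; rewrite /sgb ?expr1 ?expr0; ring. Qed.

Lemma norm_sg b : `|sgb b| = 1.
Proof. by rewrite /sgb normrX normrN1 expr1n. Qed.

Lemma avg_expR_sg (y : R) : avg (fun b => expR (y * sgb b)) <= expR (y ^+ 2 / 2).
Proof.
by rewrite avg_bool /sgb expr0 expr1 mulr1 mulrN1 ler_pdivrMr// addrC mulrC
  cosh_le_expR_sqr.
Qed.

Lemma avg_expR_sum_sg (I : finType) (y : I -> R) :
  avg (fun r : {ffun I -> bool} => expR (\sum_i y i * sgb (r i))) <=
  expR ((\sum_i y i ^+ 2) / 2).
Proof.
under eq_avg do rewrite expR_sum.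
rewrite (avg_prod (fun i b => expR (y i * sgb b))) mulr_suml expR_sum.
by apply: ler_prod => i _; rewrite avg_expR_sg andbT avg_ge0.
Qed.

End rademacher.

(** * Rademacher chaos of order two *)

Section chaos.
Variable R : realType.
Local Notation sg := (sgb R).

Lemma dsum_setD1 (I : finType) (S : {set I}) (x : I) (F : I -> I -> R) :
  x \in S ->
  \sum_(i in S) \sum_(j in S) F i j =
  F x x + \sum_(j in S :\ x) (F x j + F j x) +
  \sum_(i in S :\ x) \sum_(j in S :\ x) F i j.
Proof.
move=> xS; have H i :
    \sum_(j in S) F i j = F i x + \sum_(j in S :\ x) F i j.
  exact: big_setD1.
by under eq_bigr do rewrite H; rewrite !big_split (big_setD1 x xS)/=;
  rewrite (big_setD1 x xS)/=; ring.
Qed.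

(** Schur test: weight a_i a_j <= (a_i^2 + a_j^2) / 2 by [|B i j|] and use the symmetry of [B]. *)
Lemma sum_mul_le_sqr (I : finType) (S : {set I}) (B : I -> I -> R) (a : I -> R)
    (rho : R) :
  (forall i j, B i j = B j i) ->
  (forall i, i \in S -> \sum_(j in S) `|B i j| <= rho) ->
  \sum_(i in S) \sum_(j in S) B i j * (a i * a j) <=
  rho * \sum_(i in S) a i ^+ 2.
Proof.
move=> Bs Br.
have H i j : B i j * (a i * a j) <=
    `|B i j| * a i ^+ 2 / 2 + `|B j i| * a j ^+ 2 / 2.
  rewrite (Bs j i) (le_trans (ler_norm _))// normrM -mulrDl -mulrDr -mulrA.
  rewrite ler_wpM2l// ler_pdivlMr// normrM.
  have := sqr_ge0 (`|a i| - `|a j|); rewrite sqrrB !real_normK ?num_real//.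
  lra.
apply: (le_trans (y := \sum_(i in S) \sum_(j in S)
    (`|B i j| * a i ^+ 2 / 2 + `|B j i| * a j ^+ 2 / 2))).
  by apply: ler_sum => i _; apply: ler_sum => j _; exact: H.
under eq_bigr do rewrite big_split/=.
rewrite big_split/= [X in _ + X]exchange_big/=.
suff H2 : \sum_(i in S) \sum_(j in S) `|B i j| * a i ^+ 2 / 2 <=
    (rho * \sum_(i in S) a i ^+ 2) / 2 by lra.
rewrite mulr_sumr mulr_suml; apply: ler_sum => i iS.
by rewrite -2!mulr_suml ler_wpM2r// ler_wpM2r ?sqr_ge0// Br.
Qed.

Lemma sum_sqr_le (I : finType) (S : {set I}) (a : I -> R) :
  \sum_(i in S) a i ^+ 2 <= (\sum_(i in S) `|a i|) ^+ 2.
Proof.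
rewrite expr2 mulr_suml; apply: ler_sum => i iS.
rewrite -[a i ^+ 2]real_normK ?num_real// expr2 ler_wpM2l//.
by rewrite (bigD1 i)//= lerDl sumr_ge0.
Qed.

(* Integrating out the sign of one index x replaces the matrix A by its
   rank-one update A i j + A x i * A x j, which by dominance keeps the row sums
   of the remaining block below those of A. *)
Lemma avg_expR_chaos (I : finType) (S : {set I}) (A : I -> I -> R) :
  (forall i j, A i j = A j i) -> (forall i, A i i = 0) ->
  (forall i, i \in S -> \sum_(j in S) `|A i j| <= 1 / 2) ->
  avg (fun r : {ffun I -> bool} =>
    expR ((\sum_(i in S) \sum_(j in S) A i j * (sg (r i) * sg (r j))) / 2)) <=
  expR (\sum_(i in S) \sum_(j in S) A i j ^+ 2).
Proof.
have [n] := ubnP #|S|; elim: n => // n IH in S A *.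
rewrite ltnS => Sn As A0 Ar.
have [->|/finset.set0Pn[x xS]] := eqVneq S finset.set0.
  rewrite finset.big_set0 expR0; under eq_avg do rewrite finset.big_set0 mul0r expR0.
  by rewrite (avg_cst [ffun=> true]).
pose S' := S :\ x; pose a j := A x j.
have S'n : (#|S'| < n)%N.
  by move: Sn; rewrite (cardsD1 x S) xS.
have aS' : \sum_(j in S') `|a j| <= 1 / 2.
  by have := Ar x xS; rewrite (big_setD1 x xS)/= A0 normr0 add0r.
have a2 : \sum_(j in S') a j ^+ 2 <= 1 / 4.
  apply: (le_trans (sum_sqr_le _ _)).
  have : 0 <= \sum_(j in S') `|a j| by rewrite sumr_ge0.
  move: aS'; move: (\sum_(j in S') `|a j|) => s s1 s0.
  have : s * s <= 1/2 * (1/2) by rewrite ler_pM.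
  by rewrite expr2; lra.
(* The diagonal of the update is removed because it does not depend on the signs: it is the factor
   exp (sum a_j^2 / 2) in [step]. *)
pose A' i j := A i j + (i != j)%:R * (a i * a j).
have A's i j : A' i j = A' j i by rewrite /A' As eq_sym [a i * _]mulrC.
have A'0 i : A' i i = 0 by rewrite /A' A0 eqxx mul0r addr0.
have A'r i : i \in S' -> \sum_(j in S') `|A' i j| <= 1 / 2.
  rewrite inE => /andP[ix iS]; apply: le_trans (Ar i iS).
  rewrite [leRHS](big_setD1 x xS)/= addrC.
  apply: (le_trans (y := \sum_(j in S') (`|A i j| + `|a i| * `|a j|))).
    apply: ler_sum => j _; rewrite /A' (le_trans (ler_normD _ _))// lerD2l.
    by case: (i != j); rewrite ?mul1r ?mul0r ?normr0 ?mulr_ge0// normrM.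
  rewrite big_split/= lerD2l -mulr_sumr (As i x).
  by rewrite ler_piMr// (le_trans aS')//; lra.
have {IH} := IH S' A' S'n A's A'0 A'r.
set E' := avg _ => IH.
have step : avg (fun r : {ffun I -> bool} =>
    expR ((\sum_(i in S) \sum_(j in S) A i j * (sg (r i) * sg (r j))) / 2)) <=
    expR ((\sum_(j in S') a j ^+ 2) / 2) * E'.
  rewrite -(avg_resample true x) -avgZ; apply: ler_avg => r.
  pose y := \sum_(j in S') a j * sg (r j).
  pose Q := (\sum_(i in S') \sum_(j in S') A i j * (sg (r i) * sg (r j))) / 2.
  have ur b j : j \in S' -> upd r x b j = r j.
    by rewrite ffunE in_setD1 => /andP[/negbTE->].
  rewrite (@eq_avg _ _ _ (fun b => expR Q * expR (y * sg b))); last first.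
    move=> b; rewrite -expRD; congr expR.
    rewrite (dsum_setD1 _ xS) A0 mul0r add0r.
    rewrite (eq_bigr (fun j => 2 * (a j * sg (r j) * sg b))); last first.
      move=> j jS'; rewrite (ur b j jS') ffunE eqxx (As j x) /a; ring.
    rewrite -mulr_sumr -mulr_suml -/y.
    rewrite (eq_bigr (fun i => \sum_(j in S') A i j * (sg (r i) * sg (r j)))).
      by rewrite mulrDl mulrAC mulfV// mul1r -/Q addrC.
    by move=> i iS'; apply: eq_bigr => j jS'; rewrite !ur.
  rewrite avgZ (le_trans (ler_wpM2l (expR_ge0 _) (avg_expR_sg _)))//.
  rewrite -!expRD ler_expR /Q -mulrDl -[leRHS]mulrDl ler_wpM2r//.
  suff -> : \sum_(i in S') \sum_(j in S') A' i j * (sg (r i) * sg (r j)) =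
      \sum_(i in S') \sum_(j in S') A i j * (sg (r i) * sg (r j)) +
      (y ^+ 2 - \sum_(j in S') a j ^+ 2) by lra.
  have -> : y ^+ 2 = \sum_(i in S') \sum_(j in S')
      a i * sg (r i) * (a j * sg (r j)).
    rewrite expr2 {1}/y mulr_suml; apply: eq_bigr => i _.
    by rewrite mulr_sumr.
  have K i : i \in S' -> a i ^+ 2 = \sum_(j in S') (i == j)%:R * a i ^+ 2.
    move=> iS'; rewrite (bigD1 i iS')/= eqxx mul1r big1 ?addr0// => j.
    by move=> /andP[_ ji]; rewrite eq_sym (negbTE ji) mul0r.
  rewrite (eq_bigr _ K) -sumrB -big_split/=; apply: eq_bigr => i iS'.
  rewrite -sumrB -big_split/=; apply: eq_bigr => j jS'; rewrite /A'.
  have [->|ij] := eqVneq i j; last by rewrite /=; ring.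
  by have := sg_sqr R (r j); rewrite /= => s1; ring: s1.
rewrite (le_trans step)// (le_trans (ler_wpM2l (expR_ge0 _) IH))//.
(* Row and column [x] provide 2 s with s = sum a_j^2. The cost is s / 2 from the diagonal, s from
   the cross terms of [A'] squared, and s^2 <= s / 4 from their squares: 7/4 s in all. *)
rewrite -expRD ler_expR (dsum_setD1 _ xS) A0 expr0n add0r.
have -> : \sum_(j in S :\ x) (A x j ^+ 2 + A j x ^+ 2) =
    2 * \sum_(j in S') a j ^+ 2.
  by rewrite mulr_sumr; apply: eq_bigr => j _; rewrite (As j x) /a; ring.
have : \sum_(i in S') \sum_(j in S') A' i j ^+ 2 <=
    \sum_(i in S') \sum_(j in S') A i j ^+ 2 +
    2 * (\sum_(i in S') \sum_(j in S') A i j * (a i * a j)) +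
    (\sum_(i in S') a i ^+ 2) ^+ 2.
  rewrite [_ ^+ 2 in leRHS]expr2 mulr_suml mulr_sumr -!big_split/=.
  apply: ler_sum => i _; rewrite !mulr_sumr -!big_split/=.
  apply: ler_sum => j _; rewrite /A'.
  have [->|ij] := eqVneq i j; last by rewrite /= mul1r; nra.
  by rewrite A0; have := sqr_ge0 (a j ^+ 2); rewrite /= expr2; nra.
have : \sum_(i in S') \sum_(j in S') A i j * (a i * a j) <=
    (1 / 2) * \sum_(i in S') a i ^+ 2.
  apply: sum_mul_le_sqr => // i; rewrite inE => /andP[ix iS].
  apply: le_trans (Ar i iS); rewrite [leRHS](big_setD1 x xS)/=.
  by rewrite lerDr.
have : (\sum_(i in S') a i ^+ 2) ^+ 2 <= 1 / 4 * \sum_(i in S') a i ^+ 2.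
  by rewrite expr2 ler_wpM2r// sumr_ge0// => i _; exact: sqr_ge0.
have : 0 <= \sum_(i in S') a i ^+ 2.
  by rewrite sumr_ge0// => i _; exact: sqr_ge0.
rewrite -/S'; lra.
Qed.
End chaos.

Section expR_bounds.
Variable R : realType.
Implicit Types z q : R.

(** From exp (- z) >= 1 - z, so that no lower bound on z is imposed. *)
Lemma expR_le1D z : z <= 1 / 2 -> expR z <= 1 + z + 2 * z ^+ 2.
Proof.
move=> z2; rewrite -[expR z]invrK -expRN.
have z1 : 0 < 1 - z by lra.
apply: (@le_trans _ _ (1 - z)^-1).
  rewrite lef_pV2 ?posrE ?expR_gt0//.
  by have := expR_ge1Dx (- z).
rewrite -div1r ler_pdivrMr// -subr_ge0.
have -> : (1 + z + 2 * z ^+ 2) * (1 - z) - 1 = z ^+ 2 * (1 - 2 * z) by ring.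
by rewrite mulr_ge0 ?sqr_ge0//; lra.
Qed.

(* theta is artanh q, for which 1 + s * q = sqrt (1 - q ^ 2) * exp (theta * s)
   whenever s = 1 or s = -1. *)
Lemma exists_artanh q : 0 <= q -> q < 1 -> exists theta : R,
  [/\ 0 <= theta, theta <= q / (1 - q) &
      forall b, 1 + q * sgb R b <= expR (- (q ^+ 2 / 2)) * expR (theta * sgb R b)].
Proof.
move=> q0 q1; have q1' : 0 < 1 - q by lra.
have r0 : 0 < (1 + q) / (1 - q) by rewrite divr_gt0//; lra.
pose theta := ln ((1 + q) / (1 - q)) / 2.
have E2 : expR (2 * theta) = (1 + q) / (1 - q).
  by rewrite /theta mulrCA mulfV// mulr1 lnK.
have th0 : 0 <= theta.
  by rewrite divr_ge0// ln_ge0// ler_pdivlMr//; lra.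
exists theta; split => //.
  suff : 2 * theta <= 2 * (q / (1 - q)) by lra.
  rewrite -ler_expR E2; apply: le_trans (expR_ge1Dx _).
  rewrite le_eqVlt; apply/orP; left; apply/eqP; field.
  by rewrite gt_eqF.
move=> b; rewrite -expRD -(@ler_pXn2r _ 2)// ?nnegrE ?expR_ge0//; last first.
  by case: b; rewrite /sgb; lra.
rewrite -expRM_natl mulrDr expRD.
have -> : 2%:R * - (q ^+ 2 / 2) = - q ^+ 2 by field.
have qq : 1 - q ^+ 2 <= expR (- q ^+ 2) by exact: expR_ge1Dx.
have -> : (1 + q * sgb R b) ^+ 2 = (1 - q ^+ 2) * expR (2%:R * (theta * sgb R b)).
  case: b; rewrite /sgb ?expr1 ?expr0 ?mulrN1 ?mulr1 ?mulrN ?expRN E2.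
    by field; apply/andP; split; lra.
  by field; lra.
by rewrite ler_wpM2r// expR_ge0.
Qed.

End expR_bounds.

Section signed_low_rank.
Variable R : realType.
Local Notation sg := (sgb R).

Lemma sum_pair (I K : finType) (F : I * K -> R) :
  \sum_p F p = \sum_i \sum_k F (i, k).
Proof. by rewrite pair_bigA; apply: eq_bigr => -[]. Qed.

Lemma avg_expR_chaosT (I : finType) (A : I -> I -> R) :
  (forall i j, A i j = A j i) -> (forall i, A i i = 0) ->
  (forall i, \sum_j `|A i j| <= 1 / 2) ->
  avg (fun r : {ffun I -> bool} =>
    expR ((\sum_i \sum_j A i j * (sg (r i) * sg (r j))) / 2)) <=
  expR (\sum_i \sum_j A i j ^+ 2).
Proof.
move=> As A0 Ar; have T (F : I -> R) : \sum_(i in [set: I]%SET) F i = \sum_i F i.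
  by apply: eq_bigl => i; rewrite finset.in_setT.
have T2 (F : I -> I -> R) :
    \sum_(i in [set: I]%SET) \sum_(j in [set: I]%SET) F i j = \sum_i \sum_j F i j.
  by rewrite T; apply: eq_bigr => i _; rewrite T.
rewrite -(T2 (fun i j => A i j ^+ 2)).
under eq_avg do rewrite -T2.
by apply: avg_expR_chaos => // i _; rewrite T.
Qed.

(** Given [r], the exponent is linear in [r'], and the subgaussian bound leaves a quadratic form in
    [r] with the Gram matrix [H] of the rows of [X]. Its diagonal is constant and yields the sharp
    term theta^2 / 2; the rest is a chaos with matrix theta^2 H off the diagonal, whose squared norm
    is at most theta^4 N^2 times that of [X], for each [i]. *)
Lemma avg_expR_bilinear (I K : finType) (X : K -> K -> R) (theta N : R) :
  0 <= theta -> 0 <= N -> (theta * N) ^+ 2 <= 1 / 2 ->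
  (forall a, \sum_b `|X a b| <= N) -> (forall b, \sum_a `|X a b| <= N) ->
  avg (fun r : {ffun I * K -> bool} => avg (fun r' : {ffun I * K -> bool} =>
    expR (theta * \sum_i \sum_a \sum_b
      X a b * (sg (r (i, a)) * sg (r' (i, b)))))) <=
  expR (#|I|%:R * (theta ^+ 2 / 2 + theta ^+ 4 * N ^+ 2) *
        \sum_a \sum_b X a b ^+ 2).
Proof.
move=> th0 N0 thN Xr Xc.
pose H a a' := \sum_b X a b * X a' b.
have Hs a a' : H a a' = H a' a by apply: eq_bigr => b _; rewrite mulrC.
have Haa : \sum_a \sum_b X a b ^+ 2 = \sum_a H a a.
  by apply: eq_bigr => a _; apply: eq_bigr => b _; rewrite expr2.
have Hr a : \sum_a' `|H a a'| <= N ^+ 2.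
  apply: (@le_trans _ _ (\sum_a' \sum_b `|X a b| * `|X a' b|)).
    apply: ler_sum => a' _; rewrite (le_trans (ler_norm_sum _ _ _))//.
    by apply: ler_sum => b _; rewrite normrM.
  rewrite exchange_big/= (@le_trans _ _ (\sum_b `|X a b| * N))//.
    by apply: ler_sum => b _; rewrite -mulr_sumr ler_wpM2l.
  by rewrite -mulr_suml expr2 ler_wpM2r.
(* From the Cauchy-Schwarz bound |H a a'| <= (H a a + H a' a') / 2 and the row sums [Hr]. *)
have HH : \sum_a \sum_a' H a a' ^+ 2 <= N ^+ 2 * \sum_a H a a.
  have Hle a a' : H a a' ^+ 2 <= `|H a a'| * H a a / 2 + `|H a' a| * H a' a' / 2.
    rewrite -(Hs a) -mulrDl -mulrDr -[H a a' ^+ 2]real_normK ?num_real// expr2.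
    rewrite -mulrA ler_wpM2l// (le_trans (ler_norm_sum _ _ _))//.
    rewrite -big_split/= mulr_suml; apply: ler_sum => b _.
    rewrite normrM.
    have := sqr_ge0 (`|X a b| - `|X a' b|).
    by rewrite sqrrB !real_normK ?num_real// !expr2; lra.
  apply: (le_trans (ler_sum _ (fun a _ => ler_sum _ (fun a' _ => Hle a a')))).
  under eq_bigr do rewrite big_split/=.
  rewrite big_split/= [X in _ + X]exchange_big/=.
  suff H2 : \sum_a \sum_a' `|H a a'| * H a a / 2 <=
      (N ^+ 2 * \sum_a H a a) / 2 by lra.
  rewrite mulr_sumr mulr_suml; apply: ler_sum => a _.
  rewrite -2!mulr_suml ler_wpM2r// ler_wpM2r//.
  by apply: sumr_ge0 => b _; rewrite -expr2 sqr_ge0.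
pose y (r : {ffun I * K -> bool}) (ib : I * K) :=
  theta * \sum_a X a ib.2 * sg (r (ib.1, a)).
apply: (@le_trans _ _ (avg (fun r => expR ((\sum_ib y r ib ^+ 2) / 2)))).
  apply: ler_avg => r; apply: le_trans (avg_expR_sum_sg (y r)).
  rewrite le_eqVlt; apply/orP; left; apply/eqP; apply: eq_avg => r'.
  congr expR; rewrite sum_pair/=.
  rewrite mulr_sumr; apply: eq_bigr => i _; rewrite exchange_big/= mulr_sumr.
  apply: eq_bigr => b _; rewrite /y/= -mulrA mulr_suml; congr (_ * _).
  by apply: eq_bigr => a _; rewrite mulrA.
pose A (ia ja : I * K) := (ia.1 == ja.1)%:R * (ia.2 != ja.2)%:R *
  (theta ^+ 2 * H ia.2 ja.2).
have As ia ja : A ia ja = A ja ia.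
  by rewrite /A Hs [ia.1 == _]eq_sym [ia.2 == _]eq_sym.
have A0 ia : A ia ia = 0 by rewrite /A !eqxx mulr0 mul0r.
have pick1 (i : I) (F : I -> R) : \sum_j (i == j)%:R * F j = F i.
  rewrite (bigD1 i)//= eqxx mul1r big1 ?addr0// => j ji.
  by rewrite eq_sym (negbTE ji) mul0r.
have sumA (f : R -> I * K -> R) : (forall ja, f 0 ja = 0) -> forall ia,
    \sum_ja f (A ia ja) ja =
    \sum_a' f ((ia.2 != a')%:R * (theta ^+ 2 * H ia.2 a')) (ia.1, a').
  move=> f0 [i a] /=.
  rewrite sum_pair/=.
  rewrite (bigD1 i)//= [X in _ + X]big1 ?addr0 => [|j ji].
    by apply: eq_bigr => a' _; rewrite /A/= eqxx mul1r.
  by rewrite big1// => a' _; rewrite /A/= eq_sym (negbTE ji) !mul0r f0.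
have Ar ia : \sum_ja `|A ia ja| <= 1 / 2.
  rewrite (sumA (fun x _ => `|x|)) => [|?]; last exact: normr0.
  apply: le_trans thN; rewrite exprMn.
  apply: (@le_trans _ _ (theta ^+ 2 * \sum_a' `|H ia.2 a'|)).
    rewrite mulr_sumr; apply: ler_sum => a' _.
    rewrite normrM [`|_ * H _ _|]normrM (ger0_norm (sqr_ge0 _)); case: (_ != _).
      by rewrite normr1 mul1r.
    by rewrite normr0 mul0r mulr_ge0 ?sqr_ge0.
  by rewrite ler_wpM2l ?sqr_ge0.
have A2 : \sum_ia \sum_ja A ia ja ^+ 2 <=
    #|I|%:R * (theta ^+ 4 * N ^+ 2) * \sum_a H a a.
  have sumA2 := sumA (fun x _ => x ^+ 2) (fun _ => expr0n _ 2).
  rewrite (eq_bigr _ (fun ia _ => sumA2 ia)).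
  rewrite sum_pair/= sumr_const -[_ *+ _]mulr_natl.
  rewrite -[leRHS]mulrA -[_ * N ^+ 2 * _]mulrA.
  rewrite ler_wpM2l//; apply: le_trans (ler_wpM2l (exprn_ge0 4 th0) HH).
  rewrite mulr_sumr; apply: ler_sum => a _; rewrite mulr_sumr.
  apply: ler_sum => a' _; rewrite exprMn [(_ * H _ _) ^+ 2]exprMn -exprM.
  case: (_ != _); first by rewrite expr1n mul1r.
  by rewrite expr0n mul0r mulr_ge0 ?sqr_ge0 ?exprn_ge0.
have yE r : (\sum_ib y r ib ^+ 2) / 2 =
    #|I|%:R * (theta ^+ 2 / 2) * (\sum_a H a a) +
    (\sum_ia \sum_ja A ia ja * (sg (r ia) * sg (r ja))) / 2.
  have sumA3 ia := sumA (fun x ja => x * (sg (r ia) * sg (r ja)))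
    (fun _ => mul0r _) ia.
  rewrite (eq_bigr _ (fun ia _ => sumA3 ia)).
  suff -> : \sum_ib y r ib ^+ 2 = #|I|%:R * (theta ^+ 2 * \sum_a H a a) +
      \sum_ia \sum_a' (ia.2 != a')%:R * (theta ^+ 2 * H ia.2 a') *
        (sg (r ia) * sg (r (ia.1, a'))) by field.
  rewrite sum_pair/=.
  rewrite sum_pair/=.
  rewrite mulr_natl -sumr_const -big_split/=.
  apply: eq_bigr => i _.
  have -> : \sum_b y r (i, b) ^+ 2 = \sum_a \sum_a' theta ^+ 2 * H a a' *
      (sg (r (i, a)) * sg (r (i, a'))).
    rewrite /y/=; under eq_bigr do rewrite exprMn [(\sum_a _) ^+ 2]expr2 mulr_suml mulr_sumr.
    rewrite exchange_big/=; apply: eq_bigr => a _.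
    under eq_bigr do rewrite mulr_sumr mulr_sumr.
    rewrite exchange_big/=; apply: eq_bigr => a' _.
    by rewrite /H mulr_sumr mulr_suml; apply: eq_bigr => b _; ring.
  rewrite mulr_sumr -big_split/=; apply: eq_bigr => a _.
  rewrite (bigD1 a)//= sg_sqr mulr1; congr (_ + _).
  rewrite [RHS](bigD1 a)//= eqxx !mul0r add0r; apply: eq_bigr => a' aa'.
  by rewrite eq_sym aa' mul1r.
rewrite (@eq_avg _ _ _ _ (fun r => congr1 expR (yE r))).
under eq_avg do rewrite expRD.
rewrite avgZ (le_trans (ler_wpM2l (expR_ge0 _) (avg_expR_chaosT As A0 Ar)))//.
by rewrite -expRD ler_expR Haa mulrDr mulrDl lerD2l.
Qed.

End signed_low_rank.

(** * A prior on low-rank sign matrices *)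

Section labelled_columns.
Variable R : realType.
Variables J K : finType.
Local Notation sg := (sgb R).
Variables (l l' : J -> K).

(** The coefficient matrix of the bilinear form in the two families of sign columns. With w the
    product of the column signs of two draws, it expresses one row of their entrywise inner
    product. *)
Definition label_sum (w : J -> R) (a b : K) : R :=
  \sum_(j | (l j == a) && (l' j == b)) w j.

Lemma sum_labels (w : J -> R) (F : K -> K -> R) :
  \sum_j w j * F (l j) (l' j) = \sum_a \sum_b label_sum w a b * F a b.
Proof.
rewrite (partition_big l xpredT)//=; apply: eq_bigr => a _.
rewrite (partition_big l' xpredT)//=; apply: eq_bigr => b _.
rewrite /label_sum mulr_suml; apply: eq_big => [j|j /andP[/eqP-> /eqP->]]//.
Qed.

Lemma label_sum_row (w : J -> R) (N : nat) (a : K) :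
  (forall j, `|w j| <= 1) -> (#|[pred j | l j == a]| <= N)%N ->
  \sum_b `|label_sum w a b| <= N%:R.
Proof.
move=> w1 lN; apply: (@le_trans _ _ (\sum_(j | l j == a) 1)).
  rewrite [leRHS](partition_big l' xpredT)//=; apply: ler_sum => b _.
  by rewrite (le_trans (ler_norm_sum _ _ _))// ler_sum.
by rewrite sumr_const ler_nat.
Qed.

Lemma label_sum_col (w : J -> R) (N : nat) (b : K) :
  (forall j, `|w j| <= 1) -> (#|[pred j | l' j == b]| <= N)%N ->
  \sum_a `|label_sum w a b| <= N%:R.
Proof.
move=> w1 lN; apply: (@le_trans _ _ (\sum_(j | l' j == b) 1)).
  rewrite [leRHS](partition_big l xpredT)//=; apply: ler_sum => a _.
  rewrite (le_trans (ler_norm_sum _ _ _))//; under [leRHS]eq_bigl do rewrite andbC.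
  by rewrite ler_sum.
by rewrite sumr_const ler_nat.
Qed.

Definition same_labels (j j' : J) := (l j == l j') && (l' j == l' j').

Lemma sum_label_sum_sqr (w : J -> R) :
  \sum_a \sum_b label_sum w a b ^+ 2 =
  \sum_j \sum_j' (same_labels j j')%:R * (w j * w j').
Proof.
under eq_bigr do under eq_bigr do rewrite expr2.
rewrite -(sum_labels w (label_sum w)); apply: eq_bigr => j _.
rewrite /label_sum mulr_sumr big_mkcond/=; apply: eq_bigr => j' _.
rewrite /same_labels [l j == _]eq_sym [l' j == _]eq_sym.
by case: (_ && _); rewrite ?mul1r ?mul0r.
Qed.

(** The square expands into pairs of columns that agree in both labels. Equal columns give
    [lam * #|J|] exactly; distinct ones form a chaos in [v] with entries 2 lam up to sign, hence the
    factor 4 lam^2. The condition on 2 lam N is the row-sum condition of the chaos bound. *)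
Lemma avg_expR_label_sum (N : nat) (lam : R) (w : J -> R) :
  0 <= lam -> 2 * lam * N%:R <= 1 / 2 -> (forall j, w j ^+ 2 = 1) ->
  (forall j, (#|[pred j' | l j' == l j]| <= N)%N) ->
  avg (fun v : {ffun J -> bool} => expR (lam *
    \sum_a \sum_b label_sum (fun j => sg (v j) * w j) a b ^+ 2)) <=
  expR (lam * #|J|%:R +
    4 * lam ^+ 2 * \sum_j \sum_j' ((j != j') && same_labels j j')%:R).
Proof.
move=> lam0 lamN w2 lN.
have w1 j : `|w j| = 1.
  by have /eqP := w2 j; rewrite sqrf_eq1 => /orP[]/eqP->; rewrite ?normrN normr1.
pose A j j' := ((j != j') && same_labels j j')%:R * (2 * lam) * (w j * w j').
have As j j' : A j j' = A j' j.
  rewrite /A /same_labels [j == j']eq_sym [l j == _]eq_sym [l' j == _]eq_sym.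
  by rewrite [w j * _]mulrC.
have A0 j : A j j = 0 by rewrite /A eqxx !mul0r.
have A1 j j' : `|A j j'| = ((j != j') && same_labels j j')%:R * (2 * lam).
  by rewrite /A !normrM !w1 !mulr1 normr_nat !ger0_norm.
have Ar j : \sum_j' `|A j j'| <= 1 / 2.
  apply: le_trans lamN; under eq_bigr do rewrite A1.
  rewrite -mulr_suml mulrC ler_wpM2l// ?mulr_ge0//.
  rewrite -natr_sum ler_nat; apply: leq_trans (lN j).
  rewrite -sum1_card [leqRHS]big_mkcond; apply: leq_sum => j' _.
  by rewrite inE /same_labels eq_sym [l j == _]eq_sym; case: (l j' == l j);
    rewrite /= ?andbF// leq_b1.
have E (v : {ffun J -> bool}) : lam * \sum_a \sum_b label_sum (fun j => sg (v j) * w j) a b ^+ 2 =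
    lam * #|J|%:R + (\sum_j \sum_j' A j j' * (sg (v j) * sg (v j'))) / 2.
  rewrite sum_label_sum_sqr -sumr_const mulr_sumr mulr_suml mulr_sumr.
  rewrite -big_split/=; apply: eq_bigr => j _.
  rewrite (bigD1 j)//= [in RHS](bigD1 j)//= A0 mul0r add0r /same_labels !eqxx.
  rewrite mul1r mulrDr; congr (_ + _).
    have -> : sg (v j) * w j * (sg (v j) * w j) = (sg (v j) * sg (v j)) * w j ^+ 2.
      by ring.
    by rewrite sg_sqr w2 mul1r.
  rewrite mulr_sumr mulr_suml; apply: eq_bigr => j' jj'.
  by rewrite /A /same_labels [j == j']eq_sym jj' /=; field.
rewrite (@eq_avg _ _ _ _ (fun v => congr1 expR (E v))).
under eq_avg do rewrite expRD.
rewrite avgZ (le_trans (ler_wpM2l (expR_ge0 _) (avg_expR_chaosT As A0 Ar)))//.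
rewrite -expRD ler_expR lerD2l mulr_sumr le_eqVlt; apply/orP; left; apply/eqP.
apply: eq_bigr => j _; rewrite mulr_sumr; apply: eq_bigr => j' _.
rewrite -[LHS]real_normK ?num_real// A1; case: (_ && _); rewrite /=; ring.
Qed.

End labelled_columns.

(** * Cyclically shifted labels and their collisions *)

Section random_shifts.
Variable R : realType.
Variables (m k : nat) (k_gt0 : (0 < k)%N).

Definition group (j : 'I_m) : 'I_(m %/ k).+1 := inord (j %/ k).

Definition shift_label (t : {ffun 'I_(m %/ k).+1 -> 'I_k}) (j : 'I_m) : 'I_k :=
  Ordinal (ltn_pmod (j + t (group j)) k_gt0).

Lemma group_val j : group j = (j %/ k)%N :> nat.
Proof. by rewrite inordK// ltnS leq_div2r// ltnW. Qed.

(** A group has distinct residues mod k, and a common shift keeps them distinct. So each label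
    occurs at most once per group. *)
Lemma shift_label_inj t j j' : shift_label t j = shift_label t j' ->
  group j = group j' -> j = j'.
Proof.
move=> [] + gg; rewrite gg => /eqP; rewrite eqn_modDr => /eqP jj'.
apply/val_inj; rewrite /= (divn_eq j k) (divn_eq j' k) jj'.
by rewrite -!group_val gg.
Qed.

Lemma card_shift_label t (a : 'I_k) :
  (#|[pred j | shift_label t j == a]| <= (m %/ k).+1)%N.
Proof.
rewrite -[leqRHS]card_ord -(@card_in_imset _ _ group).
  exact: max_card.
move=> j j'; rewrite !inE => /eqP jj /eqP jj'.
by apply: (@shift_label_inj t); exact: (etrans jj (esym jj')).
Qed.

(** The differences t - t' at g and g' agree mod k, written without subtraction. *)
Definition coll (t t' : {ffun 'I_(m %/ k).+1 -> 'I_k}) (g g' : 'I_(m %/ k).+1) :=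
  (t g + t' g' == t' g + t g' %[mod k])%N.

(** Subtracting the two congruences for a pair of columns that agree in both labels eliminates the
    columns and leaves a collision of their groups. For a given pair of groups, the residue of j,
    one of k, determines j, and the common label then determines j'. *)
Lemma sum_same_labels_le t t' :
  \sum_j \sum_j' ((j != j') &&
     same_labels (shift_label t) (shift_label t') j j')%:R <=
  k%:R * \sum_g \sum_g' ((g != g') && coll t t' g g')%:R :> R.
Proof.
pose P (jj : 'I_m * 'I_m) := (jj.1 != jj.2) &&
  same_labels (shift_label t) (shift_label t') jj.1 jj.2.
pose Q (gg : 'I_(m %/ k).+1 * 'I_(m %/ k).+1) :=
  (gg.1 != gg.2) && coll t t' gg.1 gg.2.
have sum_card (T : finType) (S : {set T}) : (\sum_x (x \in S : nat) = #|S|)%N.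
  by rewrite -sum1_card [RHS]big_mkcond; apply: eq_bigr => x _; case: (x \in S).
have -> : \sum_j \sum_j' ((j != j') &&
     same_labels (shift_label t) (shift_label t') j j')%:R =
     #|[set jj | P jj]%SET|%:R :> R.
  rewrite -sum_card natr_sum [RHS]sum_pair; apply: eq_bigr => j _.
  by apply: eq_bigr => j' _; rewrite finset.in_set.
have -> : \sum_g \sum_g' ((g != g') && coll t t' g g')%:R =
     #|[set gg | Q gg]%SET|%:R :> R.
  rewrite -sum_card natr_sum [RHS]sum_pair; apply: eq_bigr => g _.
  by apply: eq_bigr => g' _; rewrite finset.in_set.
pose phi (jj : 'I_m * 'I_m) : 'I_k * ('I_(m %/ k).+1 * 'I_(m %/ k).+1) :=
  (Ordinal (ltn_pmod jj.1 k_gt0), (group jj.1, group jj.2)).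
rewrite -natrM ler_nat -[X in (_ <= X * _)%N]card_ord -cardsT -finset.cardsX.
rewrite -(@card_in_imset _ _ phi); last first.
  move=> [j1 j1'] [j2 j2']; rewrite !finset.in_set /P /same_labels /=.
  move=> /and3P[_ /eqP l1 _] /and3P[_ /eqP l2 _] [jj gg gg'].
  have j12 : j1 = j2.
    apply/val_inj; rewrite /= (divn_eq j1 k) (divn_eq j2 k) jj.
    by rewrite -!group_val gg.
  by rewrite j12; congr pair; apply: (@shift_label_inj t) => //;
    rewrite -l1 -l2 j12.
apply/subset_leq_card/fintype.subsetP => _ /imsetP[[j j'] jP ->].
move: jP; rewrite finset.in_setX !finset.in_set /P /Q /same_labels /=.
move=> /and3P[jj' /eqP l1 /eqP l2]; apply/andP; split.
  by apply: contra jj' => /eqP gg; apply/eqP; exact: shift_label_inj l1 gg.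
case: l1 => /eqP l1; case: l2 => /eqP l2.
rewrite /coll -(eqn_modDr (j + j')).
rewrite (_ : _ + _ + (_ + _) = (j + t (group j)) + (j' + t' (group j')))%N; last lia.
rewrite -modnDml (eqP l1) modnDml -modnDmr -(eqP l2) modnDmr.
by apply/eqP; congr (_ %% k)%N; lia.
Qed.

(** The shifts [t'] are integrated out one group at a time. Given the others, each group collides
    with group [x] for at most one value of [t' x], so the mean number of collisions is at most N /
    k. Both orders of a pair count, and exp z <= 1 + 2 z on [0, 1/2]; this gives the factor 4
    beta. *)
Lemma avg_expR_coll (t : {ffun 'I_(m %/ k).+1 -> 'I_k}) (beta : R) :
  0 <= beta -> 2 * beta * (m %/ k).+1%:R <= 1 / 2 ->
  avg (fun t' => expR (beta * \sum_g \sum_g' ((g != g') && coll t t' g g')%:R)) <=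
  expR (4 * beta * (m %/ k).+1%:R ^+ 2 / k%:R).
Proof.
set N := (m %/ k).+1 => beta0 betaN.
have k0 : 0 < k%:R :> R by rewrite ltr0n.
suff H (S : {set 'I_N}) : avg (fun t' : {ffun 'I_N -> 'I_k} =>
      expR (beta * \sum_(g in S) \sum_(g' in S) ((g != g') && coll t t' g g')%:R))
    <= expR (4 * beta * N%:R / k%:R * #|S|%:R).
  have := H [set: 'I_N]%SET; rewrite cardsT card_ord.
  have T (F : 'I_N -> R) : \sum_(i in [set: 'I_N]%SET) F i = \sum_i F i.
    by apply: eq_bigl => i; rewrite finset.in_setT.
  have -> : 4 * beta * N%:R / k%:R * N%:R = 4 * beta * N%:R ^+ 2 / k%:R by ring.
  apply: le_trans; rewrite le_eqVlt; apply/orP; left; apply/eqP.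
  apply: eq_avg => t'; rewrite T; congr (expR (_ * _)).
  by apply: eq_bigr => g _; rewrite T.
have [n] := ubnP #|S|; elim: n => // n IH in S *.
rewrite ltnS => Sn.
have [->|/finset.set0Pn[x xS]] := eqVneq S finset.set0.
  rewrite cards0 mulr0 expR0; under eq_avg do rewrite finset.big_set0 mulr0 expR0.
  by rewrite (avg_cst [ffun=> Ordinal k_gt0]).
pose S' := S :\ x.
have S'n : #|S| = #|S'|.+1 by rewrite (cardsD1 x S) xS.
have {IH} : avg _ <= _ := IH S' _; rewrite -S'n => /(_ Sn).
set E' := avg _ => IH.
have S'N : #|S'|%:R <= N%:R :> R.
  by rewrite ler_nat -[leqRHS]card_ord max_card.
suff step : avg (fun t' : {ffun 'I_N -> 'I_k} =>
      expR (beta * \sum_(g in S) \sum_(g' in S) ((g != g') && coll t t' g g')%:R))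
    <= expR (4 * beta * N%:R / k%:R) * E'.
  rewrite (le_trans step)// (le_trans (ler_wpM2l (expR_ge0 _) IH))//.
  by rewrite -expRD ler_expR S'n -[#|S'|.+1%:R]natr1 mulrDr mulr1 addrC.
rewrite -(avg_resample (Ordinal k_gt0) x) -avgZ; apply: ler_avg => t'.
pose Q := beta * \sum_(g in S') \sum_(g' in S') ((g != g') && coll t t' g g')%:R.
have ut a g : g \in S' -> upd t' x a g = t' g.
  by rewrite ffunE in_setD1 => /andP[/negbTE->].
pose c (a : 'I_k) g := (t x + t' g == a + t g %[mod k])%N.
pose z a := 2 * beta * \sum_(g in S') (c a g)%:R.
rewrite (@eq_avg _ _ _ (fun a => expR Q * expR (z a))); last first.
  move=> a; rewrite -expRD; congr expR.
  rewrite (dsum_setD1 _ xS) eqxx/= add0r addrC mulrDr; congr (_ + _).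
    congr (_ * _); apply: eq_bigr => g gS; apply: eq_bigr => g' g'S.
    by rewrite /coll !ut.
  rewrite /z !mulr_sumr; apply: eq_bigr => g gS.
  have gx : g != x by move: gS; rewrite in_setD1 => /andP[].
  rewrite /coll ut// ffunE eqxx gx eq_sym gx /= /c.
  rewrite [(t g + _)%N]addnC [(t' g + _)%N]addnC [X in _ * (_ + (nat_of_bool X)%:R)]eq_sym; ring.
rewrite avgZ mulrC ler_wpM2r ?expR_ge0//.
have z0 a : 0 <= z a by rewrite !mulr_ge0// sumr_ge0.
have z2 a : z a <= 1 / 2.
  apply: le_trans betaN; rewrite ler_wpM2l ?mulr_ge0//.
  apply: le_trans S'N; rewrite -sumr_const; apply: ler_sum => g _.
  by case: (c a g).
apply: (@le_trans _ _ (avg (fun a => 1 + 2 * z a))).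
  apply: ler_avg => a; apply: (le_trans (expR_le1D (z2 a))).
  by have := z0 a; have := z2 a; rewrite expr2; nra.
rewrite avgD (avg_cst (Ordinal k_gt0)) avgZ /z avgZ.
apply: le_trans (expR_ge1Dx _); rewrite lerD2l.
have : avg (fun a => \sum_(g in S') (c a g)%:R) <= N%:R / k%:R :> R.
  rewrite /avg card_ord ler_wpM2r ?invr_ge0 ?(ltW k0)// exchange_big/=.
  apply: le_trans S'N; rewrite -sumr_const; apply: ler_sum => g _.
  rewrite -natr_sum -[leRHS]/(1%:R) ler_nat.
  have sum_card (T : finType) (P : pred T) : (\sum_x (P x : nat) = #|P|)%N.
    by rewrite -sum1_card [RHS]big_mkcond; apply: eq_bigr => y _;
      rewrite unfold_in; case: (P y).
  rewrite (sum_card _ (fun a => c a g)).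
  apply/card_le1_eqP => a b; rewrite !unfold_in => /eqP ca /eqP.
  rewrite ca => /eqP; rewrite eqn_modDr !modn_small// => /eqP ab.
  exact/val_inj.
by move: (avg _) => v vN; nra.
Qed.

End random_shifts.

Section prior.
Variable R : realType.
Variables (m k : nat) (k_gt0 : (0 < k)%N).
Local Notation sg := (sgb R).
Local Notation N := (m %/ k).+1.

(* The columns are cut into groups of k consecutive ones. Group g carries the
   labels 0, ..., k - 1 shifted cyclically by a random t g, and a column with
   label a is a random sign times the a-th of k random sign columns. *)
Definition prior : finType :=
  ({ffun 'I_N -> 'I_k} * ({ffun 'I_m -> bool} * {ffun 'I_m * 'I_k -> bool}))%type.

Definition prior0 : prior :=
  ([ffun=> Ordinal k_gt0], ([ffun=> true], [ffun=> true])).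

Definition prior_mx (th : prior) : 'M[R]_m :=
  \matrix_(i, j) (sg (th.2.2 (i, shift_label k_gt0 th.1 j)) * sg (th.2.1 j)).

Lemma rank_prior_mx th : (\rank (prior_mx th) <= k)%N.
Proof.
have -> : prior_mx th = (\matrix_(i < m, a < k) sg (th.2.2 (i, a))) *m
    (\matrix_(a < k, j < m) ((shift_label k_gt0 th.1 j == a)%:R * sg (th.2.1 j))).
  apply/matrixP => i j; rewrite !mxE (bigD1 (shift_label k_gt0 th.1 j))//=.
  rewrite !mxE eqxx mul1r big1 ?addr0// => a; rewrite eq_sym => /negbTE ja.
  by rewrite !mxE ja mul0r mulr0.
exact: mulmx_max_rank.
Qed.

Lemma prior_mx_sqr th i j : prior_mx th i j ^+ 2 = 1.
Proof. by rewrite mxE exprMn !expr2 !sg_sqr mulr1. Qed.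

Section moment.
Variables (q lam theta : R).
Hypotheses (q0 : 0 <= q) (theta0 : 0 <= theta).
Hypothesis thetaP :
  forall b, 1 + q * sg b <= expR (- (q ^+ 2 / 2)) * expR (theta * sg b).
Hypothesis q1 : q <= 1.
Hypothesis lamE : lam = m%:R * (theta ^+ 2 / 2 + theta ^+ 4 * N%:R ^+ 2).
Hypothesis thetaN : (theta * N%:R) ^+ 2 <= 1 / 2.
Hypothesis lamN : 2 * lam * N%:R <= 1 / 2.
Hypothesis lam2N : 8 * lam ^+ 2 * k%:R * N%:R <= 1 / 2.

Lemma prod_prior_le (th th' : prior) :
  \prod_i \prod_j (1 + q * (prior_mx th i j * prior_mx th' i j)) <=
  expR (- (q ^+ 2 / 2 * m%:R ^+ 2)) *
  expR (theta * \sum_i \sum_a \sum_b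
    label_sum (shift_label k_gt0 th.1) (shift_label k_gt0 th'.1)
      (fun j => sg (th.2.1 j) * sg (th'.2.1 j)) a b *
    (sg (th.2.2 (i, a)) * sg (th'.2.2 (i, b)))).
Proof.
set l := shift_label k_gt0 th.1; set l' := shift_label k_gt0 th'.1.
pose s i j := prior_mx th i j * prior_mx th' i j.
have sE i j : exists b, s i j = sg b.
  (* A product of four signs is the sign of the exclusive or of their bits, so [thetaP] applies to
     each entry. *)
  exists ((th.2.2 (i, l j) (+) th.2.1 j) (+) (th'.2.2 (i, l' j) (+) th'.2.1 j)).
  by rewrite /s !mxE /sgb -!signr_addb.
rewrite (@le_trans _ _ (\prod_i \prod_j
    (expR (- (q ^+ 2 / 2)) * expR (theta * s i j))))//.
  have s1 i j : 0 <= 1 + q * s i j <= expR (- (q ^+ 2 / 2)) * expR (theta * s i j).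
    have [b ->] := sE i j; rewrite thetaP andbT.
    by case: b; rewrite /sgb ?expr1 ?expr0 ?mulrN1 ?mulr1 ?subr_ge0 ?addr_ge0.
  apply: ler_prod => i _; apply/andP; split.
    by apply: prodr_ge0 => j _; case/andP: (s1 i j).
  by apply: ler_prod => j _; exact: s1.
rewrite le_eqVlt; apply/orP; left; apply/eqP.
under eq_bigr do rewrite big_split/= prodr_const card_ord -expR_sum.
rewrite big_split/= prodr_const card_ord -expR_sum -exprM -expRM_natl.
congr (expR _ * expR _); first by rewrite mulrN natrM; congr (- _); ring.
rewrite mulr_sumr; apply: eq_bigr => i _.
rewrite -mulr_sumr; congr (_ * _).
rewrite -(sum_labels l l' (fun j => sg (th.2.1 j) * sg (th'.2.1 j))
  (fun a b => sg (th.2.2 (i, a)) * sg (th'.2.2 (i, b)))).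
by apply: eq_bigr => j _; rewrite /s !mxE; ring.
Qed.

(** For fixed [t] and [v'], the average is taken over the column entries of both copies by the
    bilinear bound, then over the signs [v], and last over the shifts [t'], with beta = 4 lam^2 k.
    The number N is both the number of groups and a bound on the size of a label class. *)
Lemma avg_prior_le : avg (fun th => avg (fun th' =>
    \prod_i \prod_j (1 + q * (prior_mx th i j * prior_mx th' i j)))) <=
  expR (lam * m%:R - q ^+ 2 * m%:R ^+ 2 / 2 + 16 * lam ^+ 2 * N%:R ^+ 2).
Proof.
have lam0 : 0 <= lam.
  by rewrite lamE mulr_ge0// addr_ge0// ?mulr_ge0 ?sqr_ge0// exprn_ge0.
apply: (le_trans (ler_avg (fun th => ler_avg (prod_prior_le th)))).
under eq_avg do rewrite avgZ.
rewrite avgZ -[lam * _ - _]addrC -addrA.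
have -> : q ^+ 2 * m%:R ^+ 2 / 2 = q ^+ 2 / 2 * m%:R ^+ 2 by ring.
rewrite expRD ler_wpM2l ?expR_ge0// avg_pair/=.
apply: (avg_le_avg_le [ffun=> Ordinal k_gt0]) => t.
under eq_avg do rewrite avg_pair/=.
rewrite exchange_avg.
pose beta := 4 * lam ^+ 2 * k%:R.
have beta0 : 0 <= beta by rewrite !mulr_ge0// sqr_ge0.
apply: (@le_trans _ _ (avg (fun t' => expR (lam * m%:R) *
    expR (beta * \sum_g \sum_g' ((g != g') && coll t t' g g')%:R)))); last first.
  rewrite avgZ expRD ler_wpM2l ?expR_ge0//.
  have bN : 2 * beta * N%:R <= 1 / 2.
    by rewrite (le_trans _ lam2N)// /beta le_eqVlt; apply/orP; left; apply/eqP; ring.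
  apply: (le_trans (avg_expR_coll k_gt0 t beta0 bN)).
  rewrite ler_expR /beta le_eqVlt; apply/orP; left; apply/eqP; field.
  by rewrite pnatr_eq0 -lt0n.
apply: ler_avg => t'.
rewrite avg_pair/=.
under eq_avg do under eq_avg do rewrite avg_pair/=.
under eq_avg do rewrite exchange_avg.
rewrite exchange_avg.
apply: (avg_le_avg_le [ffun=> true]) => v'.
set l := shift_label k_gt0 t; set l' := shift_label k_gt0 t'.
have w1 (v : {ffun 'I_m -> bool}) j : `|sg (v j) * sg (v' j)| <= 1.
  by rewrite normrM !norm_sg mulr1.
apply: (@le_trans _ _ (avg (fun v : {ffun 'I_m -> bool} => expR (lam *
    \sum_a \sum_b label_sum l l' (fun j => sg (v j) * sg (v' j)) a b ^+ 2)))).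
  apply: ler_avg => v.
  have := @avg_expR_bilinear R 'I_m 'I_k
    (label_sum l l' (fun j => sg (v j) * sg (v' j))) theta N%:R theta0 _ thetaN.
  rewrite card_ord -lamE; apply => //.
    by move=> a; apply: label_sum_row => //; exact: card_shift_label.
  by move=> b; apply: label_sum_col => //; exact: card_shift_label.
have := @avg_expR_label_sum R 'I_m 'I_k l l' N lam (fun j => sg (v' j)) lam0 lamN.
move=> /(_ (fun j => esym (etrans (esym (sg_sqr R (v' j))) (esym (expr2 _))))).
move=> /(_ (fun j => card_shift_label k_gt0 t (l j))).
move=> /le_trans; apply; rewrite card_ord -expRD ler_expR lerD2l /beta -[leRHS]mulrA.
by rewrite ler_wpM2l ?sum_same_labels_le// mulr_ge0 ?sqr_ge0.
Qed.

End moment.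

Theorem avg_prior_chi2 (kap q : R) : (k ^ 3 <= m)%N -> 0 <= kap -> kap <= 1 / 4 ->
  q = kap * Num.sqrt k%:R / m%:R ->
  avg (fun th => avg (fun th' =>
    \prod_i \prod_j (1 + q * (prior_mx th i j * prior_mx th' i j)))) <=
  expR (70 * kap ^+ 3).
Proof.
move=> k3m kap0 kap4 qE.
have k2m : (k ^ 2 <= m)%N by apply: leq_trans k3m; rewrite leq_pexp2l.
have km : (k <= m)%N by apply: leq_trans k2m; rewrite -{1}[k]expn1 leq_pexp2l.
set K : R := k%:R; set M : R := m%:R; pose s : R := Num.sqrt K.
have K1 : 1 <= K by rewrite ler1n.
have K2M : K ^+ 2 <= M by rewrite -natrX ler_nat.
have M0 : 0 < M by rewrite ltr0n (leq_trans k_gt0).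
have s2 : s ^+ 2 = K by rewrite sqr_sqrtr ?ler0n.
have s0 : 0 <= s by rewrite sqrtr_ge0.
have s1 : 1 <= s by rewrite -sqrtr1 ler_wsqrtr.
have sK : s <= K by rewrite -s2 expr2 ler_peMr.
have qM : q * M = kap * s by rewrite qE -/M -/K -/s divfK// gt_eqF.
have q0 : 0 <= q by rewrite qE !mulr_ge0 ?invr_ge0 ?sqrtr_ge0.
have sqK : s * q * K <= kap.
  rewrite -(ler_pM2r M0); apply: (@le_trans _ _ (kap * K ^+ 2)).
    by rewrite mulrAC -[s * q * M]mulrA qM mulrCA -expr2 s2 -mulrA -expr2.
  by rewrite ler_wpM2l.
have qK : q * K <= kap.
  apply: le_trans sqK; rewrite -mulrA ler_peMl// mulr_ge0//; lra.
have q4 : q <= 1 / 4 by apply: (le_trans _ (le_trans qK kap4)); rewrite ler_peMr.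
have [theta [th0 thq thP]] := @exists_artanh R q q0 ltac:(lra).
(* From theta <= q / (1 - q); the factor 1 + 4 q is valid because q <= 1/4. *)
have th2 : theta ^+ 2 <= q ^+ 2 * (1 + 4 * q).
  have q1 : 0 < 1 - q by lra.
  apply: (@le_trans _ _ ((q / (1 - q)) ^+ 2)); first by rewrite lerXn2r ?nnegrE// (le_trans th0).
  rewrite expr_div_n ler_pdivrMr ?exprn_gt0// -mulrA ler_peMr ?sqr_ge0//.
  have -> : (1 + 4 * q) * (1 - q) ^+ 2 = 1 + q * (2 - 7 * q + 4 * q ^+ 2) by ring.
  by rewrite lerDl mulr_ge0//; have := sqr_ge0 q; lra.
have th22 : theta ^+ 2 <= 2 * q ^+ 2.
  apply: (le_trans th2); rewrite mulrC ler_wpM2r ?sqr_ge0//; lra.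
set NN : R := N%:R; pose X := q * NN.
have NN0 : 0 <= NN by exact: ler0n.
have NK : NN * K <= 2 * M.
  rewrite -!natrM ler_nat mulSn mul2n -addnn leq_add// ; exact: leq_divM.
have X0 : 0 <= X by rewrite mulr_ge0.
have sX : s * X <= 2 * kap.
  have s_gt0 : 0 < s by lra.
  rewrite -(ler_pM2r s_gt0) mulrAC -expr2 s2 /X mulrCA [K * _]mulrC.
  apply: (le_trans (ler_wpM2l q0 NK)).
  by rewrite mulrCA qM mulrA.
have X2K : K * X ^+ 2 <= 4 * kap ^+ 2.
  rewrite -s2 -exprMn (_ : 4 * kap ^+ 2 = (2 * kap) ^+ 2); last by ring.
  by rewrite lerXn2r ?nnegrE// mulr_ge0.
have X2 : X ^+ 2 <= 4 * kap ^+ 2.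
  by apply: le_trans X2K; rewrite ler_peMl ?sqr_ge0.
have kap2 : kap ^+ 2 <= 1 / 16.
  by have := @ler_pM R _ _ _ _ kap0 kap0 kap4 kap4; rewrite expr2; lra.
have thN2 : (theta * NN) ^+ 2 <= 2 * X ^+ 2.
  have -> : 2 * X ^+ 2 = 2 * q ^+ 2 * NN ^+ 2 by rewrite /X; ring.
  by rewrite exprMn ler_wpM2r ?sqr_ge0.
have thN : (theta * NN) ^+ 2 <= 1 / 2 by lra.
pose lam := M * (theta ^+ 2 / 2 + theta ^+ 4 * NN ^+ 2).
have th4 : theta ^+ 4 * NN ^+ 2 = theta ^+ 2 * (theta * NN) ^+ 2 by ring.
have lam0 : 0 <= lam.
  by rewrite mulr_ge0 ?(ltW M0)// addr_ge0 ?mulr_ge0 ?sqr_ge0 ?exprn_ge0.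
have lamq : lam <= 2 * kap * s * q.
  have -> : 2 * kap * s * q = M * (2 * q ^+ 2).
    by rewrite -mulrA -mulrA (mulrA kap) -qM; ring.
  rewrite ler_wpM2l ?(ltW M0)//; apply: le_trans th22; rewrite th4.
  have : theta ^+ 2 * (theta * NN) ^+ 2 <= theta ^+ 2 * (1 / 2).
    by rewrite ler_wpM2l ?sqr_ge0.
  by lra.
have lamN : lam * NN <= 4 * kap ^+ 2.
  apply: (le_trans (ler_wpM2r NN0 lamq)).
  have -> : 2 * kap * s * q * NN = 2 * kap * (s * X) by rewrite /X; ring.
  have -> : 4 * kap ^+ 2 = 2 * kap * (2 * kap) by ring.
  by rewrite ler_wpM2l// mulr_ge0.
have lamN0 : 0 <= lam * NN by rewrite mulr_ge0.
have lamK : lam * K <= 2 * kap ^+ 2.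
  apply: (@le_trans _ _ (2 * kap * s * q * K)); first by rewrite ler_wpM2r ?ler0n.
  have -> : 2 * kap * s * q * K = 2 * kap * (s * q * K) by ring.
  have -> : 2 * kap ^+ 2 = 2 * kap * kap by ring.
  by rewrite ler_wpM2l// mulr_ge0.
have lamK0 : 0 <= lam * K by rewrite mulr_ge0.
have k4 : kap ^+ 4 <= kap ^+ 3 / 4.
  by rewrite (exprS kap 3) mulrC ler_wpM2l ?exprn_ge0//; lra.
have c1 : 2 * lam * NN <= 1 / 2 by rewrite -mulrA; lra.
have c2 : 8 * lam ^+ 2 * K * NN <= 1 / 2.
  have -> : 8 * lam ^+ 2 * K * NN = 8 * ((lam * K) * (lam * NN)) by ring.
  have := ler_pM lamK0 lamN0 lamK lamN.
  have := ler_pM (sqr_ge0 kap) (sqr_ge0 kap) kap2 kap2.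
  lra.
have q1 : q <= 1 by lra.
apply: (le_trans (@avg_prior_le q lam theta q0 th0 thP q1 erefl thN c1 c2)).
rewrite ler_expR -/M -/NN.
(* The leading q^2 M^2 / 2 cancels. The remainder is 2 kap^3 + 16 kap^4 from [L1] and 256 kap^4 from
   collisions; as kap <= 1/4, it is at most (2 + 272 / 4) kap^3 = 70 kap^3. *)
have L2 : 16 * lam ^+ 2 * NN ^+ 2 <= 256 * kap ^+ 4.
  have -> : 16 * lam ^+ 2 * NN ^+ 2 = 16 * ((lam * NN) * (lam * NN)) by ring.
  have := ler_pM lamN0 lamN0 lamN lamN.
  have -> : 4 * kap ^+ 2 * (4 * kap ^+ 2) = 16 * kap ^+ 4 by ring.
  lra.
have L1 : lam * M <= q ^+ 2 * M ^+ 2 / 2 + 2 * kap ^+ 3 + 16 * kap ^+ 4.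
  have -> : lam * M = (M ^+ 2 * theta ^+ 2) / 2 +
      (M ^+ 2 * theta ^+ 2) * (theta * NN) ^+ 2 by rewrite /lam; field.
  have A1 : M ^+ 2 * theta ^+ 2 <= q ^+ 2 * M ^+ 2 + 4 * kap ^+ 3.
    apply: (le_trans (ler_wpM2l (sqr_ge0 M) th2)).
    have -> : M ^+ 2 * (q ^+ 2 * (1 + 4 * q)) =
       q ^+ 2 * M ^+ 2 + 4 * ((q * M) ^+ 2 * q) by ring.
    rewrite lerD2l ler_wpM2l// qM exprMn s2 -mulrA [K * q]mulrC.
    by rewrite (exprSr kap 2) ler_wpM2l ?sqr_ge0.
  have A2 : (M ^+ 2 * theta ^+ 2) * (theta * NN) ^+ 2 <= 16 * kap ^+ 4.
    apply: (@le_trans _ _ ((2 * (kap ^+ 2 * K)) * (2 * X ^+ 2))).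
      rewrite ler_pM ?mulr_ge0 ?sqr_ge0//.
      have -> : 2 * (kap ^+ 2 * K) = M ^+ 2 * (2 * q ^+ 2).
        by rewrite -s2 -exprMn -qM; ring.
      by rewrite ler_wpM2l ?sqr_ge0.
    have -> : 2 * (kap ^+ 2 * K) * (2 * X ^+ 2) = 4 * kap ^+ 2 * (K * X ^+ 2) by ring.
    have -> : 16 * kap ^+ 4 = 4 * kap ^+ 2 * (4 * kap ^+ 2) by ring.
    by rewrite ler_wpM2l// mulr_ge0 ?sqr_ge0.
  lra.
have := exprn_ge0 3 kap0; lra.
Qed.

End prior.

(** * Two-point noise *)

Section finite_space.
Variable I : finType.

(** Sample space of the two-point experiments: for each entry, whether it is observed and the sign
    bit of [M i j + eps i j]. The discrete sigma-algebra makes every function on it measurable. *)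
Definition cells : Type := {ffun I -> bool * bool}.
HB.instance Definition _ := Finite.on cells.
HB.instance Definition _ := isPointed.Build cells [ffun=> (true, true)].
HB.instance Definition _ := @isMeasurable.Build default_measure_display
  cells discrete_measurable discrete_measurable0
  discrete_measurableC discrete_measurableU.

Lemma measurable_fun_cells d (T : measurableType d) (f : cells -> T) :
  measurable_fun setT f.
Proof. by []. Qed.

Section weights.
Variables (R : realType) (W : {ffun I -> bool * bool} -> R).
Hypothesis W0 : forall w, 0 <= W w.
Hypothesis W1 : \sum_w W w = 1.

Local Notation cell i := (nth (point : cells) (enum {: {ffun I -> bool * bool}}) i).

Definition cells_prob : set cells -> \bar R :=
  msum (fun i => mscale (NngNum (W0 (cell i))) (@dirac _ cells (cell i) R))
    (size (enum {: {ffun I -> bool * bool}})).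

Lemma cells_probE (A : set cells) :
  cells_prob A = (\sum_w W w * (w \in A)%:R)%:E.
Proof.
have -> : \sum_w W w * (w \in A)%:R =
    \sum_(i < size (enum {: {ffun I -> bool * bool}})) W (cell i) * (cell i \in A)%:R.
  by rewrite -big_enum/= (big_nth (point : cells)) big_mkord.
rewrite /cells_prob /msum -sumEFin.
by apply: eq_bigr => i _; rewrite EFinM; congr (_ * _)%E.
Qed.

HB.instance Definition _ := Measure.on cells_prob.

Lemma cells_probT : cells_prob setT = 1%E.
Proof.
rewrite cells_probE -[in RHS]W1; congr EFin; apply: eq_bigr => w _.
by rewrite in_setT mulr1.
Qed.

HB.instance Definition _ := Measure_isProbability.Build _ _ _ cells_prob cells_probT.

Definition cells_probability : probability cells R := cells_prob.

Lemma expectation_cells (f : cells -> R) :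
  ('E_cells_probability[f] = (\sum_w W w * f w)%:E)%E.
Proof.
rewrite unlock.
have fE : f = fun w : cells => \sum_(v : {ffun I -> bool * bool}) f v * \1_[set v : cells] w.
  apply/funext => w; rewrite (bigD1 w)//= indicE mem_set// mulr1 big1 ?addr0// => v vw.
  by rewrite indicE memNset ?mulr0// => /= wv; rewrite wv eqxx in vw.
rewrite {1}fE.
under eq_integral do (rewrite -sumEFin; under eq_bigr do rewrite EFinM).
rewrite integral_sum//=; last first.
  by move=> v; apply: integrableZl => //; exact: integrable_indic.
rewrite -sumEFin; apply: eq_bigr => v _.
rewrite integralZl//; last exact: integrable_indic.
rewrite integral_indic// setIT.
have Pv : cells_prob [set v : cells] = (W v)%:E.
  rewrite cells_probE; congr EFin.
  rewrite (bigD1 v)//= mem_set// mulr1 big1 ?addr0// => w wv.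
  by rewrite memNset ?mulr0// => /= wv'; rewrite wv' eqxx in wv.
by rewrite mulrC EFinM; congr (_ * _)%E; exact: Pv.
Qed.

End weights.
End finite_space.

Section two_point_experiment.
Variable R : realType.
Variables (n m : nat) (U u sigma : R) (M : 'M[R]_m).
Local Notation I := ('I_m * 'I_m)%type.
Local Notation sg := (sgb R).
Local Notation p := (n%:R / m%:R ^+ 2 : R).
Hypothesis nm : (n <= m ^ 2)%N.
Hypothesis u01 : 0 <= u <= 1.
Hypothesis Mu : forall i j, M i j ^+ 2 = u ^+ 2.
Hypothesis sigma_u : sigma ^+ 2 = 1 - u ^+ 2.
Hypothesis U2 : 2 <= U.

Definition bern_weight (q : R) (b : bool) : R := if b then q else 1 - q.
(** The law on -1 and 1 with mean x; its variance is 1 - x^2. *)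
Definition sign_weight (x : R) (s : bool) : R := (1 + x * sg s) / 2.
Definition cell_weight (ij : I) (c : bool * bool) : R :=
  bern_weight p c.1 * sign_weight (M ij.1 ij.2) c.2.
Definition cells_weight (w : {ffun I -> bool * bool}) : R :=
  \prod_ij cell_weight ij (w ij).

Lemma p01 : 0 <= p <= 1.
Proof.
rewrite divr_ge0//= -natrX; have [->|m0] := posnP m.
  by rewrite exp0n// invr0 mulr0.
by rewrite ler_pdivrMr ?mul1r ?ler_nat// ltr0n expn_gt0 m0.
Qed.

Lemma M_le1 i j : `|M i j| <= 1.
Proof.
have : `|M i j| ^+ 2 <= 1.
  rewrite real_normK ?num_real// Mu; case/andP: u01 => u0 u1.
  by rewrite expr_le1.
by rewrite expr_le1.
Qed.

Lemma sign_weight_ge0 i j s : 0 <= sign_weight (M i j) s.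
Proof.
rewrite divr_ge0//; have := M_le1 i j; rewrite ler_norml.
by case: s; rewrite /sgb ?expr1 ?expr0 ?mulr1 ?mulrN1; lra.
Qed.

Lemma cells_weight_ge0 w : 0 <= cells_weight w.
Proof.
apply: prodr_ge0 => ij _; rewrite mulr_ge0 ?sign_weight_ge0//.
by have := p01; rewrite /bern_weight; case: (w ij).1; lra.
Qed.

Lemma sum_bool2 (f : bool * bool -> R) :
  \sum_c f c = f (true, true) + f (true, false) + (f (false, true) + f (false, false)).
Proof. by rewrite sum_pair big_bool !big_bool. Qed.

Lemma sum_cell_weight ij : \sum_c cell_weight ij c = 1.
Proof.
rewrite sum_bool2 /cell_weight /sign_weight /bern_weight /sgb /=.
by move: (_ / _) => q; field.
Qed.

Lemma sum_cells_weight_prod (f : I -> bool * bool -> R) :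
  \sum_w cells_weight w * \prod_ij f ij (w ij) =
  \prod_ij \sum_c cell_weight ij c * f ij c.
Proof.
by rewrite bigA_distr_bigA/=; apply: eq_bigr => w _; rewrite -big_split.
Qed.

Lemma sum_cells_weight_cell ij (f : bool * bool -> R) :
  \sum_w cells_weight w * f (w ij) = \sum_c cell_weight ij c * f c.
Proof.
have := sum_cells_weight_prod (fun kl c => if kl == ij then f c else 1).
rewrite (bigD1 ij)//= [X in _ = _ * X -> _]big1 => [|kl kli]; last first.
  rewrite (negbTE kli); under eq_bigr do rewrite mulr1.
  exact: sum_cell_weight.
rewrite eqxx mulr1 => <-; apply: eq_bigr => w _; congr (_ * _).
rewrite (bigD1 ij)//= eqxx big1 ?mulr1// => kl kli.
by rewrite (negbTE kli).
Qed.

Lemma sum_cells_weight : \sum_w cells_weight w = 1.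
Proof.
transitivity (\sum_w cells_weight w * \prod_(ij : I) 1).
  by apply: eq_bigr => w _; rewrite big1_eq mulr1.
rewrite (sum_cells_weight_prod (fun _ _ => 1)) big1// => ij _.
by under eq_bigr do rewrite mulr1; exact: sum_cell_weight.
Qed.

Definition two_point_prob : probability (cells I) R :=
  cells_probability cells_weight_ge0 sum_cells_weight.

Definition cell_B (i j : 'I_m) (w : cells I) : bool := (w (i, j)).1.
Definition cell_eps (i j : 'I_m) (w : cells I) : R := sg (w (i, j)).2 - M i j.

HB.instance Definition _ i j := @isMeasurableFun.Build _ _ _ _ (cell_B i j)
  (measurable_fun_cells (cell_B i j)).
HB.instance Definition _ i j := @isMeasurableFun.Build _ _ _ _ (cell_eps i j)
  (measurable_fun_cells (cell_eps i j)).

Lemma two_point_probE (A : set (cells I)) :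
  two_point_prob A = (\sum_w cells_weight w * (w \in A)%:R)%:E.
Proof. exact: cells_probE. Qed.

Lemma two_point_cell_probE ij (A : set (cells I)) (f : bool * bool -> bool) :
  (forall w : cells I, (w \in A) = f (w ij)) ->
  two_point_prob A = (\sum_c cell_weight ij c * (f c)%:R)%:E.
Proof.
move=> Af; rewrite two_point_probE; congr EFin.
rewrite -(sum_cells_weight_cell ij (fun c => (f c)%:R)).
by apply: eq_bigr => w _; rewrite Af.
Qed.

Lemma two_point_B i j (E : set bool) :
  two_point_prob (cell_B i j @^-1` E) =
  (\sum_b bern_weight p b * (b \in E)%:R)%:E.
Proof.
rewrite (two_point_cell_probE (ij := (i, j)) (f := fun c => c.1 \in E)); last first.
  by move=> w; apply: asbool_equiv_eq.
congr EFin; rewrite sum_pair; apply: eq_bigr => b _.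
rewrite big_bool /cell_weight/= /sign_weight /sgb.
by move: (_ / _) => q; field.
Qed.

Lemma two_point_eps i j (G : set R) :
  two_point_prob (cell_eps i j @^-1` G) =
  (\sum_s sign_weight (M i j) s * (sg s - M i j \in G)%:R)%:E.
Proof.
rewrite (two_point_cell_probE (ij := (i, j)) (f := fun c => sg c.2 - M i j \in G)); last first.
  by move=> w; apply: asbool_equiv_eq.
congr EFin; rewrite sum_pair big_bool !big_bool /cell_weight/= /bern_weight.
by move: (_ / _) => q; ring.
Qed.

Lemma two_point_bernoulli i j :
  two_point_prob (cell_B i j @^-1` [set true]) = p%:E.
Proof.
rewrite two_point_B big_bool /= mem_set// memNset// mulr1 mulr0 addr0.
by [].
Qed.

Lemma two_point_mean i j : ('E_two_point_prob[cell_eps i j] = 0)%E.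
Proof.
rewrite expectation_cells.
rewrite (sum_cells_weight_cell (i, j) (fun c => sg c.2 - M i j)) sum_bool2.
rewrite /cell_weight /sign_weight /bern_weight /sgb /=; congr EFin.
by move: (_ / _) => q; field.
Qed.

Lemma two_point_var i j :
  ('E_two_point_prob[(fun w => cell_eps i j w ^+ 2)%R] = (sigma ^+ 2)%:E)%E.
Proof.
rewrite expectation_cells.
rewrite (sum_cells_weight_cell (i, j) (fun c => (sg c.2 - M i j) ^+ 2)) sum_bool2.
rewrite /cell_weight /sign_weight /bern_weight /sgb sigma_u -(Mu i j) /=.
by congr EFin; move: (_ / _) => q; field.
Qed.

Lemma two_point_bound :
  {ae two_point_prob, forall w, forall i j, `|cell_eps i j w| <= U}.
Proof.
(* The noise is a sign minus a mean in [-1, 1], hence bounded by 2; this is where 2 <= U enters. *)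
apply: aeW => w i j; rewrite /cell_eps (le_trans (ler_normB _ _))// norm_sg.
by have := M_le1 i j; have := U2; lra.
Qed.

Lemma two_point_indep (E : 'I_m -> 'I_m -> set bool) (G : 'I_m -> 'I_m -> set R) :
  (forall i j, measurable (E i j)) -> (forall i j, measurable (G i j)) ->
  two_point_prob [set w | forall i j, E i j (cell_B i j w) /\ G i j (cell_eps i j w)] =
  (\prod_i \prod_j
    (two_point_prob (cell_B i j @^-1` E i j) * two_point_prob (cell_eps i j @^-1` G i j)))%E.
Proof.
move=> _ _; rewrite two_point_probE.
under [RHS]eq_bigr do under eq_bigr do rewrite two_point_B two_point_eps -EFinM.
under [RHS]eq_bigr do rewrite prodEFin.
rewrite prodEFin; congr EFin.
pose f (ij : I) (c : bool * bool) : R :=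
  (c.1 \in E ij.1 ij.2)%:R * (sg c.2 - M ij.1 ij.2 \in G ij.1 ij.2)%:R.
transitivity (\sum_w cells_weight w * \prod_ij f ij (w ij)).
  apply: eq_bigr => w _; congr (_ * _).
  have [wA|wA] := boolP (w \in _).
    rewrite big1// => -[i j] _; move/set_mem: wA => /(_ i j)[wE wG].
    by rewrite /f/= !mem_set// mulr1.
  have /existsNP[i /existsNP[j /not_andP wij]] : ~ (forall i j,
      E i j (cell_B i j w) /\ G i j (cell_eps i j w)).
    by move=> wA'; move/negP: wA; apply; apply/mem_set.
  rewrite (bigD1 (i, j))//= /f/=; case: wij => wij.
    by rewrite memNset// !mul0r.
  by rewrite [sg _ - _ \in _]memNset// mulr0 mul0r.
rewrite sum_cells_weight_prod pair_bigA/=; apply: eq_bigr => -[i j] _.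
rewrite sum_pair mulr_suml; apply: eq_bigr => b _.
rewrite mulr_sumr; apply: eq_bigr => s _.
by rewrite /f /cell_weight /=; ring.
Qed.

Definition two_point_experiment : experiment n m U sigma :=
  @Experiment R n m U sigma _ (cells I) two_point_prob
    (fun i j => cell_B i j) (fun i j => cell_eps i j)
    two_point_bernoulli two_point_indep two_point_mean two_point_var two_point_bound.

End two_point_experiment.

Section observation_law.
Variable R : realType.
Variables (n m : nat).
Local Notation I := ('I_m * 'I_m)%type.
Local Notation sg := (sgb R).
Local Notation p := (n%:R / m%:R ^+ 2 : R).
Hypothesis nm : (n <= m ^ 2)%N.

(* The value None stands for an unobserved entry. *)
Definition obs_weight (x : R) (o : option bool) : R :=
  if o is Some s then p * sign_weight x s else 1 - p.

Definition obs_law (M : 'M[R]_m) (o : {ffun I -> option bool}) : R :=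
  \prod_ij obs_weight (M ij.1 ij.2) (o ij).

Definition obs_cell (c : bool * bool) : option bool :=
  if c.1 then Some c.2 else None.

Definition obs_data (o : {ffun I -> option bool}) : data R m :=
  [tuple [tuple (o (i, j) != None, if o (i, j) is Some s then sg s else 0)
         | j < m] | i < m].

(** [obs_law] is the image of the cell law under forgetting the signs of unobserved entries. The
    data depend on a cell only through this image, so null and alternatives live on one finite
    space. *)
Lemma sum_cells_weight_obs (M : 'M[R]_m) (F : {ffun I -> option bool} -> R) :
  \sum_w cells_weight n M w * F [ffun ij => obs_cell (w ij)] =
  \sum_o obs_law M o * F o.
Proof.
transitivity (\sum_w \sum_o F o *
   (cells_weight n M w * \prod_ij (o ij == obs_cell (w ij))%:R)).
  apply: eq_bigr => w _; rewrite (bigD1 [ffun ij => obs_cell (w ij)])//=.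
  rewrite big1 => [|ij _]; last by rewrite ffunE eqxx.
  rewrite mulr1 [RHS]addrC big1 ?add0r 1?mulrC// => o ow.
  have [ij oij] : exists ij, o ij != obs_cell (w ij).
    apply/existsP; rewrite -negb_forall; apply: contra ow => /forallP H.
    by apply/eqP/ffunP => ij; rewrite ffunE; apply/eqP.
  by rewrite (bigD1 ij)//= (negbTE oij) mul0r !mulr0.
rewrite exchange_big/=; apply: eq_bigr => o _; rewrite -mulr_sumr mulrC.
rewrite (sum_cells_weight_prod n M (fun ij c => (o ij == obs_cell c)%:R)).
congr (_ * _); apply: eq_bigr => ij _; rewrite sum_bool2.
rewrite /cell_weight /obs_weight /obs_cell /bern_weight /=.
by case: (o ij) => [[]|] /=; rewrite ?eqxx /sign_weight /sgb; move: (_ / _) => q; field.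
Qed.

Section two_point.
Variables (U u sigma : R) (M : 'M[R]_m).
Hypothesis u01 : 0 <= u <= 1.
Hypothesis Mu : forall i j, M i j ^+ 2 = u ^+ 2.
Hypothesis sigma_u : sigma ^+ 2 = 1 - u ^+ 2.
Hypothesis U2 : 2 <= U.

Lemma observe_two_point (w : cells I) :
  observe (X := two_point_experiment nm u01 Mu sigma_u U2) M w =
  obs_data [ffun ij => obs_cell (w ij)].
Proof.
apply: eq_from_tnth => i; rewrite !tnth_mktuple.
apply: eq_from_tnth => j; rewrite !tnth_mktuple.
rewrite ffunE /obs_cell /= /cell_B /cell_eps.
by case: (w (i, j)) => -[] s /=; rewrite ?mul0r// mul1r addrC subrK.
Qed.

Lemma prob_two_point (ev : set (data R m)) :
  eprob (two_point_experiment nm u01 Mu sigma_u U2)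
    [set w | ev (observe M w)] =
  (\sum_o obs_law M o * (obs_data o \in ev)%:R)%:E.
Proof.
rewrite two_point_probE -(sum_cells_weight_obs M (fun o => (obs_data o \in ev)%:R)).
congr EFin; apply: eq_bigr => w _; congr (_ * _); congr (nat_of_bool _)%:R.
by rewrite -observe_two_point; apply: asbool_equiv_eq.
Qed.

Lemma expectation_two_point (f : data R m -> R) :
  ('E_(eprob (two_point_experiment nm u01 Mu sigma_u U2))[
     (fun w => f (observe M w))%R] = (\sum_o obs_law M o * f (obs_data o))%:E)%E.
Proof.
rewrite expectation_cells -(sum_cells_weight_obs M (fun o => f (obs_data o))).
by congr EFin; apply: eq_bigr => w _; rewrite -observe_two_point.
Qed.

End two_point.

(** Density of [obs_law M] with respect to [obs_law 0]; unobserved entries carry no information and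
    contribute 1. *)
Definition likelihood (M : 'M[R]_m) (o : {ffun I -> option bool}) : R :=
  \prod_ij (if o ij is Some s then 1 + M ij.1 ij.2 * sg s else 1).

Lemma obs_law_likelihood M o : obs_law M o = obs_law 0 o * likelihood M o.
Proof.
rewrite -big_split; apply: eq_bigr => ij _; rewrite /obs_weight /sign_weight mxE.
by case: (o ij) => [s|] /=; ring.
Qed.

Lemma obs_law0_ge0 o : 0 <= obs_law 0 o.
Proof.
apply: prodr_ge0 => ij _; have /andP[p0 p1] := p01 R nm; rewrite /obs_weight mxE.
by case: (o ij) => [s|]; rewrite ?subr_ge0// /sign_weight mul0r addr0 mulr_ge0.
Qed.

Lemma sum_option_bool (f : option bool -> R) :
  \sum_c f c = f None + f (Some true) + f (Some false).
Proof.
rewrite (bigD1 None)//= (bigD1 (Some true))//= (bigD1 (Some false))//=.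
by rewrite big_pred0 ?addr0 ?addrA// => -[[]|].
Qed.

(** The sum factors over entries. Under the null an observed sign is fair, so the terms linear in it
    vanish and the product of the two means remains, with weight p. *)
Lemma sum_obs_law0_likelihood2 M M' :
  \sum_o obs_law 0 o * (likelihood M o * likelihood M' o) =
  \prod_i \prod_j (1 + p * (M i j * M' i j)).
Proof.
rewrite pair_bigA/=.
transitivity (\prod_(ij : I) \sum_c obs_weight 0 c *
   ((if c is Some s then 1 + M ij.1 ij.2 * sg s else 1) *
    (if c is Some s then 1 + M' ij.1 ij.2 * sg s else 1))).
  rewrite bigA_distr_bigA/=; apply: eq_bigr => o _.
  by rewrite /likelihood /obs_law -!big_split; apply: eq_bigr => ij _; rewrite mxE.
apply: eq_bigr => ij _; rewrite sum_option_bool /obs_weight /sign_weight /sgb.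
by move: (_ / _) => q; field.
Qed.

Lemma likelihood0 o : likelihood 0 o = 1.
Proof.
by rewrite /likelihood big1// => ij _; rewrite mxE; case: (o ij) => [s|]; rewrite ?mul0r ?addr0.
Qed.

Lemma sum_obs_law0 : \sum_o obs_law 0 o = 1.
Proof.
transitivity (\sum_o obs_law 0 o * (likelihood 0 o * likelihood 0 o)).
  by apply: eq_bigr => o _; rewrite likelihood0 !mulr1.
rewrite sum_obs_law0_likelihood2 big1// => i _; rewrite big1// => j _.
by rewrite mxE !mulr0 addr0.
Qed.

Lemma sum_obs_law0_likelihood M : \sum_o obs_law 0 o * likelihood M o = 1.
Proof.
transitivity (\sum_o obs_law 0 o * (likelihood M o * likelihood 0 o)).
  by apply: eq_bigr => o _; rewrite likelihood0 mulr1.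
rewrite sum_obs_law0_likelihood2 big1// => i _; rewrite big1// => j _.
by rewrite [X in _ * (_ * X)]mxE !mulr0 addr0.
Qed.

(* The chi-square bound on the total variation distance between the null and
   the mixture of the alternatives. *)
Lemma null_le_mixture (T : finType) (t0 : T) (M : T -> 'M[R]_m)
    (delta : R) (F : {ffun I -> option bool} -> R) :
  0 < delta -> (forall o, 0 <= F o <= 1) ->
  avg (fun t => avg (fun t' =>
    \prod_i \prod_j (1 + p * (M t i j * M t' i j)))) <= 1 + delta ^+ 2 ->
  \sum_o obs_law 0 o * F o <= avg (fun t => \sum_o obs_law (M t) o * F o) + delta.
Proof.
move=> d0 F01 chi.
pose L o := avg (fun t => likelihood (M t) o).
have avg_sum (g : T -> {ffun I -> option bool} -> R) :
    avg (fun t => \sum_o g t o) = \sum_o avg (g^~ o).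
  by rewrite /avg exchange_big/= mulr_suml.
have avgE : avg (fun t => \sum_o obs_law (M t) o * F o) =
    \sum_o obs_law 0 o * F o * L o.
  rewrite avg_sum; apply: eq_bigr => o _; rewrite -avgZ; apply: eq_avg => t.
  by rewrite obs_law_likelihood; ring.
have L1 : \sum_o obs_law 0 o * L o = 1.
  rewrite -[RHS](avg_cst t0) /L; under eq_bigr do rewrite -avgZ.
  by rewrite -avg_sum; apply: eq_avg => t; exact: sum_obs_law0_likelihood.
have L2 : \sum_o obs_law 0 o * L o ^+ 2 <= 1 + delta ^+ 2.
  apply: le_trans chi; rewrite le_eqVlt; apply/orP; left; apply/eqP.
  under [RHS]eq_avg do under eq_avg do rewrite -sum_obs_law0_likelihood2.
  under [RHS]eq_avg do rewrite avg_sum.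
  rewrite avg_sum; apply: eq_bigr => o _.
  under [RHS]eq_avg do rewrite avgZ.
  rewrite avgZ; congr (_ * _); under [RHS]eq_avg do rewrite avgZ.
  rewrite -/(L o) expr2 -avgZ; apply: eq_avg => t; exact: mulrC.
rewrite avgE -lerBlDl -sumrB.
(* Pointwise (1 - L) F <= |1 - L| <= (delta + (1 - L)^2 / delta) / 2. The mean of (1 - L)^2 is at
   most delta^2, so the total is at most delta. *)
apply: (@le_trans _ _ (\sum_o obs_law 0 o *
   ((delta + (1 - 2 * L o + L o ^+ 2) / delta) / 2))).
  apply: ler_sum => o _; rewrite -mulrA -mulrBr ler_wpM2l ?obs_law0_ge0//.
  apply: (@le_trans _ _ `|1 - L o|).
    rewrite (le_trans (ler_norm _))// -{1}[F o]mulr1 -mulrBr normrM.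
    by case/andP: (F01 o) => f0 f1; rewrite ger0_norm// ler_piMl.
  have -> : (delta + (1 - 2 * L o + L o ^+ 2) / delta) / 2 =
     ((delta - `|1 - L o|) ^+ 2 / delta) / 2 + `|1 - L o|.
    rewrite sqrrB real_normK ?num_real//; field.
    by rewrite gt_eqF.
  by rewrite lerDr divr_ge0// divr_ge0 ?sqr_ge0// ltW.
have -> : \sum_o obs_law 0 o * ((delta + (1 - 2 * L o + L o ^+ 2) / delta) / 2) =
    (delta + 1 / delta) / 2 * \sum_o obs_law 0 o - (\sum_o obs_law 0 o * L o) / delta
    + (\sum_o obs_law 0 o * L o ^+ 2) / (2 * delta).
  rewrite mulr_sumr !mulr_suml -sumrB -big_split/=; apply: eq_bigr => o _.
  by field; rewrite gt_eqF.
rewrite sum_obs_law0 L1 mulr1.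
have : (\sum_o obs_law 0 o * L o ^+ 2) / (2 * delta) <= (1 + delta ^+ 2) / (2 * delta).
  by rewrite ler_wpM2r// invr_ge0 mulr_ge0// ltW.
have -> : (1 + delta ^+ 2) / (2 * delta) = delta - ((delta + 1 / delta) / 2 - 1 / delta).
  by field; rewrite gt_eqF.
lra.
Qed.

End observation_law.

(** * Moments under an arbitrary experiment *)

Section independence.
Context d (T : measurableType d) (R : realType).
Variable mu : {measure set T -> \bar R}.
Import HBNNSimple.

Lemma ge0_integral_approx (e h : T -> R) (f : R -> R)
    (mf : measurable_fun [set: R] (EFin \o f)) :
  measurable_fun setT e -> measurable_fun setT h ->
  (forall w, 0 <= h w) -> (forall x, 0 <= f x) ->
  let f_ := nnsfun_approx measurableT mf in
  (\int[mu]_w (h w * f (e w))%:E = limn (fun n => \sum_(r \in range (f_ n))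
    (r%:E * \int[mu]_w (h w * \1_(f_ n @^-1` [set r]) (e w))%:E)))%E.
Proof.
move=> me mh h0 f0 f_.
have fcvg x : EFin \o f_ ^~ x @ \oo --> (f x)%:E.
  by apply: cvg_nnsfun_approx => // y _; rewrite lee_fin.
have mfe n : measurable_fun setT (fun w => h w * f_ n (e w)).
  apply: measurable_funM => //; apply: measurableT_comp => //.
transitivity (limn (fun n => \int[mu]_w (h w * f_ n (e w))%:E))%E.
  rewrite -monotone_convergence//=.
  - apply: eq_integral => w _; apply/esym/cvg_lim => //.
    rewrite EFinM; under eq_fun do rewrite EFinM.
    by apply: cvgeZl => //; exact: fcvg.
  - by move=> n; exact/measurable_EFinP.
  - by move=> n w _; rewrite lee_fin mulr_ge0.
  - move=> w _ a b ab; rewrite lee_fin ler_wpM2l//.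
    exact/lefP/nd_nnsfun_approx.
congr (limn _); apply/funext => n.
have rng0 r : r \in range (f_ n) -> 0 <= r by move=> /set_mem[x _ <-].
have finr : finite_set (range (f_ n)) by [].
rewrite fsbig_finite//=.
transitivity (\int[mu]_w (\sum_(r <- finmap.enum_fset (fset_set (range (f_ n))))
    (r * (h w * \1_(f_ n @^-1` [set r]) (e w)))%:E))%E.
  apply: eq_integral => w _; rewrite sumEFin; congr EFin.
  rewrite fimfunE fsbig_finite//= mulr_sumr.
  by apply: eq_bigr => r _; rewrite mulrCA.
have mr r : measurable_fun setT (fun w => h w * \1_(f_ n @^-1` [set r]) (e w)).
  by apply: measurable_funM => //; apply: measurableT_comp.
rewrite ge0_integral_sum//; last 2 first.
- by move=> r; apply/measurable_EFinP; exact: measurable_funM.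
- move=> r w _; rewrite lee_fin mulrCA mulr_ge0// indicE.
  have [/set_mem/= <-|] := boolP (_ \in _); last by rewrite mulr0.
  by rewrite mulr1.
rewrite big_seq [RHS]big_seq.
apply: eq_bigr => r; rewrite in_fset_set// => /rng0 r0.
under eq_integral do rewrite EFinM.
rewrite ge0_integralZl//; first exact/measurable_EFinP.
by move=> w _; rewrite lee_fin mulr_ge0.
Qed.

(** Approximating [f] by simple functions shows that the integral depends on [h] only through its
    integrals over the events generated by [e]. *)
Lemma ge0_integral_transfer (e h h' : T -> R) (f : R -> R) :
  measurable_fun setT e -> measurable_fun setT h -> measurable_fun setT h' ->
  measurable_fun [set: R] f ->
  (forall w, 0 <= h w) -> (forall w, 0 <= h' w) -> (forall x, 0 <= f x) ->
  (forall G : set R, measurable G ->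
    \int[mu]_w (h w * \1_G (e w))%:E = \int[mu]_w (h' w * \1_G (e w))%:E)%E ->
  (\int[mu]_w (h w * f (e w))%:E = \int[mu]_w (h' w * f (e w))%:E)%E.
Proof.
move=> me mh mh' mf h0 h'0 f0 hh.
have mf' : measurable_fun [set: R] (EFin \o f) by exact/measurable_EFinP.
rewrite !(ge0_integral_approx mf')//; congr (limn _); apply/funext => n.
by apply: eq_fsbigr => r _; congr (_ * _)%E; exact: hh.
Qed.
End independence.

Section product_rule.
Context d (T : measurableType d) (R : realType) (P : probability T R).
Variables (I : finType) (B : I -> T -> bool) (e : I -> T -> R).
Variables (pB : I -> set bool -> R) (pe : I -> set R -> R).
Hypothesis mB : forall i, measurable_fun setT (B i).
Hypothesis me : forall i, measurable_fun setT (e i).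
Hypothesis pB0 : forall i E, 0 <= pB i E.
Hypothesis pe0 : forall i G, 0 <= pe i G.
Hypothesis Pe : forall i G, measurable G -> P (e i @^-1` G) = (pe i G)%:E.
Hypothesis PBe : forall (E : I -> set bool) (G : I -> set R),
  (forall i, measurable (G i)) ->
  P [set w | forall i, E i (B i w) /\ G i (e i w)] =
  (\prod_i (pB i (E i) * pe i (G i)))%:E.

Let mEB i (A : set bool) : measurable_fun setT (fun w => \1_A (B i w) : R).
Proof.
have m1 : measurable_fun setT (\1_A : bool -> R) by exact: measurable_indic.
exact: (measurableT_comp m1 (mB i)).
Qed.

Let mGe i (A : set R) : measurable A ->
  measurable_fun setT (fun w => \1_A (e i w) : R).
Proof.
move=> mA; have m1 : measurable_fun setT (\1_A : R -> R) by exact: measurable_indic.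
exact: (measurableT_comp m1 (me i)).
Qed.

Let mge i (g : R -> R) : measurable_fun [set: R] g ->
  measurable_fun setT (fun w => g (e i w)).
Proof. by move=> mg; exact: (measurableT_comp mg (me i)). Qed.

(** Independence is given for events only. Indicators are replaced by the functions [g i] one
    coordinate at a time, [S] being the coordinates already treated. The sets [G] elsewhere stay
    arbitrary: testing the new coordinate on every event is what the transfer lemma asks for. *)
Lemma integral_prod_indep_fixed (E : I -> set bool) (g : I -> R -> R) (c : I -> R) :
  (forall i, measurable_fun [set: R] (g i)) -> (forall i x, 0 <= g i x) ->
  (forall i, \int[P]_w (g i (e i w))%:E = (c i)%:E)%E ->
  (\int[P]_w (\prod_i (\1_(E i) (B i w) * g i (e i w)))%:E =
   (\prod_i (pB i (E i) * c i))%:E)%E.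
Proof.
move=> mg g0 gc.
have c0 i : 0 <= c i.
  by rewrite -lee_fin -gc integral_ge0// => w _; rewrite lee_fin.
pose F (S : {set I}) (G : I -> set R) i w :=
  \1_(E i) (B i w) * (if i \in S then g i (e i w) else \1_(G i) (e i w)).
have F0 S G i w : 0 <= F S G i w.
  by rewrite /F mulr_ge0//; case: ifP.
have mF S G i : (forall i, measurable (G i)) -> measurable_fun setT (F S G i).
  move=> mG; apply: measurable_funM.
    exact: mEB.
  by case: (i \in S); [exact: (mge i (mg i))|exact: (mGe i (mG i))].
suff H (S : {set I}) (G : I -> set R) : (forall i, measurable (G i)) ->
    (\int[P]_w (\prod_i F S G i w)%:E =
     (\prod_i (pB i (E i) * (if i \in S then c i else pe i (G i))))%:E)%E.
  have := H [set: I]%SET (fun=> setT) (fun=> measurableT).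
  under eq_integral do under eq_bigr do rewrite /F finset.in_setT.
  by move=> ->; congr EFin; apply: eq_bigr => i _; rewrite finset.in_setT.
have [n] := ubnP #|S|; elim: n => // n IH in S G *.
rewrite ltnS => Sn mG.
have [S0|/finset.set0Pn[x xS]] := eqVneq S finset.set0.
  rewrite [X in _ = X%:E](eq_bigr (fun i => pB i (E i) * pe i (G i))); last first.
    by move=> i _; rewrite S0 finset.in_set0.
  rewrite -(PBe E mG).
  set A := [set w | _]; have FA w : \prod_i F S G i w = \1_A w.
    rewrite indicE; have [wA|wA] := boolP (w \in A).
      rewrite big1// => i _; have [wE wG] := set_mem wA i.
      by rewrite /F S0 finset.in_set0 !indicE !mem_set// mulr1.
    have /existsNP[i /not_andP wi] : ~ (forall i, E i (B i w) /\ G i (e i w)).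
      by move=> wA'; move/negP: wA; apply; apply/mem_set.
    rewrite (bigD1 i)//= {1}/F S0 finset.in_set0 !indicE.
    case: wi => wi; first by rewrite [B i w \in _]memNset// !mul0r.
    by rewrite [e i w \in _]memNset// mulr0 mul0r.
  under eq_integral do rewrite FA.
  rewrite integral_indic ?setIT//; apply/(measurable_indicP R).
  rewrite (_ : \1_A = fun w => \prod_i F S G i w); last by apply/funext => w; rewrite FA.
  by apply: measurable_prod => i _; exact: mF.
pose S' := S :\ x.
have S'n : (#|S'| < n)%N by move: Sn; rewrite (cardsD1 x S) xS.
pose h w := \1_(E x) (B x w) * \prod_(i | i != x) F S G i w.
pose K := pB x (E x) * \prod_(i | i != x) (pB i (E i) * (if i \in S then c i else pe i (G i))).
have K0 : 0 <= K.
  rewrite mulr_ge0// prodr_ge0// => i _; rewrite mulr_ge0//; by case: ifP.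
have h0 w : 0 <= h w by rewrite mulr_ge0// prodr_ge0.
have mh : measurable_fun setT h.
  apply: measurable_funM; first exact: mEB.
  under eq_fun do rewrite big_mkcond/=.
  by apply: measurable_prod => i _; case: (i != x); [exact: mF|exact: measurable_cst].
transitivity (\int[P]_w (h w * g x (e x w))%:E)%E.
  apply: eq_integral => w _; congr EFin; rewrite (bigD1 x)//= /h {1}/F xS; ring.
have -> : (\int[P]_w (h w * g x (e x w))%:E = \int[P]_w (K * g x (e x w))%:E)%E.
  apply: ge0_integral_transfer => // G' mG'.
  pose G2 i := if i == x then G' else G i.
  have mG2 i : measurable (G2 i) by rewrite /G2; case: ifP.
  transitivity (\int[P]_w (\prod_i F S' G2 i w)%:E)%E.
    apply: eq_integral => w _; congr EFin.
    rewrite [RHS](bigD1 x)//= {1}/F in_setD1 eqxx/= /G2 eqxx /h.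
    rewrite mulrAC; congr (_ * _); apply: eq_bigr => i ix.
    by rewrite /F in_setD1 ix (negbTE ix).
  rewrite IH//; under eq_integral do rewrite EFinM.
  rewrite ge0_integralZl//; last by apply/measurable_EFinP; exact: (mGe x mG').
  have -> : (\int[P]_w (\1_G' (e x w))%:E = P (e x @^-1` G'))%E.
    transitivity (\int[P]_w (\1_(e x @^-1` G') w)%:E)%E.
      apply: eq_integral => w _; rewrite !indicE.
      by congr (nat_of_bool _)%:R%:E; apply: asbool_equiv_eq.
    by rewrite integral_indic ?setIT// -[X in measurable X]setTI; exact: me.
  rewrite Pe// -EFinM; congr EFin.
  rewrite (bigD1 x)//= in_setD1 eqxx/= /G2 eqxx /K mulrAC; congr (_ * _).
  by congr (_ * _); apply: eq_bigr => i ix; rewrite in_setD1 ix (negbTE ix).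
under eq_integral do rewrite EFinM.
rewrite ge0_integralZl//; last 2 first.
- by apply/measurable_EFinP; exact: (mge x (mg x)).
- by move=> w _; rewrite lee_fin.
rewrite gc -EFinM; congr EFin; rewrite (bigD1 x)//= xS /K; ring.
Qed.

Lemma integral_prod_indep (g : I -> bool -> R -> R) (c : I -> bool -> R) :
  (forall i b, measurable_fun [set: R] (g i b)) -> (forall i b x, 0 <= g i b x) ->
  (forall i b, \int[P]_w (g i b (e i w))%:E = (c i b)%:E)%E ->
  (\int[P]_w (\prod_i g i (B i w) (e i w))%:E =
   (\prod_i \sum_b pB i [set b] * c i b)%:E)%E.
Proof.
move=> mg g0 gc.
(* Splitting according to the values of all [B i] reduces to factors in which the Boolean argument
   is fixed. *)
pose F (b : {ffun I -> bool}) w := \prod_i (\1_[set b i] (B i w) * g i (b i) (e i w)).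
transitivity (\int[P]_w (\sum_b (F b w)%:E))%E.
  apply: eq_integral => w _; rewrite sumEFin; congr EFin.
  rewrite /F -(bigA_distr_bigA (fun i b => \1_[set b] (B i w) * g i b (e i w))).
  have in1 (b b' : bool) : (b \in [set b']) = (b == b').
    by apply/idP/eqP => [/set_mem//|->]; exact: mem_set.
  apply: eq_bigr => i _; rewrite big_bool !indicE !in1.
  by case: (B i w); rewrite /= mul1r mul0r ?addr0 ?add0r.
rewrite ge0_integral_sum//; last 2 first.
- move=> b; apply/measurable_EFinP; apply: measurable_prod => i _.
  by apply: measurable_funM; [exact: mEB|exact: (mge i (mg i (b i)))].
- by move=> b w _; rewrite lee_fin prodr_ge0// => i _; rewrite mulr_ge0.
rewrite bigA_distr_bigA -sumEFin; apply: eq_bigr => b _.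
by rewrite (@integral_prod_indep_fixed (fun i => [set b i]) (fun i => g i (b i))
  (fun i => c i (b i))).
Qed.
End product_rule.

Section experiment_moments.
Variables (R : realType) (n m : nat) (U sigma : R) (X : experiment n m U sigma).
Local Notation I := ('I_m * 'I_m)%type.
Local Notation P := (eprob X).
Local Notation p := (n%:R / m%:R ^+ 2 : R).

Lemma measurable_eB i j (E : set bool) : measurable (eB X i j @^-1` E).
Proof. by rewrite -[Y in measurable Y]setTI; apply: measurable_funPT. Qed.

Lemma measurable_eeps i j (G : set R) : measurable G -> measurable (eeps X i j @^-1` G).
Proof. by move=> mG; rewrite -[Y in measurable Y]setTI; apply: measurable_funPT. Qed.

Lemma experiment_p01 (i j : 'I_m) : 0 <= p <= 1.
Proof.
rewrite divr_ge0//= -lee_fin -(eB_bernoulli X i j).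
by rewrite probability_le1//; exact: measurable_eB.
Qed.

Lemma integrable_eps_sqr i j : P.-integrable setT (fun w => (eeps X i j w ^+ 2)%:E).
Proof.
apply/integrableP; split.
  by apply/measurable_EFinP; exact: measurable_funX.
have := eeps_var X i j; rewrite unlock => H.
under eq_integral do rewrite gee0_abs ?lee_fin ?sqr_ge0//.
by rewrite H ltry.
Qed.

Lemma integrable_eps i j : P.-integrable setT (fun w => (eeps X i j w)%:E).
Proof.
apply: (@le_integrable _ _ _ P setT _ _ (fun w => (1 + eeps X i j w ^+ 2)%:E)) => //.
- exact/measurable_EFinP.
- move=> w _; rewrite lee_fin.
  have e0 : 0 <= eeps X i j w ^+ 2 by exact: sqr_ge0.
  rewrite [leRHS]ger0_norm ?addr_ge0//.
  have := sqr_ge0 (`|eeps X i j w| - 1); rewrite sqrrB real_normK ?num_real//.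
  by have := normr_ge0 (eeps X i j w); lra.
- under eq_fun do rewrite EFinD.
  apply: integrableD => //; last exact: integrable_eps_sqr.
  exact: finite_measure_integrable_cst.
Qed.

Lemma integral_eps_quadratic i j (c0 c1 c2 : R) :
  (\int[P]_w (c0 + c1 * eeps X i j w + c2 * eeps X i j w ^+ 2)%:E =
   (c0 + c2 * sigma ^+ 2)%:E)%E.
Proof.
have := eeps_var X i j; have := eeps_mean X i j.
rewrite unlock => H1 H2.
under eq_integral do rewrite !EFinD (EFinM c1) (EFinM c2).
have i0 : P.-integrable setT (fun=> c0%:E) by exact: finite_measure_integrable_cst.
have i1 : P.-integrable setT (fun w => c1%:E * (eeps X i j w)%:E)%E.
  by apply: integrableZl => //; exact: integrable_eps.
have i2 : P.-integrable setT (fun w => c2%:E * (eeps X i j w ^+ 2)%:E)%E.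
  by apply: integrableZl => //; exact: integrable_eps_sqr.
rewrite integralD//; last exact: integrableD.
rewrite integralD// integral_cst// [X in (_ * X)%E](_ : _ = 1%E) ?mule1; last exact: probability_setT.
rewrite integralZl//; last exact: integrable_eps.
rewrite integralZl//; last exact: integrable_eps_sqr.
by rewrite H1 H2 mule0 adde0 -EFinM -EFinD.
Qed.

Lemma experiment_prod (g : I -> bool -> R -> R) (c : I -> bool -> R) :
  (forall i b, measurable_fun [set: R] (g i b)) -> (forall i b x, 0 <= g i b x) ->
  (forall i b, \int[P]_w (g i b (eeps X i.1 i.2 w))%:E = (c i b)%:E)%E ->
  (\int[P]_w (\prod_ij g ij (eB X ij.1 ij.2 w) (eeps X ij.1 ij.2 w))%:E =
   (\prod_ij ((1 - p) * c ij false + p * c ij true))%:E)%E.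
Proof.
move=> mg g0 gc.
pose pB (ij : I) (E : set bool) := fine (P (eB X ij.1 ij.2 @^-1` E)).
pose pe (ij : I) (G : set R) := fine (P (eeps X ij.1 ij.2 @^-1` G)).
have PB ij E : P (eB X ij.1 ij.2 @^-1` E) = (pB ij E)%:E.
  by rewrite /pB fineK// fin_num_measure//; exact: measurable_eB.
have Pe ij G : measurable G -> P (eeps X ij.1 ij.2 @^-1` G) = (pe ij G)%:E.
  by move=> mG; rewrite /pe fineK// fin_num_measure//; exact: measurable_eeps.
have := @integral_prod_indep _ _ R P I (fun ij => eB X ij.1 ij.2)
  (fun ij => eeps X ij.1 ij.2) pB pe (fun ij => measurable_funPT _) (fun ij => measurable_funPT _)
  (fun ij E => fine_ge0 (measure_ge0 P _)) (fun ij E => fine_ge0 (measure_ge0 P _)) Pe.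
move=> H; rewrite (H _ g c)//.
  congr EFin; apply: eq_bigr => ij _; rewrite big_bool addrC.
  have pt : pB ij [set true] = p by rewrite /pB eB_bernoulli.
  have pf : pB ij [set false] = 1 - p.
    rewrite /pB (_ : _ @^-1` _ = ~` (eB X ij.1 ij.2 @^-1` [set true])); last first.
      by apply/seteqP; split => w /=; case: (eB X _ _ w).
    have := probability_setC P (measurable_eB ij.1 ij.2 [set true]).
    by rewrite eB_bernoulli => ->.
  by rewrite pt pf.
move=> E G mG; rewrite -prodEFin.
under eq_bigr => ij _ do rewrite EFinM -PB -(Pe ij (G ij) (mG ij)).
transitivity (\prod_i \prod_j
    (P (eB X i j @^-1` E (i, j)) * P (eeps X i j @^-1` G (i, j))))%E; last first.
  by rewrite pair_bigA; apply: eq_bigr => -[].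
rewrite -(@eindep _ _ _ _ _ X (fun i j => E (i, j)) (fun i j => G (i, j)))//.
congr (P _); apply/seteqP; split => w /= H' => [i j|[i j]]; [exact: (H' (i, j))|exact: H'].
Qed.

(** Only two moments of the noise are known, so the exponential of v = z (M + eps) is first replaced
    by the quadratic 1 + v + 2 v^2, allowed because |v| <= 1/2 almost surely. Independence then
    factors the integral, and M^2 + sigma^2 <= a^2 + U^2 gives the quadratic term. *)
Lemma experiment_mgf (a : R) (M z : 'M[R]_m) : 0 <= a -> 0 <= U -> sigma ^+ 2 <= U ^+ 2 ->
  (forall i j, `|M i j| <= a) -> (forall i j, `|z i j| * (a + U) <= 1 / 2) ->
  (\int[P]_w (expR (\sum_ij z ij.1 ij.2 *
     ((eB X ij.1 ij.2 w)%:R * (M ij.1 ij.2 + eeps X ij.1 ij.2 w))))%:E <=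
   (expR (p * \sum_ij (z ij.1 ij.2 * M ij.1 ij.2 +
      2 * (a ^+ 2 + U ^+ 2) * z ij.1 ij.2 ^+ 2)))%:E)%E.
Proof.
move=> a0 U0 sU Ma zaU.
pose g (ij : I) (b : bool) (x : R) : R := if b then
  (1 + z ij.1 ij.2 * M ij.1 ij.2 + 2 * (z ij.1 ij.2 * M ij.1 ij.2) ^+ 2) +
  (z ij.1 ij.2 + 4 * z ij.1 ij.2 ^+ 2 * M ij.1 ij.2) * x +
  (2 * z ij.1 ij.2 ^+ 2) * x ^+ 2 else 1.
have gE ij x : g ij true x = 1 + (z ij.1 ij.2 * (M ij.1 ij.2 + x)) +
    2 * (z ij.1 ij.2 * (M ij.1 ij.2 + x)) ^+ 2 by rewrite /g; ring.
have g0 ij b x : 0 <= g ij b x.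
  case: b; last by rewrite /g.
  rewrite gE; move: (_ * (_ + _)) => v.
  by have := sqr_ge0 (1 + 2 * v); rewrite sqrrD; nra.
pose c (ij : I) (b : bool) : R := if b then
  1 + z ij.1 ij.2 * M ij.1 ij.2 + 2 * (z ij.1 ij.2 * M ij.1 ij.2) ^+ 2 +
  (2 * z ij.1 ij.2 ^+ 2) * sigma ^+ 2 else 1.
have mg ij b : measurable_fun [set: R] (g ij b).
  case: b; rewrite /g; last exact: measurable_cst.
  apply: measurable_funD; last by apply: measurable_funM => //; exact: measurable_funX.
  by apply: measurable_funD => //; exact: measurable_funM.
have gc ij b : (\int[P]_w (g ij b (eeps X ij.1 ij.2 w))%:E = (c ij b)%:E)%E.
  case: b; rewrite /g /c; first exact: integral_eps_quadratic.
  by rewrite integral_cst// mul1e; exact: probability_setT.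
have mB ij : measurable_fun setT (fun w => (eB X ij.1 ij.2 w)%:R : R).
  have m1 : measurable_fun setT (fun b : bool => b%:R : R) by [].
  exact: (measurableT_comp m1 (measurable_funPT (eB X ij.1 ij.2))).
have mge ij b : measurable_fun setT (fun w => g ij b (eeps X ij.1 ij.2 w)).
  exact: (measurableT_comp (mg ij b) (measurable_funPT (eeps X ij.1 ij.2))).
apply: (@le_trans _ _ (\int[P]_w (\prod_ij g ij (eB X ij.1 ij.2 w) (eeps X ij.1 ij.2 w))%:E)%E).
  apply: ae_ge0_le_integral => //.
  - apply/measurable_EFinP; apply: measurableT_comp => //.
    apply: measurable_sum => ij; apply: measurable_funM => //.
    by apply: measurable_funM => //; exact: measurable_funD.
  - by move=> w _; rewrite lee_fin prodr_ge0.
  - apply/measurable_EFinP; apply: measurable_prod => ij _.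
    rewrite (_ : (fun w => _) = fun w =>
      (eB X ij.1 ij.2 w)%:R * g ij true (eeps X ij.1 ij.2 w) +
      (1 - (eB X ij.1 ij.2 w)%:R) * g ij false (eeps X ij.1 ij.2 w)); last first.
      by apply/funext => w; case: (eB X _ _ w); rewrite ?subrr ?subr0 ?mul0r ?mul1r ?addr0 ?add0r.
    apply: measurable_funD; apply: measurable_funM => //.
    exact: measurable_funB.
  - have := eeps_bound X; apply: filterS => w Hw _.
    rewrite lee_fin expR_sum; apply: ler_prod => ij _; rewrite expR_ge0/=.
    case: (eB X ij.1 ij.2 w); last by rewrite mul0r mulr0 expR0.
    rewrite mul1r gE; apply: expR_le1D.
    apply: (le_trans (ler_norm _)); rewrite normrM; apply: le_trans (zaU ij.1 ij.2).
    rewrite ler_wpM2l// (le_trans (ler_normD _ _))// lerD//.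
rewrite (experiment_prod mg g0 gc) lee_fin mulr_sumr expR_sum.
apply: ler_prod => ij _; have /andP[p0 p1] := experiment_p01 ij.1 ij.2.
have c0 b : 0 <= c ij b.
  by rewrite -lee_fin -gc integral_ge0// => w _; rewrite lee_fin.
apply/andP; split.
  by apply: addr_ge0; apply: mulr_ge0; rewrite ?subr_ge0.
apply: le_trans (expR_ge1Dx _); rewrite /c mulr1.
have M2 : M ij.1 ij.2 ^+ 2 <= a ^+ 2.
  by rewrite -[M _ _ ^+ 2]real_normK ?num_real// lerXn2r ?nnegrE.
have : z ij.1 ij.2 ^+ 2 * (M ij.1 ij.2 ^+ 2 + sigma ^+ 2) <= z ij.1 ij.2 ^+ 2 * (a ^+ 2 + U ^+ 2).
  by rewrite ler_wpM2l ?sqr_ge0// lerD.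
move=> H; rewrite exprMn.
have := ler_wpM2l p0 H; lra.
Qed.

End experiment_moments.

(** * Packing of low-rank matrices *)

Section frobenius.
Variable R : realType.

Definition fn2 (p q : nat) (A : 'M[R]_(p, q)) : R := \sum_i \sum_j A i j ^+ 2.

Lemma fn2_ge0 p q (A : 'M[R]_(p, q)) : 0 <= fn2 A.
Proof. by apply: sumr_ge0 => i _; apply: sumr_ge0 => j _; exact: sqr_ge0. Qed.

Lemma fn2D_le p q (A B : 'M[R]_(p, q)) : fn2 (A + B) <= 2 * fn2 A + 2 * fn2 B.
Proof.
rewrite /fn2 !mulr_sumr -big_split; apply: ler_sum => i _ /=.
rewrite !mulr_sumr -big_split; apply: ler_sum => j _ /=; rewrite mxE.
by have := sqr_ge0 (A i j - B i j); rewrite sqrrB sqrrD; lra.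
Qed.

Lemma fn2N p q (A : 'M[R]_(p, q)) : fn2 (- A) = fn2 A.
Proof. by apply: eq_bigr => i _; apply: eq_bigr => j _; rewrite mxE sqrrN. Qed.

Lemma fn2B_le p q (A B C : 'M[R]_(p, q)) : fn2 (A - C) <= 2 * fn2 (A - B) + 2 * fn2 (C - B).
Proof.
have -> : A - C = (A - B) + (- (C - B)) by rewrite opprB addrA subrK.
by rewrite (le_trans (fn2D_le _ _))// fn2N.
Qed.

(* Rounding each coefficient up or down so that the new error makes a
   nonpositive inner product with the error accumulated so far. *)
Lemma greedy_rounding (I J : finType) (h : R) (x : I -> R) (v : I -> J -> R) :
  0 < h -> exists y : I -> int,
    (forall i, (h * (y i)%:~R - x i) ^+ 2 <= h ^+ 2) /\
    \sum_j (\sum_i (h * (y i)%:~R - x i) * v i j) ^+ 2 <=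
    h ^+ 2 * \sum_i \sum_j v i j ^+ 2.
Proof.
move=> h0.
suff H (s : seq I) : uniq s -> exists y : I -> int,
    (forall i, (h * (y i)%:~R - x i) ^+ 2 <= h ^+ 2) /\
    \sum_j (\sum_(i <- s) (h * (y i)%:~R - x i) * v i j) ^+ 2 <=
    h ^+ 2 * \sum_(i <- s) \sum_j v i j ^+ 2.
  have [y [y1 y2]] := H _ (index_enum_uniq I).
  by exists y.
have fl i : exists y1 y2 : int, [/\ (h * y1%:~R - x i) ^+ 2 <= h ^+ 2,
    (h * y2%:~R - x i) ^+ 2 <= h ^+ 2, h * y1%:~R - x i <= 0 & 0 <= h * y2%:~R - x i].
  have /andP[f1 f2] := floor_itv (x i / h).
  exists (Num.floor (x i / h)), (Num.floor (x i / h) + 1).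
  move: f1 f2; rewrite ler_pdivlMr// ltr_pdivrMr// => f1 f2.
  rewrite intrD in f2 *; set f := (Num.floor _)%:~R in f1 f2 *.
  have ? : `|h * f - x i| <= h by rewrite ler_norml; apply/andP; split; lra.
  have ? : `|h * (f + 1) - x i| <= h by rewrite ler_norml; apply/andP; split; lra.
  split; [| |lra|lra].
    by rewrite -[X in X <= _]real_normK ?num_real// lerXn2r ?nnegrE ?(ltW h0).
  by rewrite -[X in X <= _]real_normK ?num_real// lerXn2r ?nnegrE ?(ltW h0).
elim: s => [_|i s IH /=/andP[is_ us]].
  have [y yP] := choice fl; exists y; split => [i|]; first by have [? []] := yP i.
  by rewrite big_nil mulr0 big1// => j _; rewrite big_nil expr0n.
have [y [y1 y2]] := IH us.
pose cur j := \sum_(i <- s) (h * (y i)%:~R - x i) * v i j.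
have [c [c1 c2]] : exists c : int, (h * c%:~R - x i) ^+ 2 <= h ^+ 2 /\
    (h * c%:~R - x i) * (\sum_j cur j * v i j) <= 0.
  have [l [u [l1 u1 l2 u2]]] := fl i.
  have [c0|c0] := leP 0 (\sum_j cur j * v i j).
    by exists l; split => //; rewrite mulr_le0_ge0.
  by exists u; split => //; rewrite mulr_ge0_le0// ltW.
exists (fun k => if k == i then c else y k); split.
  by move=> k; case: eqP => [->|_].
have cE j : \sum_(k <- i :: s) (h * (if k == i then c else y k)%:~R - x k) * v k j =
    (h * c%:~R - x i) * v i j + cur j.
  rewrite big_cons eqxx; congr (_ + _); rewrite /cur big_seq [RHS]big_seq.
  by apply: eq_bigr => k ks; case: eqP => // ki; rewrite ki (negbTE is_) in ks.
under eq_bigr do rewrite cE.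
set e := h * c%:~R - x i in c1 c2 *.
have -> : \sum_j (e * v i j + cur j) ^+ 2 = e ^+ 2 * \sum_j v i j ^+ 2 +
   2 * (e * \sum_j cur j * v i j) + \sum_j cur j ^+ 2.
  rewrite !mulr_sumr -!big_split/=; apply: eq_bigr => j _; ring.
rewrite big_cons mulrDr.
have : e ^+ 2 * \sum_j v i j ^+ 2 <= h ^+ 2 * \sum_j v i j ^+ 2.
  by rewrite ler_wpM2r// sumr_ge0// => j _; exact: sqr_ge0.
have := y2; rewrite -/cur; lra.
Qed.

(** Splitting off the component of A along a unit vector w of its row space leaves A' with A' w^T =
    0. Its rank is smaller, because w is no longer in the row space, and squared norms add by
    Pythagoras, which controls [C]. Missing rank is padded with zeros. *)
Lemma rank_factor (p q r : nat) (A : 'M[R]_(p, q)) : (\rank A <= r)%N ->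
  exists (C : 'M[R]_(p, r)) (V : 'M[R]_(r, q)),
    [/\ A = C *m V, forall t, \sum_j V t j ^+ 2 <= 1 & fn2 C <= fn2 A].
Proof.
elim: r A => [|r IH] A rA.
  have -> : A = 0 by apply/eqP; rewrite -mxrank_eq0 -leqn0.
  exists 0, 0; split; first by rewrite mul0mx.
    by case.
  by rewrite /fn2 big1 ?fn2_ge0// => i _; rewrite big_ord0.
have [->|A0] := eqVneq A 0.
  exists 0, 0; split; first by rewrite mul0mx.
    by move=> t; rewrite big1// => j _; rewrite mxE expr0n.
  by rewrite /fn2; apply: ler_sum => i _; rewrite !big1// => j _; rewrite mxE expr0n.
have [i Ai] : exists i, row i A != 0.
  apply/existsP; apply: contraNT A0; rewrite negb_exists => /forallP H.
  by apply/eqP/row_matrixP => i; rewrite row0; have /negPn/eqP := H i.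
pose u := row i A; pose N := \sum_j u 0 j ^+ 2.
have N0 : 0 < N.
  rewrite lt_neqAle sumr_ge0 ?andbT; last by move=> j _; exact: sqr_ge0.
  apply: contra Ai => /eqP/esym/eqP; rewrite psumr_eq0; last by move=> j _; exact: sqr_ge0.
  move=> /allP H; apply/eqP/rowP => j.
  by have := H j (mem_index_enum _); rewrite sqrf_eq0 => /eqP ->; rewrite mxE.
pose w := (Num.sqrt N)^-1 *: u.
have ww : w *m w^T = 1%:M.
  apply/matrixP => a b; rewrite !ord1 !mxE eqxx.
  rewrite (eq_bigr (fun j => N^-1 * u 0 j ^+ 2)); last first.
    move=> j _; rewrite !mxE; set x := A i j.
    by rewrite mulrACA -invfM -expr2 sqr_sqrtr ?(ltW N0)// expr2.
  by rewrite -mulr_sumr mulVf// gt_eqF.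
have w1 : \sum_j w 0 j ^+ 2 = 1.
  have /matrixP/(_ 0 0) := ww; rewrite mxE [RHS]mxE eqxx => H.
  by rewrite -[RHS]H; apply: eq_bigr => j _; rewrite [w^T _ _]mxE expr2.
have wA : (w <= A)%MS by rewrite scalemx_sub// row_sub.
pose c := A *m w^T; pose A' := A - c *m w.
have A'A : (A' <= A)%MS.
  by rewrite addmx_sub// eqmx_opp mulmx_sub.
have A'w : A' *m w^T = 0.
  by rewrite mulmxBl -mulmxA ww mulmx1 subrr.
have rA' : (\rank A' <= r)%N.
  rewrite -ltnS (leq_trans _ rA)// ltn_neqAle mxrankS// andbT.
  apply/negP => /eqP rAA'.
  have /eqmxP AA' : (A' == A)%MS by rewrite -(geq_leqif (mxrank_leqif_eq A'A)) rAA'.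
  have : (w <= A')%MS by rewrite AA'.
  move=> /submxP[D wD]; have := ww; rewrite {1}wD -mulmxA A'w mulmx0.
  by move=> /matrixP/(_ 0 0)/eqP; rewrite !mxE eqxx eq_sym oner_eq0.
have [C' [V' [A'E V'1 C'A']]] := IH A' rA'.
have AE : A = row_mx c C' *m col_mx w V' by rewrite mul_row_col -A'E addrC subrK.
have V1 (t : 'I_(1 + r)) : \sum_j (col_mx w V') t j ^+ 2 <= 1.
  case: (split_ordP t) => s ->.
    by rewrite (eq_bigr (fun j => w 0 j ^+ 2)) ?w1// => j _; rewrite col_mxEu ord1.
  rewrite (eq_bigr (fun j => V' s j ^+ 2)) ?V'1// => j _.
  by rewrite col_mxEd.
have fC : fn2 (row_mx c C') = fn2 c + fn2 C'.
  rewrite /fn2 -big_split; apply: eq_bigr => k _ /=.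
  rewrite big_split_ord/=; congr (_ + _); apply: eq_bigr => j _.
    by rewrite row_mxEl.
  by rewrite row_mxEr.
have fA : fn2 A = fn2 c + fn2 A'.
  rewrite /fn2 -big_split; apply: eq_bigr => k _ /=.
  rewrite big_ord1.
  have cE : c k 0 = \sum_j A k j * w 0 j.
    by rewrite mxE; apply: eq_bigr => j _; rewrite [w^T _ _]mxE.
  have -> : \sum_j A' k j ^+ 2 = \sum_j A k j ^+ 2 -
     2 * c k 0 * (\sum_j A k j * w 0 j) + c k 0 ^+ 2 * \sum_j w 0 j ^+ 2.
    rewrite !mulr_sumr -sumrB -big_split/=; apply: eq_bigr => j _.
    suff -> : A' k j = A k j - c k 0 * w 0 j by ring.
    rewrite /A' mxE; congr (_ + _); rewrite mxE; congr (- _).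
    by rewrite mxE big_ord1.
  by rewrite w1 -cE; ring.
exists (row_mx c C' : 'M[R]_(p, 1 + r)), (col_mx w V' : 'M[R]_(1 + r, q)); split.
- exact: AE.
- exact: V1.
- by apply: (@le_trans _ _ (fn2 c + fn2 C')); [rewrite -fC|rewrite fA lerD2l].
Qed.

End frobenius.

Section low_rank_packing.
Variable R : realType.
Variables (m r : nat) (eps : R).
Hypotheses (m_gt0 : (0 < m)%N) (r_gt0 : (0 < r)%N) (eps_gt0 : 0 < eps).
Local Notation d := (m * r)%N.

Definition code_index : finType := (unit + ('I_m * 'I_r + 'I_r * 'I_m))%type.

(* The entry at inl tt is an integer s with |A|_F <= s eps, which sets the mesh
   of the lattice for the right factor. *)
Definition decode (f : {ffun code_index -> int}) : 'M[R]_m :=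
  \matrix_(i, j) \sum_t
    ((eps / (8 * Num.sqrt d%:R) * (f (inr (inl (i, t))))%:~R) *
     ((16 * (f (inl tt))%:~R * Num.sqrt m%:R)^-1 * (f (inr (inr (t, j))))%:~R)).

Lemma sum_abs_le (I : finType) (y : I -> int) (s K : R) : 0 < s ->
  \sum_i (y i)%:~R ^+ 2 <= K * s ^+ 2 * #|I|%:R ->
  \sum_i `|(y i)%:~R| <= (K + 1) / 2 * s * #|I|%:R :> R.
Proof.
move=> s0 H; have Hi i : `|(y i)%:~R : R| <= ((y i)%:~R ^+ 2 / s + s) / 2.
  rewrite -[_ ^+ 2]real_normK ?num_real//; set x := `|_|.
  have -> : (x ^+ 2 / s + s) / 2 = x + (x - s) ^+ 2 / s / 2.
    by field; rewrite gt_eqF.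
  by rewrite lerDl divr_ge0// divr_ge0 ?sqr_ge0// ltW.
apply: (le_trans (ler_sum _ (fun i _ => Hi i))).
rewrite -mulr_suml big_split/= -mulr_suml sumr_const -[_ *+ _]mulr_natr.
have H' : (\sum_i (y i)%:~R ^+ 2) / s <= K * s * #|I|%:R.
  by rewrite ler_pdivrMr// (le_trans H)// le_eqVlt; apply/orP; left; apply/eqP; ring.
lra.
Qed.

(** The meshes are coarse enough that a coefficient has size O(s) on average. The total size of a
    code is therefore O(s d), with no logarithmic factor; greedy rounding keeps the error below eps
    / 4 at such meshes. *)
Lemma low_rank_code (s : nat) (A : 'M[R]_m) : (0 < s)%N -> (\rank A <= r)%N ->
  fn2 A <= (s%:R * eps) ^+ 2 -> exists f : {ffun code_index -> int},
    [/\ f (inl tt) = s%:Z, fn2 (A - decode f) <= eps ^+ 2 / 16 &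
        \sum_w `|(f w)%:~R| <= 501 * s%:R * d%:R :> R].
Proof.
move=> s_gt0 rA fA.
have [C [V [AE V1 CA]]] := rank_factor rA.
have s0 : 0 < s%:R :> R by rewrite ltr0n.
have s1 : 1 <= s%:R :> R by rewrite ler1n.
have m0 : 0 < m%:R :> R by rewrite ltr0n.
have d_gt0 : (0 < d)%N by rewrite muln_gt0 m_gt0.
have d0 : 0 < d%:R :> R by rewrite ltr0n.
have d1 : 1 <= d%:R :> R by rewrite ler1n.
(* Rounding the left factor costs at most h1^2 d = eps^2 / 64. Rounding the right one costs at most
   h2^2 m times 3 s^2 eps^2, that is 3/256 eps^2. Both fit into eps^2 / 64, and [fn2D_le] doubles
   their sum to at most eps^2 / 16. *)
pose h1 : R := eps / (8 * Num.sqrt d%:R).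
pose h2 : R := (16 * s%:R * Num.sqrt m%:R)^-1.
have h1_gt0 : 0 < h1 by rewrite divr_gt0// mulr_gt0// sqrtr_gt0.
have h2_gt0 : 0 < h2 by rewrite invr_gt0 !mulr_gt0// sqrtr_gt0.
have h12 : h1 ^+ 2 * d%:R = eps ^+ 2 / 64.
  rewrite expr_div_n exprMn sqr_sqrtr ?(ltW d0)//; move: d0; move: (d%:R) => D D0.
  by field; rewrite gt_eqF.
have h22 : h2 ^+ 2 * m%:R = (256 * s%:R ^+ 2)^-1.
  rewrite exprVn !exprMn sqr_sqrtr ?(ltW m0)//.
  by field; rewrite !gt_eqF.
have s2 : 0 < s%:R ^+ 2 :> R by rewrite exprn_gt0.
pose v1 (it : 'I_m * 'I_r) (kj : 'I_m * 'I_m) := (kj.1 == it.1)%:R * V it.2 kj.2.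
have [y [yh yE]] := greedy_rounding (fun it => C it.1 it.2) v1 h1_gt0.
pose C' : 'M[R]_(m, r) := \matrix_(i, t) (h1 * (y (i, t))%:~R).
have v1s : \sum_it \sum_kj v1 it kj ^+ 2 <= d%:R.
  rewrite sum_pair; apply: (@le_trans _ _ (\sum_(i < m) \sum_(t < r) 1)).
    apply: ler_sum => i _; apply: ler_sum => t _; rewrite sum_pair.
    rewrite (bigD1 i)//= [X in _ + X]big1 ?addr0 => [|k ki].
      apply: le_trans (V1 t); apply: ler_sum => j _.
      by rewrite /v1/= eqxx mul1r.
    by rewrite big1// => j _; rewrite /v1/= (negbTE ki) mul0r expr0n.
  by rewrite !sumr_const !card_ord -mulrnA mulnC.
have E1 : fn2 ((C' - C) *m V) <= eps ^+ 2 / 64.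
  rewrite -h12; apply: le_trans (le_trans yE (ler_wpM2l (sqr_ge0 _) v1s)).
  rewrite sum_pair le_eqVlt; apply/orP; left; apply/eqP.
  apply: eq_bigr => k _; apply: eq_bigr => j _; congr (_ ^+ 2).
  rewrite mxE sum_pair [RHS](bigD1 k)//= [X in _ = _ + X]big1 ?addr0 => [|i ik].
    by apply: eq_bigr => t _; rewrite /v1/= eqxx mul1r !mxE.
  by apply: big1 => t _; rewrite /v1/= eq_sym (negbTE ik) mul0r mulr0.
have fC' : fn2 C' <= 3 * s%:R ^+ 2 * eps ^+ 2.
  have -> : C' = C + (C' - C) by rewrite addrC subrK.
  apply: (le_trans (fn2D_le _ _)).
  have : fn2 (C' - C) <= eps ^+ 2 / 64.
    rewrite -h12 /fn2; apply: (@le_trans _ _ (\sum_(i < m) \sum_(t < r) h1 ^+ 2)).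
      apply: ler_sum => i _; apply: ler_sum => t _; rewrite !mxE.
      exact: (yh (i, t)).
    by rewrite !sumr_const !card_ord -mulrnA mulr_natr mulnC.
  have : eps ^+ 2 <= s%:R ^+ 2 * eps ^+ 2.
    by rewrite ler_peMl ?sqr_ge0// expr_ge1// ltW.
  have := le_trans CA fA; rewrite exprMn; have := sqr_ge0 eps; lra.
pose v2 (tj : 'I_r * 'I_m) (il : 'I_m * 'I_m) := (il.2 == tj.2)%:R * C' il.1 tj.1.
have [z [zh zE]] := greedy_rounding (fun tj => V tj.1 tj.2) v2 h2_gt0.
pose V' : 'M[R]_(r, m) := \matrix_(t, j) (h2 * (z (t, j))%:~R).
have v2s : \sum_tj \sum_il v2 tj il ^+ 2 = m%:R * fn2 C'.
  transitivity (\sum_(j < m) fn2 C'); last by rewrite sumr_const card_ord mulr_natl.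
  rewrite sum_pair exchange_big/=.
  apply: eq_bigr => j _; rewrite /fn2 [RHS]exchange_big/=; apply: eq_bigr => t _.
  rewrite sum_pair; apply: eq_bigr => i _; rewrite (bigD1 j)//=.
  rewrite /v2/= eqxx mul1r big1 ?addr0// => l lj.
  by rewrite (negbTE lj) mul0r expr0n.
have V'V t j : (V' - V) t j = h2 * (z (t, j))%:~R - V t j by rewrite !mxE.
have E2 : fn2 (C' *m (V' - V)) <= eps ^+ 2 / 64.
  apply: (@le_trans _ _ (h2 ^+ 2 * (m%:R * fn2 C'))).
    rewrite -v2s; apply: le_trans zE.
    rewrite [leRHS]sum_pair le_eqVlt; apply/orP; left; apply/eqP.
    apply: eq_bigr => i _; apply: eq_bigr => l _; congr (_ ^+ 2).
    rewrite mxE sum_pair; apply: eq_bigr => t _.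
    rewrite (bigD1 l)//= big1 ?addr0 => [|j jl].
      by rewrite /v2/= eqxx mul1r V'V mulrC.
    by rewrite /v2/= eq_sym (negbTE jl) mul0r mulr0.
  rewrite mulrA h22; apply: (@le_trans _ _ ((256 * s%:R ^+ 2)^-1 * (3 * s%:R ^+ 2 * eps ^+ 2))).
    by rewrite ler_wpM2l// invr_ge0 mulr_ge0// ltW.
  rewrite (_ : _ * _ = 3 / 256 * eps ^+ 2); last by field; rewrite gt_eqF.
  by have := sqr_ge0 eps; lra.
have r1 : 1 <= r%:R :> R by rewrite ler1n.
have fV' : fn2 V' <= 3 * r%:R.
  have -> : V' = V + (V' - V) by rewrite addrC subrK.
  apply: (le_trans (fn2D_le _ _)).
  have fV : fn2 V <= r%:R.
    apply: (@le_trans _ _ (\sum_(t < r) 1)); first by rewrite ler_sum.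
    by rewrite sumr_const card_ord.
  have : fn2 (V' - V) <= r%:R * (h2 ^+ 2 * m%:R).
    rewrite /fn2; apply: (@le_trans _ _ (\sum_(t < r) \sum_(j < m) h2 ^+ 2)).
      apply: ler_sum => t _; apply: ler_sum => j _.
      by rewrite V'V; exact: (zh (t, j)).
    by rewrite !sumr_const !card_ord mulr_natr mulr_natl.
  have : r%:R * (h2 ^+ 2 * m%:R) <= r%:R * (1 / 256).
    rewrite ler_wpM2l// h22 div1r lef_pV2 ?posrE ?mulr_gt0//.
    by have s21 : 1 <= s%:R ^+ 2 :> R by [rewrite expr_ge1// ltW]; lra.
  lra.
pose f : {ffun code_index -> int} := [ffun w => match w with
  | inl _ => s%:Z | inr (inl it) => y it | inr (inr tj) => z tj end].
have decE : decode f = C' *m V'.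
  apply/matrixP => i j; rewrite !mxE; apply: eq_bigr => t _.
  by rewrite !ffunE !mxE.
exists f; split; first by rewrite ffunE.
  rewrite decE; have -> : A - C' *m V' = - ((C' - C) *m V) + - (C' *m (V' - V)).
    by rewrite AE mulmxBl mulmxBr !opprB addrA subrK.
  apply: (le_trans (fn2D_le _ _)); rewrite !fn2N; lra.
(* The total is 193/2 from [y], 769/2 from [z] and 1 from the entry [s], that is 482, below 501. *)
have y1 : \sum_it `|(y it)%:~R| <= (192 + 1) / 2 * s%:R * d%:R :> R.
  have := @sum_abs_le _ y s%:R 192 s0; rewrite card_prod !card_ord; apply.
  rewrite -(ler_pM2l (exprn_gt0 2 h1_gt0)).
  have -> : h1 ^+ 2 * (192 * s%:R ^+ 2 * d%:R) = 3 * s%:R ^+ 2 * eps ^+ 2.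
    rewrite (_ : _ * (_ * _) = h1 ^+ 2 * d%:R * (192 * s%:R ^+ 2)); last by ring.
    by rewrite h12; field.
  apply: le_trans fC'; rewrite sum_pair /fn2 mulr_sumr; apply: ler_sum => i _.
  by rewrite mulr_sumr; apply: ler_sum => t _; rewrite mxE [leRHS]exprMn.
have z1 : \sum_tj `|(z tj)%:~R| <= (768 + 1) / 2 * s%:R * d%:R :> R.
  have := @sum_abs_le _ z s%:R 768 s0; rewrite card_prod !card_ord [(r * m)%N]mulnC; apply.
  rewrite -(ler_pM2l (exprn_gt0 2 h2_gt0)).
  have -> : h2 ^+ 2 * (768 * s%:R ^+ 2 * d%:R) = 3 * r%:R.
    rewrite natrM (_ : _ * (_ * _) = h2 ^+ 2 * m%:R * (768 * s%:R ^+ 2 * r%:R)); last by ring.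
    by rewrite h22; field; rewrite gt_eqF.
  apply: le_trans fV'; rewrite sum_pair /fn2 mulr_sumr; apply: ler_sum => t _.
  by rewrite mulr_sumr; apply: ler_sum => j _; rewrite mxE [leRHS]exprMn.
have -> : \sum_w `|(f w)%:~R| = s%:R + (\sum_it `|(y it)%:~R| + \sum_tj `|(z tj)%:~R|) :> R.
  rewrite big_sumType/= big_sumType/=; congr (_ + (_ + _)).
  - by rewrite (bigD1 tt)//= big1 ?addr0 => [|[]//]; rewrite ffunE normr_nat.
  - by apply: eq_bigr => it _; rewrite ffunE.
  - by apply: eq_bigr => it _; rewrite ffunE.
have : s%:R <= s%:R * d%:R :> R by rewrite ler_peMr// ltW.
lra.
Qed.
End low_rank_packing.

(** * Integer codes with geometric weights *)

Section code_sum.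
Variable R : realType.

Lemma sum_half_expn n : \sum_(i < n.+1) (1 / 2) ^+ i = 2 - (1 / 2) ^+ n :> R.
Proof.
elim: n => [|n IH]; first by rewrite big_ord1 expr0; lra.
rewrite big_ord_recr/= IH [in RHS]exprS [in LHS]exprS; lra.
Qed.

(** A Kraft-type inequality. Coding an integer by sign and absolute value bounds the weight of one
    coordinate by 2 times a geometric sum, hence by 4; zero has two codes, which is harmless for an
    upper bound. *)
Lemma sum_codes (W : finType) (S : seq {ffun W -> int}) : uniq S ->
  \sum_(f <- S) \prod_w (1 / 2) ^+ `|f w|%N <= 4 ^+ #|W| :> R.
Proof.
move=> uS; pose B := (\max_(f <- S) \max_w `|f w|)%N.
have fB f w : f \in S -> (`|f w| < B.+1)%N.
  move=> fS; rewrite ltnS.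
  apply: (leq_trans (leq_bigmax (F := fun w => `|f w|%N) w)).
  exact: (leq_bigmax_seq (F := fun f : {ffun W -> int} => (\max_w `|f w|)%N)).
pose enc (f : {ffun W -> int}) : {ffun W -> bool * 'I_B.+1} :=
  [ffun w => (f w < 0, inord `|f w|%N)].
pose g (e : {ffun W -> bool * 'I_B.+1}) : R := \prod_w (1 / 2) ^+ (e w).2.
have g0 e : 0 <= g e by apply: prodr_ge0 => w _; rewrite exprn_ge0.
have -> : \sum_(f <- S) \prod_w (1 / 2) ^+ `|f w|%N = \sum_(e <- map enc S) g e.
  rewrite big_map big_seq [RHS]big_seq; apply: eq_bigr => f fS.
  by apply: eq_bigr => w _; rewrite ffunE/= inordK// fB.
have encI : {in S &, injective enc}.
  move=> f1 f2 f1S f2S /ffunP e12; apply/ffunP => w.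
  have := e12 w; rewrite !ffunE => -[sg12 /(congr1 val)/=].
  rewrite !inordK ?fB// => abs12; lia.
rewrite big_uniq ?map_inj_in_uniq//=.
apply: (@le_trans _ _ (\sum_e g e)).
  by rewrite [leRHS](bigID (mem (map enc S)))/= lerDl sumr_ge0.
rewrite /g -(bigA_distr_bigA (fun (_ : W) (e : bool * 'I_B.+1) => (1 / 2) ^+ e.2))/=.
rewrite prodr_const lerXn2r ?nnegrE ?sumr_ge0//.
rewrite sum_pair big_bool /= !sum_half_expn.
have : 0 <= (1 / 2) ^+ B :> R by rewrite exprn_ge0.
lra.
Qed.

Lemma expR1_ge2 : 2 <= expR 1 :> R.
Proof. by have := expR_ge1Dx (1 : R); lra. Qed.

Lemma expR2_ge4 : 4 <= expR (1 + 1) :> R.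
Proof.
rewrite expRD; have := expR1_ge2; move: (expR 1) => e e2.
by have := ler_pM (ler0n R 2) (ler0n R 2) e2 e2; rewrite -natrM.
Qed.

Lemma half_expn_ge n : expR (- n%:R) <= (1 / 2) ^+ n :> R.
Proof.
rewrite -mulrN1 expRM_natl lerXn2r ?nnegrE ?expR_ge0// expRN div1r.
by rewrite lef_pV2 ?posrE ?expR_gt0// expR1_ge2.
Qed.

End code_sum.

Section packing.
Variables (R : realType) (m r : nat) (eps : R).
Hypotheses (m_gt0 : (0 < m)%N) (r_gt0 : (0 < r)%N) (eps_gt0 : 0 < eps).
Local Notation d := (m * r)%N.
Variable K : R.
Hypothesis K501 : 501 <= K.

(** Each A is coded through A - M. Two matrices with the same code would satisfy |A - B|^2 <= eps^2
    / 4, against the separation, so codes are distinct. If t is the integer part of |A - M| / eps,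
    the code has size at most K (t + 1) d <= K t^2 d + 2 K d, at most theta |A - M|^2 + 2 K d. So
    each term is at most exp (2 K d) times the weight of its code; the 1 + 2 d coordinates, each
    costing 4 <= exp 2, account for 6 d. *)
Lemma packing_sum (F : seq 'M[R]_m) (M : 'M[R]_m) (theta : R) : uniq F ->
  (forall A, A \in F -> (\rank (A - M)%R <= r)%N) ->
  (forall A B, A \in F -> B \in F -> A != B -> eps ^+ 2 <= fn2 (A - B)) ->
  K * d%:R <= theta * eps ^+ 2 ->
  \sum_(A <- F) expR (- (theta * fn2 (A - M))) <= expR ((2 * K + 6) * d%:R).
Proof.
move=> uF rF sF th.
have eps2 : 0 < eps ^+ 2 by rewrite exprn_gt0.
have d1 : 1 <= d%:R :> R by rewrite ler1n muln_gt0 m_gt0.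
have K0 : 0 <= K by apply: le_trans K501; exact: ler0n.
have d0 : 0 <= d%:R :> R by exact: ler0n.
have th0 : 0 <= theta.
  by rewrite -(pmulr_lge0 _ eps2); apply: le_trans th; exact: mulr_ge0.
have code A : exists f : {ffun code_index m r -> int}, (\rank (A - M)%R <= r)%N ->
    fn2 (A - M - decode eps f) <= eps ^+ 2 / 16 /\
    \sum_w `|(f w)%:~R| <= theta * fn2 (A - M) + 2 * K * d%:R :> R.
  have [rA|] := leqP (\rank (A - M)%R) r; last by exists [ffun=> 0].
  pose x := Num.sqrt (fn2 (A - M)) / eps.
  have x0 : 0 <= x by rewrite divr_ge0 ?sqrtr_ge0// ltW.
  have xe : fn2 (A - M) = (x * eps) ^+ 2.
    by rewrite divfK ?gt_eqF// sqr_sqrtr// fn2_ge0.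
  have /andP[t1 t2] := truncn_itv x0; set t := Num.truncn x in t1 t2.
  have [|f [_ f2 f3]] := @low_rank_code R m r eps m_gt0 r_gt0 eps_gt0 t.+1 (A - M) isT rA.
    rewrite xe lerXn2r ?nnegrE ?mulr_ge0 ?invr_ge0 ?(ltW eps_gt0)//.
    by rewrite ler_wpM2r// ?(ltW eps_gt0)// ltW.
  have {}f3 : \sum_w `|(f w)%:~R| <= K * t.+1%:R * d%:R :> R.
    apply: (le_trans f3); apply: ler_wpM2r => //.
    by apply: ler_wpM2r => //; exact: ler0n.
  exists f => _; split => //; apply: (le_trans f3).
  have t0 : 0 <= t%:R :> R by exact: ler0n.
  have xt : t%:R ^+ 2 <= x ^+ 2 by rewrite lerXn2r ?nnegrE.
  have H : K * d%:R * t%:R ^+ 2 <= theta * fn2 (A - M).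
    rewrite xe (_ : theta * _ = theta * eps ^+ 2 * x ^+ 2); last by ring.
    by apply: ler_pM => //; rewrite ?mulr_ge0 ?sqr_ge0.
  apply: (@le_trans _ _ (K * d%:R * t%:R ^+ 2 + 2 * K * d%:R)); last by rewrite lerD2r.
  have -> : K * d%:R * t%:R ^+ 2 + 2 * K * d%:R = K * d%:R * (t%:R ^+ 2 + 2) :> R by ring.
  rewrite mulrAC -natr1; apply: ler_wpM2l; first exact: mulr_ge0.
  have := sqr_ge0 (t%:R - 1 / 2 : R); rewrite sqrrB; lra.
have [c cP] := choice code.
have cI : {in F &, injective c}.
  move=> A B AF BF cAB; apply/eqP; apply: contraT => AB.
  have := sF A B AF BF AB.
  have [a1 _] := cP A (rF A AF); have [b1 _] := cP B (rF B BF).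
  have -> : A - B = (A - M) - (B - M) by rewrite opprB addrA subrK.
  have := fn2B_le (A - M) (decode eps (c A)) (B - M).
  rewrite {2}cAB; lra.
have bnd A : A \in F -> expR (- (theta * fn2 (A - M))) <=
    expR (2 * K * d%:R) * \prod_w (1 / 2) ^+ `|c A w|%N.
  move=> AF; have [_ N1] := cP A (rF A AF).
  rewrite -expr_sum.
  apply: le_trans (ler_wpM2l (expR_ge0 _) (half_expn_ge _ _)).
  rewrite -expRD ler_expR natr_sum.
  have -> : \sum_w (`|c A w|%N)%:R = \sum_w `|(c A w)%:~R| :> R.
    by apply: eq_bigr => w _; rewrite -intr_norm natr_absz.
  lra.
rewrite big_seq (le_trans (ler_sum _ bnd))// -big_seq -mulr_sumr.
rewrite -(big_map c xpredT (fun f : {ffun code_index m r -> int} => \prod_w (1 / 2) ^+ `|f w|%N)).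
have := @sum_codes R _ (map c F); rewrite map_inj_in_uniq// => /(_ uF) H.
apply: (le_trans (ler_wpM2l (expR_ge0 _) H)).
have -> : #|code_index m r| = (1 + (d + d))%N.
  by rewrite !card_sum !card_prod !card_ord card_unit [(r * m)%N]mulnC.
apply: (@le_trans _ _ (expR (2 * K * d%:R) * expR (1 + 1) ^+ (1 + (d + d)))).
  by apply: ler_wpM2l; [exact: expR_ge0|rewrite lerXn2r ?nnegrE ?expR_ge0 ?expR2_ge4].
rewrite -(expRM_natl (1 + (d + d))) -expRD ler_expR [(_ + 6) * _]mulrDl lerD2l.
rewrite natrD natrD; move: d1; move: (d%:R : R) => x x1.
have -> : (1%:R + (x + x)) * (1 + 1) = 2 + 4 * x :> R by ring.
by clear H; lra.
Qed.

End packing.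

Section matrix_norm.
Variables (R : realType) (m : nat).

Lemma entry_le_mx_norm (A : 'M[R]_m) i j : `|A i j| <= `|A|.
Proof.
rewrite [leRHS]/Num.norm /= mx_normrE; apply/bigmax_geP; right => /=.
by exists (i, j).
Qed.

Lemma mx_norm_le (A : 'M[R]_m) (a : R) : 0 <= a -> (forall i j, `|A i j| <= a) ->
  `|A| <= a.
Proof.
move=> a0 Aa; rewrite [leLHS]/Num.norm /= mx_normrE; apply/bigmax_leP; split => // ij _; exact: Aa.
Qed.

End matrix_norm.

Section net.
Variables (R : realType) (m l : nat) (a eps : R).
Hypotheses (m_gt0 : (0 < m)%N) (l_gt0 : (0 < l)%N) (eps_gt0 : 0 < eps).
Hypothesis a_ge0 : 0 <= a.
Variable K : R.
Hypothesis K501 : 501 <= K.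

Lemma rankB_le (A B : 'M[R]_m) : (\rank A <= l)%N -> (\rank B <= l)%N ->
  (\rank (A - B)%R <= 2 * l)%N.
Proof.
move=> rA rB; rewrite mul2n -addnn (leq_trans (mxrank_add _ _))// leq_add//.
by rewrite mxrank_opp.
Qed.

Lemma lowrank_le (A : 'M[R]_m) i j : lowrank a l A -> `|A i j| <= a.
Proof.
move=> [Aa _]; apply: le_trans Aa.
exact: entry_le_mx_norm.
Qed.

Lemma fn2_lowrank_le (A : 'M[R]_m) : lowrank a l A -> fn2 A <= (a * m%:R) ^+ 2.
Proof.
move=> Al; apply: (@le_trans _ _ (\sum_(i < m) \sum_(j < m) a ^+ 2)).
  apply: ler_sum => i _; apply: ler_sum => j _.
  rewrite -[A i j ^+ 2]real_normK ?num_real// lerXn2r ?nnegrE//.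
  exact: lowrank_le.
by rewrite !sumr_const !card_ord -mulrnA mulnn exprMn -natrX mulr_natr.
Qed.

Definition separated (F : seq 'M[R]_m) := [/\ uniq F,
  forall A, A \in F -> lowrank a l A &
  forall A B, A \in F -> B \in F -> A != B -> eps ^+ 2 <= fn2 (A - B)].

Lemma lowrank0 : lowrank a l (0 : 'M[R]_m).
Proof. by split; rewrite ?normr0 ?mxrank0. Qed.

Lemma separated_sum (F : seq 'M[R]_m) (M : 'M[R]_m) (theta : R) :
  separated F -> lowrank a l M ->
  K * (m * (2 * l))%:R <= theta * eps ^+ 2 ->
  \sum_(A <- F) expR (- (theta * fn2 (A - M))) <= expR ((2 * K + 6) * (m * (2 * l))%:R).
Proof.
move=> [uF lF sF] [_ rM] th; apply: (@packing_sum R m (2 * l) eps _ _ _ K) => //.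
  by rewrite muln_gt0.
by move=> A /lF[_ rA]; exact: rankB_le.
Qed.

(** In the packing sum centred at 0 every term is at least [c], as the model is bounded. *)
Lemma size_separated : exists N, forall F, separated F -> (size F <= N)%N.
Proof.
pose theta : R := K * (m * (2 * l))%:R / eps ^+ 2.
pose c := expR (- (theta * (a * m%:R) ^+ 2)).
exists (Num.truncn (expR ((2 * K + 6) * (m * (2 * l))%:R) / c)) => F sF.
rewrite truncn_ge_nat ?divr_ge0 ?expR_ge0// ler_pdivlMr ?expR_gt0//.
have th : K * (m * (2 * l))%:R <= theta * eps ^+ 2.
  by rewrite divfK// expf_neq0// gt_eqF.
apply: le_trans (separated_sum sF lowrank0 th).
have -> : (size F)%:R * c = \sum_(A <- F) c.
  by rewrite big_const_seq count_predT iter_addr_0 mulr_natl.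
rewrite big_seq [leRHS]big_seq; apply: ler_sum => A AF.
rewrite ler_expR lerN2 subr0 ler_wpM2l//.
  rewrite divr_ge0 ?sqr_ge0// mulr_ge0//.
  by apply: le_trans K501; exact: ler0n.
by apply: fn2_lowrank_le; case: sF => _ + _; apply.
Qed.

(** A separated family of maximal size is a net: a matrix farther than eps from all members could be
    added. *)
Lemma exists_net : exists F, separated F /\
  forall M, lowrank a l M -> exists2 A, A \in F & fn2 (A - M) <= eps ^+ 2.
Proof.
have [N sN] := size_separated.
pose P k := `[< exists F, separated F /\ size F = k >].
have exP : exists k, P k.
  by exists 0; apply/asboolP; exists [::]; split.
have PN k : P k -> (k <= N)%N by move=> /asboolP[F [sF <-]]; exact: sN.
have [k /asboolP[F [sF Fk]] kmax] := ex_maxnP exP PN.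
exists F; split => // M lM; apply: contrapT => noA.
have far A : A \in F -> eps ^+ 2 < fn2 (A - M).
  by move=> AF; rewrite ltNge; apply/negP => H; apply: noA; exists A.
suff : P k.+1 by move=> /kmax; rewrite ltnn.
apply/asboolP; exists (M :: F); split; last by rewrite /= Fk.
case: sF => uF lF sF; split => /=.
- rewrite uF andbT; apply/negP => /far; rewrite subrr.
  rewrite (_ : fn2 0 = 0) ?ltNge ?sqr_ge0//.
  by rewrite /fn2 big1// => i _; rewrite big1// => j _; rewrite mxE expr0n.
- by move=> A; rewrite inE => /orP[/eqP->|/lF].
- move=> A B; rewrite !inE => /orP[/eqP->|AF] /orP[/eqP->|BF].
  + by rewrite eqxx.
  + by move=> _; rewrite -fn2N opprB ltW// far.
  + by move=> _; rewrite ltW// far.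
  + exact: sF.
Qed.

End net.

(** * Upper bound on the minimax risk *)

Section gibbs_estimator.
Variables (R : realType) (m : nat) (F : seq 'M[R]_m) (kp p : R).

Definition obs_entry (y : data R m) i j : R := (tnth (tnth y i) j).2.

(** Exponential weight at inverse temperature [kp] for the contrast p |A|^2 - 2 <A, Y>, whose
    expectation is p (|A - M|^2 - |M|^2). *)
Definition gibbs_weight (A : 'M[R]_m) (y : data R m) : R :=
  expR (kp * (2 * \sum_i \sum_j A i j * obs_entry y i j - p * fn2 A)).

Definition gibbs (y : data R m) : 'M[R]_m :=
  (\sum_(A <- F) gibbs_weight A y)^-1 *: \sum_(A <- F) gibbs_weight A y *: A.

Lemma measurable_obs_entry i j : measurable_fun setT (fun y => obs_entry y i j).
Proof.
have m1 := @measurable_tnth _ (m.-tuple (bool * R)%type) m i.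
have m2 := @measurable_tnth _ (bool * R)%type m j.
exact: (measurableT_comp measurable_snd (measurableT_comp m2 m1)).
Qed.

Lemma measurable_gibbs_weight A : measurable_fun setT (gibbs_weight A).
Proof.
apply: measurableT_comp => //; apply: measurable_funM => //.
apply: measurable_funB => //; apply: measurable_funM => //.
apply: measurable_sum => i; apply: measurable_sum => j.
by apply: measurable_funM => //; exact: measurable_obs_entry.
Qed.

Lemma gibbs_weight_sum_gt0 A0 y : A0 \in F -> 0 < \sum_(A <- F) gibbs_weight A y.
Proof.
move=> A0F; rewrite (big_rem A0)//= ltr_wpDr// ?expR_gt0//.
by apply: sumr_ge0 => A _; exact: expR_ge0.
Qed.

Lemma measurable_gibbs A0 i j : A0 \in F -> measurable_fun setT (fun y => gibbs y i j).
Proof.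
(* The inverse of the positive normalizer is written with [expR] and [ln], so that measurability
   follows by composition. *)
move=> A0F; rewrite (_ : (fun y => _) = fun y =>
    expR (- ln (\sum_(A <- F) gibbs_weight A y)) *
    \sum_(A <- F) gibbs_weight A y * A i j); last first.
  apply/funext => y; rewrite expRN lnK ?posrE ?(gibbs_weight_sum_gt0 _ A0F)//.
  by rewrite mxE summxE; congr (_ * _); apply: eq_bigr => A _; rewrite mxE.
apply: measurable_funM.
  apply: measurableT_comp => //; apply: measurableT_comp => //.
  apply: measurableT_comp; first exact: measurable_ln.
  by apply: measurable_sum => A; exact: measurable_gibbs_weight.
apply: measurable_sum => A; apply: measurable_funM => //.
exact: measurable_gibbs_weight.
Qed.

(** Jensen's inequality bounds the loss by the weighted mean of [fn2 (A - M)]. Matrices within T of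
    M contribute at most T; for the others, the normalizer is bounded below by the single weight of
    [A0]. *)
Lemma gibbs_le (M A0 : 'M[R]_m) (T : R) y : A0 \in F -> 0 <= T ->
  fn2 (gibbs y - M) <= T + \sum_(A <- F) (T < fn2 (A - M))%R%:R * fn2 (A - M) *
     (gibbs_weight A y / gibbs_weight A0 y).
Proof.
move=> A0F T0; set W := \sum_(A <- F) gibbs_weight A y.
have W0 : 0 < W by exact: gibbs_weight_sum_gt0 A0F.
have WA0 : gibbs_weight A0 y <= W.
  rewrite /W (big_rem A0)//= lerDl; apply: sumr_ge0 => A _; exact: expR_ge0.
have gE i j : (gibbs y - M) i j = (\sum_(A <- F) gibbs_weight A y * (A - M) i j) / W.
  transitivity (W^-1 * (\sum_(A <- F) gibbs_weight A y * A i j) - M i j).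
    rewrite !mxE summxE; congr (_ * _ - _); apply: eq_bigr => A _; by rewrite mxE.
  have -> : M i j = W^-1 * (\sum_(A <- F) gibbs_weight A y * M i j).
    by rewrite -mulr_suml mulKf// gt_eqF.
  rewrite -mulrBr mulrC -sumrB; congr (_ / _); apply: eq_bigr => A _.
  by rewrite !mxE mulrBr.
have CS (x : 'M[R]_m -> R) : ((\sum_(A <- F) gibbs_weight A y * x A) / W) ^+ 2 <=
    (\sum_(A <- F) gibbs_weight A y * x A ^+ 2) / W.
  set mu := _ / W.
  have : 0 <= \sum_(A <- F) gibbs_weight A y * (x A - mu) ^+ 2.
    by apply: sumr_ge0 => A _; rewrite mulr_ge0 ?sqr_ge0// expR_ge0.
  have -> : \sum_(A <- F) gibbs_weight A y * (x A - mu) ^+ 2 =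
      \sum_(A <- F) gibbs_weight A y * x A ^+ 2 -
      2 * mu * (\sum_(A <- F) gibbs_weight A y * x A) + mu ^+ 2 * W.
    rewrite !mulr_sumr -sumrB -big_split/=; apply: eq_bigr => A _; ring.
  have -> : \sum_(A <- F) gibbs_weight A y * x A = mu * W by rewrite divfK// gt_eqF.
  rewrite ler_pdivlMr// expr2 => H; lra.
apply: (@le_trans _ _ ((\sum_(A <- F) gibbs_weight A y * fn2 (A - M)) / W)).
  apply: (@le_trans _ _ (\sum_i \sum_j
     (\sum_(A <- F) gibbs_weight A y * (A - M) i j ^+ 2) / W)).
    by apply: ler_sum => i _; apply: ler_sum => j _; rewrite gE; exact: CS.
  rewrite le_eqVlt; apply/orP; left; apply/eqP.
  under eq_bigr do rewrite -mulr_suml.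
  rewrite -mulr_suml; congr (_ / _).
  under eq_bigr do rewrite exchange_big/=.
  rewrite exchange_big/=; apply: eq_bigr => A _.
  by rewrite /fn2 mulr_sumr; apply: eq_bigr => i _; rewrite mulr_sumr.
rewrite ler_pdivrMr// mulrDl mulr_sumr mulr_suml -big_split/=.
apply: ler_sum => A _; rewrite [T * _]mulrC -mulrA.
have wA0 : 0 < gibbs_weight A0 y by exact: expR_gt0.
have wA : 0 <= gibbs_weight A y by exact: expR_ge0.
have [TD|DT] := ltP T (fn2 (A - M)); last first.
  by rewrite !mul0r addr0 ler_wpM2l.
rewrite mul1r; apply: (@le_trans _ _ (fn2 (A - M) * (gibbs_weight A y / gibbs_weight A0 y) * W)).
  rewrite [leLHS]mulrC -!mulrA ler_wpM2l ?fn2_ge0// ler_peMr//.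
  by rewrite mulrC ler_pdivlMr// mul1r.
by rewrite mulrA lerDr mulr_ge0.
Qed.

End gibbs_estimator.

Section gibbs_risk.
Variables (R : realType) (n m : nat) (a U sigma kp : R).
Variable X : experiment n m U sigma.
Local Notation P := (eprob X).
Local Notation p := (n%:R / m%:R ^+ 2 : R).
Hypotheses (a_gt0 : 0 < a) (U_gt0 : 0 < U) (sigma_U : sigma ^+ 2 <= U ^+ 2).
Hypothesis kp_gt0 : 0 < kp.
Hypothesis kp1 : kp * (8 * (a + U) ^+ 2) <= 1 / 4.
Hypothesis p_gt0 : 0 < p.

Lemma obs_entry_observe (M : 'M[R]_m) w i j :
  obs_entry (observe (X := X) M w) i j = (eB X i j w)%:R * (M i j + eeps X i j w).
Proof. by rewrite /obs_entry !tnth_mktuple. Qed.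

Lemma measurable_observe (M : 'M[R]_m) :
  measurable_fun setT (fun w => observe (X := X) M w).
Proof.
apply/measurable_fun_tnthP => i; apply/measurable_fun_tnthP => j.
rewrite (_ : _ \o _ = fun w => (eB X i j w, (eB X i j w)%:R * (M i j + eeps X i j w))).
  apply: measurable_fun_pair => //; apply: measurable_funM; last exact: measurable_funD.
  have m1 : measurable_fun setT (fun b : bool => b%:R : R) by [].
  exact: (measurableT_comp m1 (measurable_funPT (eB X i j))).
by apply/funext => w; rewrite /= !tnth_mktuple.
Qed.

Lemma measurable_gibbs_weight_observe (M A : 'M[R]_m) :
  measurable_fun setT (fun w => gibbs_weight kp p A (observe (X := X) M w)).
Proof. exact: (measurableT_comp (measurable_gibbs_weight kp p A) (measurable_observe M)). Qed.

Lemma gibbs_ratioE (M A A0 : 'M[R]_m) w :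
  gibbs_weight kp p A (observe (X := X) M w) /
  gibbs_weight kp p A0 (observe (X := X) M w) =
  expR (kp * p * (fn2 A0 - fn2 A)) *
  expR (\sum_ij (2 * kp *: (A - A0)) ij.1 ij.2 *
     ((eB X ij.1 ij.2 w)%:R * (M ij.1 ij.2 + eeps X ij.1 ij.2 w))).
Proof.
rewrite /gibbs_weight -expRB -expRD; congr expR.
rewrite sum_pair/=.
have -> : \sum_i \sum_k (2 * kp *: (A - A0)) i k * ((eB X i k w)%:R * (M i k + eeps X i k w))
   = 2 * kp * (\sum_i \sum_j A i j * obs_entry (observe (X := X) M w) i j -
               \sum_i \sum_j A0 i j * obs_entry (observe (X := X) M w) i j).
  rewrite -sumrB mulr_sumr; apply: eq_bigr => i _; rewrite -sumrB mulr_sumr.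
  by apply: eq_bigr => j _; rewrite obs_entry_observe !mxE; ring.
ring.
Qed.

Lemma measurable_gibbs_ratio (M A A0 : 'M[R]_m) :
  measurable_fun setT (fun w => gibbs_weight kp p A (observe (X := X) M w) /
    gibbs_weight kp p A0 (observe (X := X) M w)).
Proof.
under eq_fun do rewrite {2}/gibbs_weight -expRN.
apply: measurable_funM; first exact: measurable_gibbs_weight_observe.
apply: measurableT_comp => //; apply: measurableT_comp => //.
have := measurableT_comp (@measurable_ln R) (measurable_gibbs_weight_observe M A0).
by rewrite (_ : _ \o _ = fun w => kp * (2 * \sum_i \sum_j A0 i j *
  obs_entry (observe (X := X) M w) i j - p * fn2 A0))//; apply/funext => w; rewrite /= expRK.
Qed.

Lemma measurable_frob_gibbs (F : seq 'M[R]_m) (M A0 : 'M[R]_m) : A0 \in F ->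
  measurable_fun setT (fun w => frob_norm (gibbs F kp p (observe (X := X) M w) - M)).
Proof.
move=> A0F.
have ms : measurable_fun [set: R] (@Num.sqrt R).
  by apply: continuous_measurable_fun; exact: sqrt_continuous.
apply: (measurableT_comp ms).
apply: measurable_sum => i; apply: measurable_sum => j.
rewrite (_ : (fun w => _) = fun w => (gibbs F kp p (observe (X := X) M w) i j - M i j) ^+ 2).
  apply: measurable_funX; apply: measurable_funB => //.
  exact: (measurableT_comp (measurable_gibbs kp p i j A0F) (measurable_observe M)).
by apply/funext => w; congr (_ ^+ 2); rewrite !mxE.
Qed.

(** The linear term of the moment bound gives |A0 - M|^2 - |A - M|^2 exactly. By the choice of [kp],
    the quadratic one is at most |A - A0|^2 / 4, hence half the sum of the two squared distances;
    this gives 3/2 and -1/2. *)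
Lemma integral_gibbs_ratio (M A A0 : 'M[R]_m) :
  (forall i j, `|M i j| <= a) -> (forall i j, `|A i j| <= a) ->
  (forall i j, `|A0 i j| <= a) ->
  (\int[P]_w (gibbs_weight kp p A (observe M w) /
             gibbs_weight kp p A0 (observe M w))%:E <=
   (expR (kp * p * (3 / 2 * fn2 (A0 - M) - 1 / 2 * fn2 (A - M))))%:E)%E.
Proof.
move=> Ma Aa A0a.
pose z := 2 * kp *: (A - A0).
have zE i j : z i j = 2 * kp * (A - A0) i j by rewrite mxE.
have zaU i j : `|z i j| * (a + U) <= 1 / 2.
  have -> : z i j = 2 * kp * (A i j - A0 i j) by rewrite !mxE.
  rewrite normrM ger0_norm ?mulr_ge0 ?(ltW kp_gt0)//.
  have H : `|A i j - A0 i j| <= 2 * a.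
    by rewrite (le_trans (ler_normB _ _))// (le_trans (lerD (Aa i j) (A0a i j)))// -mulr2n mulr_natl.
  have aU : a <= a + U by rewrite lerDl ltW.
  have aU0 : 0 <= a + U by rewrite addr_ge0 ?ltW.
  have k2 : 0 <= 2 * kp by rewrite mulr_ge0 ?ltW.
  have H1 := ler_wpM2r aU0 (ler_wpM2l k2 H).
  have H2 : 2 * kp * (2 * a) * (a + U) <= 2 * kp * (2 * (a + U)) * (a + U).
    by rewrite ler_wpM2r// ler_wpM2l// ler_wpM2l.
  apply: (le_trans (le_trans H1 H2)).
  have := kp1; rewrite expr2; lra.
under eq_integral do rewrite gibbs_ratioE EFinM.
rewrite ge0_integralZl//; last first.
  apply/measurable_EFinP; apply: measurableT_comp => //.
  apply: measurable_sum => ij; apply: measurable_funM => //.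
  under eq_fun do rewrite -obs_entry_observe.
  exact: (measurableT_comp (measurable_obs_entry _ _) (measurable_observe M)).
have mgf := @experiment_mgf R n m U sigma X a M z (ltW a_gt0) (ltW U_gt0) sigma_U Ma zaU.
apply: (le_trans (lee_wpmul2l _ mgf)); first by rewrite lee_fin expR_ge0.
rewrite -EFinM lee_fin -expRD ler_expR.
have -> : \sum_ij (z ij.1 ij.2 * M ij.1 ij.2 + 2 * (a ^+ 2 + U ^+ 2) * z ij.1 ij.2 ^+ 2) =
   kp * (2 * (\sum_i \sum_j (A - A0) i j * M i j) +
   kp * (8 * (a ^+ 2 + U ^+ 2)) * fn2 (A - A0)).
  rewrite sum_pair/= mulr_sumr mulr_sumr -big_split mulr_sumr; apply: eq_bigr => i _ /=.
  rewrite !mulr_sumr -big_split mulr_sumr; apply: eq_bigr => j _ /=.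
  by rewrite zE; ring.
have -> : 2 * (\sum_i \sum_j (A - A0) i j * M i j) =
    fn2 (A0 - M) - fn2 (A - M) + fn2 A - fn2 A0.
  rewrite /fn2 mulr_sumr -!(sumrB, big_split)/=; apply: eq_bigr => i _.
  rewrite mulr_sumr -!(sumrB, big_split)/=; apply: eq_bigr => j _.
  by rewrite !mxE; ring.
have H1 : kp * (8 * (a ^+ 2 + U ^+ 2)) * fn2 (A - A0) <= 1 / 4 * fn2 (A - A0).
  rewrite ler_wpM2r ?fn2_ge0//; apply: le_trans kp1.
  rewrite ler_wpM2l ?(ltW kp_gt0)// ler_wpM2l//.
  have := mulr_gt0 a_gt0 U_gt0; rewrite sqrrD; lra.
have H2 := fn2B_le A M A0.
have kpp : 0 <= kp * p by rewrite mulr_ge0 ?ltW.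
have H3 : fn2 (A0 - M) - fn2 (A - M) + kp * (8 * (a ^+ 2 + U ^+ 2)) * fn2 (A - A0) <=
   3 / 2 * fn2 (A0 - M) - 1 / 2 * fn2 (A - M) by lra.
have := ler_wpM2l kpp H3.
apply: le_trans; rewrite le_eqVlt; apply/orP; left; apply/eqP; ring.
Qed.

End gibbs_risk.

Section minimax_upper_bound.
Variables (R : realType) (a U K : R).
Hypotheses (a_gt0 : 0 < a) (U_gt0 : 0 < U) (K501 : 501 <= K).

Lemma frob_norm_fn2 m (A : 'M[R]_m) : frob_norm A = Num.sqrt (fn2 A).
Proof. by []. Qed.

Lemma gibbs_tail_sum m l (F : seq 'M[R]_m) (M A0 : 'M[R]_m) (eps c : R) :
  (0 < m)%N -> (0 < l)%N -> 0 < eps -> 0 < c ->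
  separated l a eps F -> lowrank a l M -> fn2 (A0 - M) <= eps ^+ 2 ->
  c * eps ^+ 2 = 8 * (K * (m * (2 * l))%:R) ->
  \sum_(A <- F) (12 * eps ^+ 2 < fn2 (A - M))%R%:R * fn2 (A - M) *
     expR (c * (3 / 2 * fn2 (A0 - M) - 1 / 2 * fn2 (A - M))) <= 8 / c.
Proof.
move=> m0 l0 e0 c0 sF lM A0M ce; set d := (m * (2 * l))%:R : R.
have d0 : 0 <= d by exact: ler0n.
have Kge0 : 0 <= K by apply: le_trans K501; exact: ler0n.
have Kd0 : 0 <= K * d by exact: mulr_ge0.
have th : K * d <= c / 8 * eps ^+ 2.
  rewrite (_ : c / 8 * eps ^+ 2 = c * eps ^+ 2 / 8); last by ring.
  by rewrite ce [8 * _]mulrC mulfK.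
have S := separated_sum m0 l0 e0 K501 sF lM th.
apply: (@le_trans _ _ (8 / c * expR (- (12 * (K * d))) *
   \sum_(A <- F) expR (- (c / 8 * fn2 (A - M))))); last first.
  rewrite -[leRHS]mulr1 -mulrA ler_wpM2l ?divr_ge0 ?(ltW c0)//.
  apply: (le_trans (ler_wpM2l (expR_ge0 _) S)).
  rewrite -expRD expR_le1 -/d.
  have -> : - (12 * (K * d)) + (2 * K + 6) * d = - ((10 * K - 6) * d) by ring.
  by rewrite oppr_le0 mulr_ge0//; have := K501; lra.
rewrite [leRHS]mulr_sumr; apply: ler_sum => A _; set D := fn2 (A - M).
have [TD|_] := ltP (12 * eps ^+ 2) D; last first.
  by rewrite !mul0r !mulr_ge0 ?expR_ge0 ?invr_ge0 ?(ltW c0).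
rewrite [true%:R * D]mul1r -[leRHS]mulrA -expRD.
have DE : D <= 8 / c * expR (c * D / 8).
  have := expR_ge1Dx (c * D / 8) => H.
  rewrite -(ler_pM2l c0) !mulrA.
  have -> : c * 8 / c = 8 by field; rewrite gt_eqF.
  lra.
apply: (le_trans (ler_wpM2r (expR_ge0 _) DE)).
rewrite -[leLHS]mulrA -expRD ler_wpM2l ?divr_ge0 ?(ltW c0)// ler_expR.
(* With D absorbed into exp (c D / 8), the exponent is at most 12 K d - 3/8 c D. It must be below
   -12 K d - c D / 8, that is c D >= 96 K d: this fixes the threshold 12 eps^2. The gain exp (- 12 K
   d) then beats the packing sum exp ((2 K + 6) d). *)
have E1 : c * fn2 (A0 - M) <= 8 * (K * d) by rewrite -ce ler_wpM2l ?(ltW c0).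
have E2 : 12 * (8 * (K * d)) <= c * D.
  rewrite -ce mulrCA ler_wpM2l ?(ltW c0)//; exact: ltW.
have -> : c * (3 / 2 * fn2 (A0 - M) - 1 / 2 * D) =
   3 / 2 * (c * fn2 (A0 - M)) - 1 / 2 * (c * D) by ring.
have -> : c / 8 * D = (c * D) / 8 by ring.
move: (K * d) (c * D) (c * fn2 _) E1 E2 => u v w E1 E2.
clear -E1 E2; lra.
Qed.

Lemma gibbs_risk_le n m l sigma (X : experiment n m U sigma) (F : seq 'M[R]_m)
    (M : 'M[R]_m) (eps kp s : R) : let p := n%:R / m%:R ^+ 2 : R in
  (0 < m)%N -> (0 < l)%N -> 0 < eps -> 0 < kp -> 0 < p -> 0 < s ->
  kp * (8 * (a + U) ^+ 2) <= 1 / 4 -> sigma ^+ 2 <= U ^+ 2 ->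
  separated l a eps F ->
  (forall M, lowrank a l M -> exists2 A, A \in F & fn2 (A - M) <= eps ^+ 2) ->
  lowrank a l M ->
  kp * p * eps ^+ 2 = 8 * (K * (m * (2 * l))%:R) ->
  12 * eps ^+ 2 + 8 / (kp * p) <= s ^+ 2 ->
  (\int[eprob X]_w (frob_norm (gibbs F kp p (observe M w) - M))%:E <= s%:E)%E.
Proof.
move=> p m0 l0 e0 kp0 p0 s0 kp1 sU sF netF lM kpe Ts.
have [A0 A0F A0M] := netF M lM.
have T0 : 0 <= 12 * eps ^+ 2 by rewrite mulr_ge0// sqr_ge0.
pose c A : R := (12 * eps ^+ 2 < fn2 (A - M))%R%:R * fn2 (A - M).
have c_ge0 A : 0 <= c A by rewrite mulr_ge0 ?fn2_ge0.
pose ra A (w : espace X) := gibbs_weight kp p A (observe M w) / gibbs_weight kp p A0 (observe M w).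
have ra_ge0 A w : 0 <= ra A w by rewrite divr_ge0// expR_ge0.
have mra A : measurable_fun setT (ra A) by exact: measurable_gibbs_ratio.
have s2 : 0 < 2 * s by rewrite mulr_gt0.
(* By sqrt x <= (x / s + s) / 2, the risk is bounded by an expression affine in the squared loss, to
   which [gibbs_le] applies. *)
apply: (@le_trans _ _ (\int[eprob X]_w (((12 * eps ^+ 2) / s + s) / 2 +
   \sum_(A <- F) c A / (2 * s) * ra A w)%:E)%E).
  apply: ge0_le_integral => //.
  - by move=> w _; rewrite lee_fin sqrtr_ge0.
  - apply/measurable_EFinP; apply: measurable_frob_gibbs; exact: A0F.
  - apply/measurable_EFinP; apply: measurable_funD => //.
    by apply: measurable_sum => A; exact: measurable_funM.
  - move=> w _; rewrite lee_fin frob_norm_fn2.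
    have := gibbs_le kp p M (observe M w) A0F T0.
    set x := fn2 _; have x0 : 0 <= x by exact: fn2_ge0.
    move=> xle.
    have -> : \sum_(A <- F) c A / (2 * s) * ra A w = (\sum_(A <- F) c A * ra A w) / (2 * s).
      by rewrite mulr_suml; apply: eq_bigr => A _; ring.
    apply: (@le_trans _ _ ((x / s + s) / 2)).
      have := sqr_ge0 (Num.sqrt x - s); rewrite sqrrB sqr_sqrtr// => H.
      rewrite ler_pdivlMr// -(ler_pM2r s0) mulrDl divfK ?gt_eqF//; lra.
    have -> : ((12 * eps ^+ 2) / s + s) / 2 + (\sum_(A <- F) c A * ra A w) / (2 * s) =
      ((12 * eps ^+ 2 + \sum_(A <- F) c A * ra A w) / s + s) / 2 by field; rewrite gt_eqF.
    by rewrite ler_wpM2r// lerD2r ler_wpM2r// invr_ge0 ltW.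
have k_ge0 A : 0 <= c A / (2 * s) by rewrite divr_ge0 ?(ltW s2).
under eq_integral do rewrite EFinD.
rewrite ge0_integralD//; last 3 first.
- by move=> w _; rewrite lee_fin divr_ge0// addr_ge0 ?(ltW s0)// divr_ge0 ?(ltW s0).
- by move=> w _; rewrite lee_fin sumr_ge0// => A _; rewrite mulr_ge0.
- apply/measurable_EFinP.
  by apply: measurable_sum => A; exact: measurable_funM.
rewrite integral_cst// [X in (_ * X)%E](_ : _ = 1%E) ?mule1; last exact: probability_setT.
under eq_integral do (rewrite -sumEFin; under eq_bigr do rewrite EFinM).
rewrite ge0_integral_sum//; last 2 first.
- move=> A; apply/measurable_EFinP; exact: measurable_funM.
- by move=> A w _; rewrite lee_fin mulr_ge0.
apply: (@le_trans _ _ ((((12 * eps ^+ 2) / s + s) / 2)%:E +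
    \sum_(A <- F) (c A / (2 * s) *
      expR (kp * p * (3 / 2 * fn2 (A0 - M) - 1 / 2 * fn2 (A - M))))%:E)%E).
  rewrite leeD2l// big_seq [leRHS]big_seq; apply: lee_sum => A AF.
  rewrite ge0_integralZl//; [|exact/measurable_EFinP|by move=> *; rewrite lee_fin ?ra_ge0|by rewrite lee_fin k_ge0].
  rewrite [leRHS]EFinM lee_wpmul2l ?lee_fin//.
  case: sF => _ lF _; apply: (integral_gibbs_ratio X a_gt0 U_gt0 sU kp0 kp1 p0).
  - by move=> i j; exact: lowrank_le lM.
  - by move=> i j; exact: lowrank_le (lF A AF).
  - by move=> i j; exact: lowrank_le (lF A0 A0F).
rewrite sumEFin -EFinD lee_fin.
have kpp : 0 < kp * p by rewrite mulr_gt0.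
have tail := gibbs_tail_sum m0 l0 e0 kpp sF lM A0M kpe.
have -> : \sum_(A <- F) c A / (2 * s) *
      expR (kp * p * (3 / 2 * fn2 (A0 - M) - 1 / 2 * fn2 (A - M))) =
    (\sum_(A <- F) c A * expR (kp * p * (3 / 2 * fn2 (A0 - M) - 1 / 2 * fn2 (A - M)))) / (2 * s).
  by rewrite mulr_suml; apply: eq_bigr => A _; ring.
apply: (@le_trans _ _ (((12 * eps ^+ 2) / s + s) / 2 + (8 / (kp * p)) / (2 * s))).
  by rewrite lerD2l ler_wpM2r// invr_ge0 ltW.
have -> : ((12 * eps ^+ 2) / s + s) / 2 + (8 / (kp * p)) / (2 * s) =
    ((12 * eps ^+ 2 + 8 / (kp * p)) / s + s) / 2.
  by move: (8 / (kp * p)) => q; field; rewrite gt_eqF.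
rewrite ler_pdivrMr// [s * 2]mulr_natr mulr2n lerD2r ler_pdivrMr// -expr2.
Qed.

Lemma minimax_risk_le n m l k0 (Sigma : set R) : (0 < n)%N -> (0 < m)%N ->
  (0 < l)%N -> (k0 <= l)%N -> Sigma `<=` `]0, U] ->
  (minimax_risk n m a U k0 Sigma <=
   (Num.sqrt (104 * 64 * K * (a + U) ^+ 2 * (l%:R * m%:R ^+ 3 / n%:R)))%:E)%E.
Proof.
move=> n0 m0 l0 k0l SU.
have n0' : 0 < n%:R :> R by rewrite ltr0n.
have m0' : 0 < m%:R :> R by rewrite ltr0n.
have l0' : 0 < l%:R :> R by rewrite ltr0n.
have K0 : 0 < K by apply: lt_le_trans K501; rewrite ltr0n.
have aU : 0 < a + U by rewrite addr_gt0.
pose p : R := n%:R / m%:R ^+ 2.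
have p0 : 0 < p by rewrite divr_gt0// exprn_gt0.
(* The value with equality in the condition kp 8 (a + U)^2 <= 1/4. *)
pose kp : R := (32 * (a + U) ^+ 2)^-1.
have kp0 : 0 < kp by rewrite invr_gt0 mulr_gt0// exprn_gt0.
pose d : R := (m * (2 * l))%:R.
have d1 : 1 <= d by rewrite ler1n muln_gt0 m0 muln_gt0.
have d_gt0 : 0 < d by exact: lt_le_trans d1.
pose eps := Num.sqrt (8 * (K * d) / (kp * p)).
have epos : 0 < 8 * (K * d) / (kp * p).
  by apply: divr_gt0; apply: mulr_gt0 => //; exact: mulr_gt0.
have eps0 : 0 < eps by rewrite sqrtr_gt0.
have eps2 : eps ^+ 2 = 8 * (K * d) / (kp * p) by rewrite sqr_sqrtr// ltW.
set B := _ * (_ / _) : R.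
(* The 104 is 96 from 12 eps^2 plus 8 from the tail, using 1 <= K d. The 64 is 32 from 1 / kp times
   2 from d = 2 l m, differences of rank-l matrices having rank at most 2 l. *)
have BE : B = 104 * (K * d) / (kp * p).
  rewrite /B /kp /p /d !natrM; field.
  by rewrite !gt_eqF.
have B0 : 0 < B by rewrite BE; apply: divr_gt0; apply: mulr_gt0 => //; exact: mulr_gt0.
have [F [sF netF]] := exists_net m0 l0 eps0 (ltW a_gt0) K501.
apply: (@le_trans _ _ (ereal_sup (expectations n U (model a k0 Sigma)
    (fun th y => frob_norm (gibbs F kp p y - th.1))))).
  apply: ereal_inf_lbound; exists (gibbs F kp p) => //.
  move=> i j; have [A0 A0F _] := netF 0 (lowrank0 m l (ltW a_gt0)).
  exact: measurable_gibbs A0F.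
apply: ub_ereal_sup => _ [[M sigma] [[/= [Ma rM] Ssigma] [X ->]]].
have /= := SU _ Ssigma; rewrite in_itv/= => /andP[sg0 sgU].
rewrite unlock; apply: (@gibbs_risk_le n m l sigma X F M eps kp (Num.sqrt B)) => //.
- by rewrite sqrtr_gt0.
- rewrite /kp le_eqVlt; apply/orP; left; apply/eqP; field.
  by rewrite gt_eqF.
- by rewrite lerXn2r ?nnegrE ?(ltW sg0) ?(ltW U_gt0).
- by split => //; exact: leq_trans rM k0l.
- by rewrite -/p -/d eps2 mulrC divfK// gt_eqF// mulr_gt0.
- rewrite eps2 sqr_sqrtr ?(ltW B0)// BE -/p.
  rewrite mulrA -mulrDl ler_wpM2r ?invr_ge0 ?(ltW (mulr_gt0 kp0 p0))//.
  have : 1 <= K * d.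
    have K1 : 1 <= K by apply: le_trans K501; rewrite ler1n.
    by rewrite (le_trans K1)// ler_peMr// ltW.
  by move: (K * d) => u u1; lra.
Qed.

End minimax_upper_bound.

(** * Lower bound on the diameter *)

Section finite_sample_lower_bound.
Variables (R : realType) (n m : nat).
Local Notation I := ('I_m * 'I_m)%type.
Local Notation p := (n%:R / m%:R ^+ 2 : R).
Hypothesis nm : (n <= m ^ 2)%N.

Definition obs_prob (M : 'M[R]_m) (ev : set (data R m)) : R :=
  \sum_o obs_law n M o * (obs_data R o \in ev)%:R.

Lemma obs_law_ge0 (M : 'M[R]_m) o : (forall i j, `|M i j| <= 1) -> 0 <= obs_law n M o.
Proof.
move=> M1; apply: prodr_ge0 => ij _; have /andP[p0 p1] := p01 R nm.
rewrite /obs_weight; case: (o ij) => [s|]; last by rewrite subr_ge0.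
rewrite mulr_ge0// divr_ge0//; have := M1 ij.1 ij.2; rewrite ler_norml.
by case: s; rewrite /sgb ?expr1 ?expr0 ?mulr1 ?mulrN1; lra.
Qed.

Lemma sum_obs_law (M : 'M[R]_m) : \sum_o obs_law n M o = 1.
Proof.
rewrite -(sum_obs_law0_likelihood n M); apply: eq_bigr => o _.
exact: obs_law_likelihood.
Qed.

Lemma le_obs_prob (M : 'M[R]_m) ev ev' : (forall i j, `|M i j| <= 1) ->
  ev `<=` ev' -> obs_prob M ev <= obs_prob M ev'.
Proof.
move=> M1 evev'; apply: ler_sum => o _; rewrite ler_wpM2l ?obs_law_ge0// ler_nat.
by have [/set_mem/evev'/mem_set->|] := boolP (obs_data R o \in ev).
Qed.

Lemma obs_probC (M : 'M[R]_m) ev : obs_prob M (~` ev) = 1 - obs_prob M ev.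
Proof.
rewrite -(sum_obs_law M) -sumrB; apply: eq_bigr => o _.
by rewrite in_setC; case: (_ \in ev); rewrite /= ?mulr0 ?mulr1 ?subrr ?subr0.
Qed.

Lemma obs_probU_le (M : 'M[R]_m) ev ev' : (forall i j, `|M i j| <= 1) ->
  obs_prob M (ev `|` ev') <= obs_prob M ev + obs_prob M ev'.
Proof.
move=> M1; rewrite /obs_prob -big_split; apply: ler_sum => o _ /=.
rewrite -mulrDr ler_wpM2l ?obs_law_ge0// -natrD ler_nat in_setU.
by case: (_ \in ev); case: (_ \in ev').
Qed.

Section separation.
Variables (k : nat) (k_gt0 : (0 < k)%N) (a u sigma kap delta beta : R).
Variables (Sigma : set R) (C : data R m -> set ('M[R]_m * R)).
Hypotheses (n_gt0 : (0 < n)%N) (km : (k ^ 3 <= m)%N).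
Hypotheses (kap0 : 0 < kap) (kap4 : kap <= 1 / 4) (delta0 : 0 < delta).
Hypothesis kap_delta : expR (70 * kap ^+ 3) <= 1 + delta ^+ 2.
Hypotheses (u0 : 0 <= u) (u1 : u <= 1).
Hypothesis uE : u ^+ 2 = kap * Num.sqrt k%:R * (m%:R / n%:R).
Hypothesis a0 : 0 <= a.
Hypothesis CM : forall y, C y `<=` model a k Sigma.

Definition alternative (th : prior m k) : 'M[R]_m := u *: prior_mx R k_gt0 th.

Lemma alternativeE th i j : alternative th i j = u * prior_mx R k_gt0 th i j.
Proof. by rewrite mxE. Qed.

Lemma alternative_sqr th i j : alternative th i j ^+ 2 = u ^+ 2.
Proof. by rewrite alternativeE exprMn prior_mx_sqr mulr1. Qed.

Lemma alternative_norm th i j : `|alternative th i j| = u.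
Proof. by rewrite -sqrtr_sqr alternative_sqr sqrtr_sqr ger0_norm. Qed.

Lemma frob_norm_alternative th : frob_norm (alternative th) = u * m%:R.
Proof.
rewrite /frob_norm; under eq_bigr do under eq_bigr do rewrite alternative_sqr.
rewrite !sumr_const !card_ord -mulrnA mulnn.
have -> : u ^+ 2 *+ (m ^ 2) = (u * m%:R) ^+ 2 by rewrite exprMn -natrX mulr_natr.
by rewrite sqrtr_sqr ger0_norm// mulr_ge0.
Qed.

(** The choice of u makes p u^2 equal to kap sqrt k / m, the q of the prior bound. *)
Lemma null_prob_le ev A : (forall th, obs_prob (alternative th) ev <= A) ->
  obs_prob 0 ev <= A + delta.
Proof.
move=> H; pose F o : R := (obs_data R o \in ev)%:R.
have F01 o : 0 <= F o <= 1 by rewrite /F; case: (_ \in _); rewrite /= ?ler01 ?lexx.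
have m0 : (0 < m)%N by rewrite (leq_trans _ km)// expn_gt0 k_gt0.
have chi : avg (fun t => avg (fun t' =>
    \prod_i \prod_j (1 + p * (alternative t i j * alternative t' i j)))) <= 1 + delta ^+ 2.
  apply: le_trans kap_delta; pose q : R := kap * Num.sqrt k%:R / m%:R.
  apply: le_trans (@avg_prior_chi2 R m k k_gt0 kap q km (ltW kap0) kap4 erefl).
  rewrite le_eqVlt; apply/orP; left; apply/eqP.
  apply: eq_avg => t; apply: eq_avg => t'; apply: eq_bigr => i _; apply: eq_bigr => j _.
  congr (1 + _); rewrite !alternativeE.
  rewrite (_ : p * _ = p * u ^+ 2 * (prior_mx R k_gt0 t i j * prior_mx R k_gt0 t' i j)).
    congr (_ * _); rewrite uE /q; field.
    by rewrite !pnatr_eq0 -!lt0n n_gt0 m0.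
  by ring.
apply: (le_trans (null_le_mixture nm (prior0 m k_gt0) delta0 F01 chi)).
by rewrite lerD2r; apply: (avg_le_avg_le (prior0 m k_gt0)).
Qed.

Lemma frob_diam_ge y th th' : C y th -> C y th' ->
  frob_norm (th.1 - th'.1) <= frob_diam (C y).
Proof.
move=> Cth Cth'; apply: ub_le_sup; last by exists th, th'.
exists (Num.sqrt (2 * (a * m%:R) ^+ 2 + 2 * (a * m%:R) ^+ 2)).
move=> _ [t [t' [/CM[/= lt _] /CM[/= lt' _] ->]]].
rewrite ler_wsqrtr// -/(fn2 _) (le_trans (fn2D_le _ _))// fn2N.
by rewrite lerD// ler_wpM2l//; apply: fn2_lowrank_le; eauto.
Qed.

(** Under an alternative, covering (0, 1) with too small a diameter excludes covering the truth, so
    this event has probability at most beta. Passing to the null costs delta, and failure to cover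
    (0, 1) costs another beta. *)
Lemma diam_lower_bound :
  (forall th, 1 - beta <= obs_prob (alternative th) [set y | C y (alternative th, sigma)]) ->
  1 - beta <= obs_prob 0 [set y | C y (0, 1)] ->
  1 - 2 * beta - delta <= obs_prob 0 [set y | u * m%:R <= frob_diam (C y)].
Proof.
move=> H1 H0.
pose ev := [set y | C y (0, 1) /\ frob_diam (C y) < u * m%:R].
have ev_le : obs_prob 0 ev <= beta + delta.
  apply: null_prob_le => th.
  apply: (@le_trans _ _ (obs_prob (alternative th) (~` [set y | C y (alternative th, sigma)]))).
    apply: le_obs_prob => [i j|y [Cy0 dy] Cyth]; first by rewrite alternative_norm.
    have := frob_diam_ge Cyth Cy0.
    by rewrite /= subr0 frob_norm_alternative leNgt dy.
  by rewrite obs_probC; have := H1 th; lra.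
have z1 i j : `|(0 : 'M[R]_m) i j| <= 1 by rewrite mxE normr0.
have : obs_prob 0 [set y | C y (0, 1)] <=
    obs_prob 0 (ev `|` [set y | u * m%:R <= frob_diam (C y)]).
  apply: le_obs_prob => // y Cy; have [?|?] := leP (u * m%:R) (frob_diam (C y)).
    by right.
  by left.
have := obs_probU_le ev [set y | u * m%:R <= frob_diam (C y)] z1.
lra.
Qed.

End separation.
End finite_sample_lower_bound.

(** * Limits along the regime *)

Section regime_filter.
Variable D : set (nat * nat).

#[local] Instance regime_filter : Filter (regime D).
Proof. exact: within_filter. Qed.

Lemma near_regime_in : \forall nm \near regime D, D nm.
Proof. exact: withinT. Qed.

(** Unboundedness of [D] makes the filter proper, so contradictory eventual properties can be
    confronted at one pair. *)
Lemma regime_nonempty (P : nat * nat -> Prop) :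
  (forall N : nat, exists n m, [/\ D (n, m), (N <= n)%N & (N <= m)%N]) ->
  (\forall nm \near regime D, P nm) -> exists nm, D nm /\ P nm.
Proof.
move=> DN [[A B] [/= [N1 _ A1] [N2 _ B2]] AB].
have [n [m [Dnm Nn Nm]]] := DN (maxn N1 N2).
exists (n, m); split => //; apply: (AB (n, m)) => //; split => /=.
  by apply: A1; rewrite /= (leq_trans (leq_maxl _ _) Nn).
by apply: B2; rewrite /= (leq_trans (leq_maxr _ _) Nm).
Qed.

Lemma limf_esup_near (R : realType) (f : nat * nat -> \bar R) (t c : \bar R) :
  limf_esup f (regime D) = t -> (t < c)%E -> \forall nm \near regime D, (f nm < c)%E.
Proof.
move=> ft tc; move: tc; rewrite -ft => /ereal_inf_lt[_ [V VF <-] Vc].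
apply: filterS VF => nm Vnm; apply: le_lt_trans Vc.
by apply: ereal_sup_ubound; exists nm.
Qed.

Lemma limf_einf_near (R : realType) (f : nat * nat -> \bar R) (t c : R) :
  (t%:E <= limf_einf f (regime D))%E -> c < t ->
  \forall nm \near regime D, (c%:E < f nm)%E.
Proof.
rewrite /limf_einf leeNr => tf ct.
have : (limf_esup (\- f)%E (regime D) < (- c)%:E)%E.
  by apply: le_lt_trans tf _; rewrite -EFinN lte_fin ltrN2.
move=> /ereal_inf_lt[_ [V VF <-] Vc].
apply: filterS VF => nm Vnm.
have : ((- f nm) < (- c)%:E)%E.
  by apply: le_lt_trans Vc; apply: ereal_sup_ubound; exists nm.
by rewrite EFinN lteN2.
Qed.

End regime_filter.
#[local] Existing Instance regime_filter.

Section separation_scale.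
Variables (R : realType) (a U : R) (Sigma : set R) (D : set (nat * nat)).
Variables (k k0 : nat -> nat -> nat) (tau : R).
Hypotheses (a_gt0 : 0 < a) (U2 : 2 <= U).
Hypothesis S : lower_bound_setting a U Sigma D k k0 tau.

Lemma one_in_Sigma : Sigma 1.
Proof.
have [s s1 sS] := Sigma_nondeg S; apply: sS; rewrite /= in_itv/= lexx andbT.
exact: ltW.
Qed.

(* The scale of the alternatives, up to the factor sqrt kap. *)
Definition scale (nm : nat * nat) : R :=
  (k nm.1 nm.2)%:R `^ (4^-1) * Num.sqrt (nm.2%:R / nm.1%:R).

Lemma scale_ge0 nm : 0 <= scale nm.
Proof. by rewrite mulr_ge0 ?powR_ge0 ?sqrtr_ge0. Qed.

Lemma scale_sqr nm : scale nm ^+ 2 = Num.sqrt (k nm.1 nm.2)%:R * (nm.2%:R / nm.1%:R).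
Proof.
rewrite exprMn [X in _ * X]sqr_sqrtr ?divr_ge0//; congr (_ * _).
rewrite -powR_mulrn ?powR_ge0// -powRrM -powR12_sqrt//; congr (_ `^ _).
by field.
Qed.

Lemma scale_lt n m : D (n, m) -> scale (n, m) < Num.min 1 a / 2.
Proof. exact: (k_n S). Qed.

Lemma k3_le n m : D (n, m) -> (k n m ^ 3 <= m)%N.
Proof.
move=> Dnm; have [_ km] := k_m S Dnm.
rewrite -(ler_nat R) natrX.
have -> : m%:R = (m%:R `^ 3^-1) ^+ 3 :> R.
  by rewrite -powR_mulrn ?powR_ge0// -powRrM mulVf// powRr1.
by rewrite lerXn2r ?nnegrE ?powR_ge0.
Qed.

(** Since kap x^2 <= x at the scales that occur, the limsup controls the variance loss. If tau > 0,
    the scale is eventually below 2 tau, and the interval ending at 1 - 4 tau leaves room. If tau <=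
    0, it is eventually below 1 - s^2, and the interval from s to 1 is used. *)
Lemma near_sigma_in (kap : R) : 0 < kap -> kap <= 1 / 4 ->
  \forall nm \near regime D, Sigma (Num.sqrt (1 - kap * scale nm ^+ 2)).
Proof.
move=> kap0 kap4.
have Din := near_regime_in D.
have half nm : D nm -> scale nm < 1 / 2.
  case: nm => n m /scale_lt /lt_le_trans; apply.
  by rewrite ler_wpM2r// ge_min lexx.
have sub1 nm : 0 <= kap * scale nm ^+ 2 by rewrite mulr_ge0 ?sqr_ge0// ltW.
have sq1 nm : D nm -> Num.sqrt (1 - kap * scale nm ^+ 2) <= 1.
  by move=> Dnm; rewrite -[leRHS]sqrtr1 ler_wsqrtr// lerBlDr lerDl sub1.
have kapx x : 0 <= x -> x < 1 / 2 -> kap * x ^+ 2 <= x.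
  move=> x0 x2; rewrite expr2 mulrA ler_piMl//.
  have := ler_pM (ltW kap0) x0 kap4 (ltW x2); lra.
have [tau0|tau0] := ltP 0 tau.
  have : \forall nm \near regime D, ((scale nm)%:E < (2 * tau)%:E)%E.
    by apply: (limf_esup_near (tau_limsup S)); rewrite lte_fin; lra.
  apply: filterS2 Din => nm Dnm; rewrite lte_fin => snm.
  apply: (Sigma_itv S); rewrite /= in_itv/= sq1// andbT ler_wsqrtr//.
  have := kapx _ (scale_ge0 nm) (half _ Dnm); lra.
have [s s1 sS] := Sigma_nondeg S.
have s0 : 0 < s.
  have : Sigma s by apply: sS; rewrite /= in_itv/= lexx ltW.
  by move=> /(Sigma_U S); rewrite /= in_itv/= => /andP[].
have : \forall nm \near regime D, ((scale nm)%:E < (1 - s ^+ 2)%:E)%E.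
  apply: (limf_esup_near (tau_limsup S)); rewrite lte_fin (le_lt_trans tau0)//.
  by rewrite subr_gt0 expr_lt1// ltW.
apply: filterS2 Din => nm Dnm; rewrite lte_fin => snm.
apply: sS; rewrite /= in_itv/= sq1// andbT -[leLHS]ger0_norm ?(ltW s0)//.
rewrite -sqrtr_sqr ler_wsqrtr//.
have := kapx _ (scale_ge0 nm) (half _ Dnm); lra.
Qed.

End separation_scale.

Lemma exists_kap (R : realType) (delta : R) : 0 < delta -> exists2 kap : R,
  0 < kap <= 1 / 4 & expR (70 * kap ^+ 3) <= 1 + delta ^+ 2.
Proof.
move=> d0; have d2 : 0 < delta ^+ 2 by rewrite exprn_gt0.
(* With z = 70 kap^3 <= 1/2, exp z <= 1 + z + 2 z^2 <= 1 + 2 z, and 2 z <= 140 kap <= delta^2. *)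
exists (Num.min 1 (delta ^+ 2) / 140).
  rewrite divr_gt0 ?lt_min ?ltr01//=.
  by rewrite ler_pdivrMr// ge_min; apply/orP; left; lra.
set kap := _ / 140.
have [kap0 kap1 kap2] : [/\ 0 < kap, 140 * kap <= 1 & 140 * kap <= delta ^+ 2].
  rewrite /kap divr_gt0 ?lt_min ?ltr01//= mulrCA mulfV ?mulr1//.
  by rewrite !ge_min !lexx orbT.
have kap3 : kap ^+ 3 <= kap by rewrite -[leRHS]expr1 ler_wiXn2l//; lra.
have kap30 : 0 < kap ^+ 3 by rewrite exprn_gt0.
apply: le_trans (expR_le1D _) _; first lra.
have : 2 * (70 * kap ^+ 3) ^+ 2 <= 70 * kap ^+ 3.
  by rewrite expr2 mulrCA; apply: ler_piMr; lra.
lra.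
Qed.

Section near_lower_bound.
Variables (R : realType) (a U : R) (Sigma : set R) (D : set (nat * nat)).
Variables (k k0 : nat -> nat -> nat) (tau : R).
Hypotheses (a_gt0 : 0 < a) (U2 : 2 <= U).
Hypothesis S : lower_bound_setting a U Sigma D k k0 tau.
Variable C : confidence_procedure R.
Arguments C : clear implicits.
Hypothesis confC : confidence_set a Sigma D k C.

Lemma honest_near alpha beta : honest a U Sigma D k alpha C -> alpha < beta ->
  \forall nm \near regime D, forall th, model a (k nm.1 nm.2) Sigma th ->
    forall X : experiment nm.1 nm.2 U th.2,
    ((1 - beta)%:E <= eprob X [set w | C nm.1 nm.2 (observe th.1 w) th])%E.
Proof.
move=> hC ab; have ba : 1 - beta < 1 - alpha by rewrite ltrD2l ltrN2.
apply: filterS (limf_einf_near hC ba) => nm /ltW h th Mth X.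
by apply: le_trans h _; apply: ereal_inf_lbound; exists th; split => //; exists X.
Qed.

Section null.
Variables (n m : nat).
Hypothesis nm : (n <= m ^ 2)%N.

Let null01 : 0 <= (0 : R) <= 1. Proof. by rewrite lexx ler01. Qed.
Let null_entry (i j : 'I_m) : (0 : 'M[R]_m) i j ^+ 2 = 0 ^+ 2.
Proof. by rewrite mxE. Qed.
Let null_var : (1 : R) ^+ 2 = 1 - 0 ^+ 2.
Proof. by rewrite expr1n expr0n subr0. Qed.

Definition null_experiment : experiment n m U 1 :=
  two_point_experiment nm null01 null_entry null_var U2.

Lemma null_in_model l : model a l Sigma (0 : 'M[R]_m, 1).
Proof. by split; [exact/lowrank0/ltW | exact: one_in_Sigma S]. Qed.

Lemma prob_null ev : eprob null_experiment [set w | ev (observe 0 w)] =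
  (obs_prob n 0 ev)%:E.
Proof. exact: prob_two_point. Qed.

Lemma null_prob_in_probs l ev :
  probs n U (model a l Sigma) (fun _ => ev) (obs_prob n (0 : 'M[R]_m) ev)%:E.
Proof.
exists (0, 1); split; first exact: null_in_model.
by exists null_experiment; rewrite prob_null.
Qed.

Lemma null_expectation_in l (f : data R m -> R) :
  expectations n U (model a l Sigma) (fun _ => f)
    (\sum_o obs_law n (0 : 'M[R]_m) o * f (obs_data R o))%:E.
Proof.
exists (0, 1); split; first exact: null_in_model.
by exists null_experiment; rewrite expectation_two_point.
Qed.

End null.

Lemma near_diam_lower_bound alpha beta delta kap : alpha < beta -> 0 < delta ->
  0 < kap -> kap <= 1 / 4 -> expR (70 * kap ^+ 3) <= 1 + delta ^+ 2 ->
  honest a U Sigma D k alpha C ->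
  \forall nm \near regime D, 1 - 2 * beta - delta <= obs_prob nm.1 0
    [set y | Num.sqrt kap * scale R k nm * nm.2%:R <= frob_diam (C nm.1 nm.2 y)].
Proof.
move=> ab d0 kap0 kap4 kapd hC.
apply: filterS3 (near_regime_in D) (near_sigma_in S kap0 kap4)
  (honest_near hC ab) => -[n m] Dnm /= sig cov.
have /andP[n0 nm] := D_n S Dnm; have [kn0 _] := k_m S Dnm.
have sc0 : 0 <= scale R k (n, m) by exact: scale_ge0.
have := scale_lt S Dnm; rewrite ltr_pdivlMr// lt_min => /andP[sc1 sca].
have sk : Num.sqrt kap <= 1.
  by rewrite -[leRHS]sqrtr1 ler_wsqrtr//; lra.
have sk0 := sqrtr_ge0 kap.
(* The bound by min (1, a) / 2 on the scale gives u <= 1, needed for means of signs, and u <= a,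
   needed to stay in the model. *)
set u := Num.sqrt kap * scale R k (n, m).
have u0 : 0 <= u by rewrite mulr_ge0.
have usc : u <= scale R k (n, m) by rewrite ler_piMl.
have u1 : u <= 1 by lra.
have ua : u <= a by lra.
have u2 : u ^+ 2 = kap * scale R k (n, m) ^+ 2.
  by rewrite exprMn sqr_sqrtr// ltW.
have su : Num.sqrt (1 - kap * scale R k (n, m) ^+ 2) ^+ 2 = 1 - u ^+ 2.
  by rewrite -u2 sqr_sqrtr// subr_ge0 expr_le1.
have u01 : 0 <= u <= 1 by rewrite u0.
apply: (diam_lower_bound (k_gt0 := kn0)
  (sigma := Num.sqrt (1 - kap * scale R k (n, m) ^+ 2)) nm n0 (k3_le S Dnm)
  kap0 kap4 d0 kapd u0 u1 _ (ltW a_gt0) _) => [|y|th|].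
- by rewrite u2 scale_sqr/= mulrA.
- by have [] := confC Dnm.
- have Mth : model a (k n m) Sigma
    (alternative kn0 u th, Num.sqrt (1 - kap * scale R k (n, m) ^+ 2)).
    split => //=; split.
      by apply: mx_norm_le; rewrite ?ltW// => i j; rewrite alternative_norm.
    exact: leq_trans (mxrankS (scalemx_sub _ (submx_refl _))) (rank_prior_mx _ _ _).
  have := cov _ Mth (two_point_experiment nm u01 (alternative_sqr kn0 u th) su U2).
  by rewrite (prob_two_point _ _ _ _ _
    [set y | C n m y (alternative kn0 u th, _)]) lee_fin.
- have := cov _ (null_in_model m (k n m)) (null_experiment nm).
  by rewrite (prob_null _ [set y | C n m y (0, 1)]) lee_fin.
Qed.

End near_lower_bound.

Lemma null_sum_ge (R : realType) (n m : nat) (x : R) (f : data R m -> R) :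
  (n <= m ^ 2)%N -> 0 <= x ->
  x ^+ 2 * obs_prob n 0 [set y | x <= f y] <=
  \sum_o obs_law n (0 : 'M[R]_m) o * f (obs_data R o) ^+ 2.
Proof.
move=> nm x0; rewrite mulr_sumr; apply: ler_sum => o _.
rewrite mulrCA ler_wpM2l ?obs_law0_ge0//.
have [/set_mem/= xf|_] := boolP (_ \in _); last by rewrite mulr0 sqr_ge0.
by rewrite mulr1 lerXn2r ?nnegrE// (le_trans x0).
Qed.

Lemma separation_sqr (R : realType) (k : nat -> nat -> nat) (kap : R) n m :
  0 <= kap -> (0 < n)%N ->
  (Num.sqrt kap * scale R k (n, m) * m%:R) ^+ 2 =
  kap * (m%:R ^+ 3 * Num.sqrt (k n m)%:R / n%:R).
Proof.
move=> kap0 n0; rewrite 2!exprMn sqr_sqrtr// scale_sqr/=.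
by field; rewrite pnatr_eq0 -lt0n.
Qed.

Section rate.
Variables (R : realType) (a U : R) (Sigma : set R) (D : set (nat * nat)).
Variables (k k0 : nat -> nat -> nat) (tau : R).
Hypotheses (a_gt0 : 0 < a) (U2 : 2 <= U).
Hypothesis S : lower_bound_setting a U Sigma D k k0 tau.

(** The risk bound needs positive rank, so [k0 = 0] is replaced by 1; as k tends to infinity, 1 is
    o(sqrt k) as well. *)
Lemma near_maxn_k0_lt (rho : R) : 0 < rho ->
  \forall nm \near regime D,
    (maxn (k0 nm.1 nm.2) 1)%:R < rho * Num.sqrt (k nm.1 nm.2)%:R :> R.
Proof.
move=> rho0.
have kN : \forall nm \near regime D, ((Num.truncn (rho ^- 2)).+1 <= k nm.1 nm.2)%N.
  exact: (k_oo S (nbhs_infty_ge (Num.truncn (rho ^- 2)).+1)).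
have rho2 : 0 < rho / 2 by lra.
apply: filterS2 kN (k0_small S rho2) => -[n m] /= kN k0s.
have s1 : 1 < rho * Num.sqrt (k n m)%:R.
  rewrite -(@ltr_pM2l _ rho^-1) ?invr_gt0// mulr1 mulKf ?gt_eqF//.
  rewrite -[ltLHS]gtr0_norm ?invr_gt0// -sqrtr_sqr ltr_sqrt ?exprn_gt0 ?invr_gt0//.
    rewrite exprVn (lt_le_trans (truncnS_gt _))// ler_nat//.
  by rewrite ltr0n (leq_trans _ kN).
have : (maxn (k0 n m) 1)%:R <= Num.max (k0 n m)%:R 1 :> R.
  by rewrite /maxn; case: ifP => _; rewrite le_max lexx ?orbT.
move=> /le_lt_trans; apply; rewrite gt_max s1 andbT; lra.
Qed.

(** The rate is accessible only through the minimax risk: c1 r is at most the risk, which the Gibbs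
    estimator bounds. Adaptivity is thereby compared with the separation of the alternatives. *)
Lemma near_rate_lt kap K r : 0 < kap -> 0 < K -> is_minimax_rate a U Sigma D k0 r ->
  \forall nm \near regime D,
    K * r nm.1 nm.2 (k0 nm.1 nm.2) < Num.sqrt kap * scale R k nm * nm.2%:R.
Proof.
move=> kap0 K0 [c1 [c2 [c10 _ rate]]].
have [T T501] : exists T : R, 501 <= T by exists 501.
have U0 : 0 < U by exact: lt_le_trans U2.
have T0 : 0 < T by apply: lt_le_trans T501.
pose L := 104 * 64 * T * (a + U) ^+ 2.
have L0 : 0 < L.
  by rewrite /L mulr_gt0 ?exprn_gt0 ?addr_gt0// mulr_gt0// mulr_gt0.
(* Chosen so that, after squaring, L l < (c1 / K)^2 kap sqrt k becomes l < rho sqrt k. *)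
pose rho := kap * (c1 / K) ^+ 2 / L.
have rho0 : 0 < rho by rewrite /rho divr_gt0 // mulr_gt0 // exprn_gt0 // divr_gt0.
apply: filterS3 rate (near_regime_in D) (near_maxn_k0_lt rho0).
move=> -[n m] /= [lower _] Dnm lk.
have /andP[n0 nm] := D_n S Dnm; have [kn0 _] := k_m S Dnm.
have m0 : (0 < m)%N by apply: leq_trans (k3_le S Dnm); rewrite expn_gt0 kn0.
set l := maxn (k0 n m) 1 in lk.
have l0 : (0 < l)%N by rewrite leq_max orbT.
have := @minimax_risk_le R a U T a_gt0 U0 T501 n m l (k0 n m) Sigma n0 m0 l0
  (leq_maxl _ _) (Sigma_U S).
rewrite -/L => /(le_trans lower); rewrite lee_fin => rL.
have q0 : 0 < m%:R ^+ 3 / n%:R :> R by rewrite divr_gt0 ?exprn_gt0 ?ltr0n.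
rewrite -(@ltr_pM2l _ (c1 / K)) ?divr_gt0// mulrA divfK ?gt_eqF//.
apply: le_lt_trans rL _.
set v := (X in _ < _ * X).
have v0 : 0 <= v by rewrite !mulr_ge0 ?sqrtr_ge0 ?scale_ge0.
have cv0 : 0 <= c1 / K * v by rewrite mulr_ge0// divr_ge0// ltW.
have sL0 : 0 <= L * (l%:R * m%:R ^+ 3 / n%:R).
  by rewrite -mulrA mulr_ge0 ?(ltW L0)// mulr_ge0 ?(ltW q0).
rewrite -(ltr_pXn2r (isT : (0 < 2)%N)) ?nnegrE ?sqrtr_ge0// sqr_sqrtr//.
rewrite [ltRHS]exprMn.
rewrite separation_sqr ?(ltW kap0)//.
have -> : L * (l%:R * m%:R ^+ 3 / n%:R) = l%:R * (L * (m%:R ^+ 3 / n%:R)) by ring.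
have -> : (c1 / K) ^+ 2 * (kap * (m%:R ^+ 3 * Num.sqrt (k n m)%:R / n%:R)) =
   rho * Num.sqrt (k n m)%:R * (L * (m%:R ^+ 3 / n%:R)).
  rewrite /rho; have := gt_eqF L0; move: (L) => L' L'0.
  by field; rewrite L'0 pnatr_eq0 -lt0n n0 gt_eqF.
by rewrite ltr_pM2r// mulr_gt0.
Qed.

End rate.

Theorem corollary5p2 (R : realType) (a U : R) (ha : 0 < a) (hU : 2 <= U) :
  (forall (Sigma : set R) (D : set (nat * nat)) (k k0 : nat -> nat -> nat)
      (tau : R) (r : nat -> nat -> nat -> R),
    lower_bound_setting a U Sigma D k k0 tau ->
    is_minimax_rate a U Sigma D k0 r ->
    is_minimax_rate a U Sigma D k r ->
    forall alpha alpha' : R, 0 < alpha -> 0 < alpha' ->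
      2 * alpha + alpha' < 1 ->
      ~ exists C : confidence_procedure R,
          [/\ confidence_set a Sigma D k C,
              honest a U Sigma D k alpha C &
              adaptive a U Sigma D k k0 r alpha' C]) /\
  (forall alpha : R, 0 < alpha -> alpha < 3^-1 ->
    exists2 c : R, 0 < c &
      forall (Sigma : set R) (D : set (nat * nat)) (k k0 : nat -> nat -> nat)
        (tau : R),
      lower_bound_setting a U Sigma D k k0 tau ->
      forall C : confidence_procedure R,
        confidence_set a Sigma D k C ->
        honest a U Sigma D k alpha C ->
        \forall nm \near regime D,
          ((c * (nm.2%:R ^+ 3 * Num.sqrt (k nm.1 nm.2)%:R / nm.1%:R))%:E <=
           ereal_sup (expectations nm.1 U (model a (k0 nm.1 nm.2) Sigma)
             (fun _ y => frob_diam (C nm.1 nm.2 y) ^+ 2)%R))%E).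
Proof.
split=> [Sigma D k k0 tau r S rate0 _ alpha alpha' alpha0 alpha'0 sum1|alpha _ alpha3].
  move=> [C [confC honC [K K0 adC]]].
  (* Coverage slack is lost twice and the change of law once, 3 eta in all, out of the available 4
     eta. *)
  pose eta := (1 - 2 * alpha - alpha') / 4.
  have eta0 : 0 < eta by rewrite /eta; lra.
  have [kap /andP[kap0 kap4] kapd] := exists_kap eta0.
  have ab : alpha < alpha + eta by lra.
  have [[n m] [Dnm /= [lower rlt]]] := regime_nonempty (D_unbounded S)
    (filterI (near_diam_lower_bound ha hU S confC ab eta0 kap0 kap4 kapd honC)
      (near_rate_lt ha hU S kap0 K0 rate0)).
  have /andP[_ nm] := D_n S Dnm.
  have := adC n m Dnm _ (or_introl erefl).
  move=> /(le_trans (ereal_sup_ubound (null_prob_in_probs ha hU S nm _ _))).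
  rewrite lee_fin => upper.
  have : 1 - 2 * (alpha + eta) - eta <= alpha'.
    apply: le_trans lower (le_trans _ upper).
    apply: le_obs_prob => // [i j|y /=]; first by rewrite mxE normr0.
    exact: lt_le_trans.
  by rewrite /eta; lra.
(* As alpha < 1/3, the probability 1 - 2 (alpha + 1/12) - 1/12 exceeds 1/12, which is the factor in
   the constant [kap / 12]. *)
have d0 : 0 < 1 / 12 :> R by lra.
have [kap /andP[kap0 kap4] kapd] := exists_kap d0.
exists (kap / 12) => [|Sigma D k k0 tau S C confC honC]; first lra.
have ab : alpha < alpha + 1 / 12 by lra.
apply: filterS2 (near_regime_in D)
  (near_diam_lower_bound ha hU S confC ab d0 kap0 kap4 kapd honC) => -[n m] Dnm /= lower.
have /andP[n0 nm] := D_n S Dnm.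
apply: le_trans (ereal_sup_ubound (null_expectation_in ha hU S nm _ _)).
rewrite lee_fin; set x := _ * _ * _ in lower.
have x0 : 0 <= x by rewrite !mulr_ge0 ?sqrtr_ge0 ?scale_ge0.
(* Markov's inequality for the squared diameter under the null, which belongs to the sub-model for
   every [k0]. *)
apply: le_trans (null_sum_ge (fun y => frob_diam (C n m y)) nm x0).
have -> : kap / 12 * (m%:R ^+ 3 * Num.sqrt (k n m)%:R / n%:R) = x ^+ 2 * (1 / 12).
  by rewrite /x separation_sqr ?(ltW kap0)//; ring.
by rewrite ler_wpM2l ?sqr_ge0//; apply: le_trans lower; lra.
Qed.
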